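(* Let $\Omega\subset\mathbb{R}$ be a bounded open interval, let $\chi>0$, let $B_1,B_2$ be nonnegative bounded functions belonging to $C^\vartheta_{loc}(\overline\Omega\times[0,\infty))$ for some $\vartheta\in(0,1)$, and let $u_0\in C^0(\overline\Omega)$ with $u_0\ge0$ in $\Omega$ and $v_0\in W^{1,\infty}(\Omega)$ with $v_0>0$ in $\overline\Omega$. Let $(u,v)$ be the global classical solution of $$\begin{cases} u_t = u_{xx} - \chi\left(\frac{u}{v}v_x\right)_x - uv + B_1(x,t), & x\in\Omega,\ t>0,\\ v_t = v_{xx} + uv - v + B_2(x,t), & x\in\Omega,\ t>0,\\ u_x=v_x=0, & x\in\partial\Omega,\ t>0,\\ u(x,0)=u_0(x),\quad v(x,0)=v_0(x), & x\in\Omega.\end{cases}$$ If $$\inf_{t>0}\int_\Omega B_2(x,t)\,dx>0,$$ then there exists $C>0$ such that $$u(x,t)\le C\quad\text{and}\quad \frac1C\le v(x,t)\le C\qquad\text{for all }x\in\Omega\text{ and }t>0.$$ If additionally $$\int_t^{t+1}\int_\Omega B_1(x,s)\,dx\,ds\to0\qquad\text{as }t\to\infty,$$ then $$u(\cdot,t)\to0\quad\text{in }L^\infty(\Omega)\qquad\text{as }t\to\infty.$$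
   Context: $C^\vartheta_{loc}$ denotes local H\''older continuity with exponent $\vartheta$. Under the stated assumptions on $\chi,B_1,B_2,u_0,v_0$, the problem has a global classical solution $(u,v)$ with $u,v>0$ in $\overline\Omega\times(0,\infty)$, for each $r>1$ uniquely determined by $u\in C^0(\overline\Omega\times[0,\infty))\cap C^{2,1}(\overline\Omega\times(0,\infty))$ and $v\in C^0([0,\infty);W^{1,r}(\Omega))\cap C^{2,1}(\overline\Omega\times(0,\infty))$; ''the solution'' refers to this one. *)

(* Defs.v *)
From HB Require Import structures.
From mathcomp Require Import all_boot all_order all_algebra.
From mathcomp Require Import all_classical all_reals all_analysis.

Set Implicit Arguments.
Unset Strict Implicit.
Unset Printing Implicit Defensive.

Import Order.TTheory GRing.Theory Num.Theory.
Import numFieldNormedType.Exports.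

Local Open Scope classical_set_scope.
Local Open Scope ring_scope.

Section SobolevSpaces.
Context {R : realType}.
Implicit Types (Omega : set R) (p : \bar R) (f g phi : R -> R).

Definition test_function Omega phi : Prop :=
  (forall n x, derivable (derive1n n phi) x 1) /\
  exists K : set R,
    [/\ compact K, K `<=` Omega & forall x, ~ K x -> phi x = 0].

Definition is_weak_derivative Omega f g : Prop :=
  [/\ locally_integrable Omega f, locally_integrable Omega g &
      forall phi, test_function Omega phi ->
        \int[lebesgue_measure]_(x in Omega) (f x * derive1 phi x) =
        - \int[lebesgue_measure]_(x in Omega) (g x * phi x)].

(* Functions on Omega are total functions whose values outside Omega are
   irrelevant; the L^p norm over Omega is that of the extension by zero. *)
Definition LpNorm Omega p f : \bar R :=
  Lnorm (@lebesgue_measure R) p (EFin \o (f \_ Omega)).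

Definition Lp Omega p f : Prop :=
  f \_ Omega \in Lfun (@lebesgue_measure R) p.

Definition W1 Omega p f : Prop :=
  Lp Omega p f /\ exists2 g, is_weak_derivative Omega f g & Lp Omega p g.

(* The weak derivative is unique almost everywhere in Omega, so that W1norm does
   not depend on the one selected here. *)
Definition weak_derivative Omega f : R -> R :=
  get [set g | is_weak_derivative Omega f g].

Definition W1norm Omega p f : \bar R :=
  (LpNorm Omega p f + LpNorm Omega p (weak_derivative Omega f))%E.

(* v belongs to C^0([0,oo); W^{1,p}(Omega)), where v is given as a function of
   (x, t). *)
Definition continuous_W1 Omega p (v : R -> R -> R) : Prop :=
  (forall t, 0 <= t -> W1 Omega p (v^~ t)) /\
  (forall t0, 0 <= t0 ->
    W1norm Omega p (fun x => v x t - v x t0)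
      @[t --> within [set` `[0, +oo[] (nbhs t0)] --> 0%E).

End SobolevSpaces.

Section ClassicalSpaces.
Context {R : realType}.
Implicit Types (a b : R) (w : R -> R -> R).

(* Derivative relative to A: one-sided at the endpoints of a closed interval A,
   the usual derivative at its interior points. *)
Definition derivable_on (A : set R) (f : R -> R) (x : R) : Prop :=
  cvg ((f y - f x) / (y - x) @[y --> within A x^']).

Definition derive_on (A : set R) (f : R -> R) (x : R) : R :=
  lim ((f y - f x) / (y - x) @[y --> within A x^']).

Definition dx a b w : R -> R -> R :=
  fun x t => derive_on [set` `[a, b]] (w^~ t) x.

Definition dxx a b w : R -> R -> R := dx a b (dx a b w).

Definition dt w : R -> R -> R := fun x t => derive1 (w x) t.

Definition continuous_in (D : set (R * R)) w : Prop :=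
  {within D, continuous (fun z : R * R => w z.1 z.2)}.

(* C^{2,1}([a,b] x (0,oo)) *)
Definition C21 a b w : Prop :=
  let D := [set` `[a, b]] `*` [set` `]0, +oo[] in
  (forall x t, x \in `[a, b] -> 0 < t ->
     [/\ derivable_on [set` `[a, b]] (w^~ t) x,
         derivable_on [set` `[a, b]] ((dx a b w)^~ t) x &
         derivable (w x) t 1]) /\
  [/\ continuous_in D w, continuous_in D (dx a b w),
      continuous_in D (dxx a b w) & continuous_in D (dt w)].

Definition holder_loc (theta : R) (D : set (R * R)) w : Prop :=
  forall K : set (R * R), compact K -> K `<=` D ->
    exists C : R, forall y z, K y -> K z ->
      `|w y.1 y.2 - w z.1 z.2| <= C * `|y - z| `^ theta.

End ClassicalSpaces.

Record is_classical_solution (R : realType) (a b chi r : R)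
    (B1 B2 : R -> R -> R) (u0 v0 : R -> R) (u v : R -> R -> R) : Prop :=
  IsClassicalSolution {
    sol_u_cont : continuous_in ([set` `[a, b]] `*` [set` `[0, +oo[]) u ;
    sol_u_C21 : C21 a b u ;
    sol_v_cont : continuous_W1 [set` `]a, b[] r%:E v ;
    sol_v_C21 : C21 a b v ;
    sol_pos : forall x t, x \in `[a, b] -> 0 < t -> 0 < u x t /\ 0 < v x t ;
    sol_u_eq : forall x t, x \in `]a, b[ -> 0 < t ->
      dt u x t = dxx a b u x t
        - chi * dx a b (fun y s => u y s / v y s * dx a b v y s) x t
        - u x t * v x t + B1 x t ;
    sol_v_eq : forall x t, x \in `]a, b[ -> 0 < t ->
      dt v x t = dxx a b v x t + u x t * v x t - v x t + B2 x t ;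
    sol_neumann : forall x t, x = a \/ x = b -> 0 < t ->
      dx a b u x t = 0 /\ dx a b v x t = 0 ;
    sol_init : forall x, x \in `]a, b[ -> u x 0 = u0 x /\ v x 0 = v0 x }.

(* Main.v *)
Require Import Defs.
From mathcomp Require Import all_boot all_order all_algebra.
From mathcomp Require Import all_classical all_reals all_analysis.
From mathcomp Require Import measurable_realfun ess_sup_inf ring lra.
Set Implicit Arguments.
Unset Strict Implicit.
Unset Printing Implicit Defensive.
Import Order.TTheory GRing.Theory Num.Theory.
Import numFieldNormedType.Exports.
Local Open Scope classical_set_scope.
Local Open Scope ring_scope.

(** The problem lives on an interval [a, b] of length L, and everything rests on
    energy estimates, one-dimensional interpolation and scalar differential
    inequalities. No heat semigroup is constructed.

    - Near t = 0. Convergence of v(t) to v0 in W^{1,r} is uniform convergence,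
      because on an interval the weak derivative controls the oscillation
      (weak_derivative_osc, initial_trace). With compactness this bounds u, v and
      1/v on (0, 2] (bounds_before_2).

    - Lower bound of v. Integrating the second equation and dropping uv gives
      (int v)' >= - int v + inf int B2, so the mass of v stays away from 0
      (mass_v_lower). Moreover v is a supersolution of w_t = w_xx - w; testing
      with the backward heat kernel with pole (x0, t0), whose normal derivative
      has the favourable sign on the boundary, turns the mass at time t0 - 1 into
      a lower bound of v at (x0, t0) (supersolution_lower_bound, v_lower).

    - Masses. With v >= c, the consumption uv damps int u, and 2 int u + int v
      satisfies a linear differential inequality (mass_upper).

    - Energy. For F = int u ln u + int v_x^2 the dissipation is
      A + D = int u_x^2 / u + int v_xx^2. The bad terms are
      int u v_x^2 / v^2 <= C sup v_x^2 and int u^2 v^2 <= C sup v^2 sup u, and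
      interpolation against the masses yields sup u <= C (1 + l A + 1 / l) for
      every l > 0 together with (sup v)^5 <= C (1 + D). The powers that appear are
      all subcritical, hence F' <= C - (A + D) / 4 (energy_dissipation). So F is
      bounded, and with it int v_x^2 and sup v (v_upper).

    - Gradient of u. For y = int u_x^2 one finds y' <= C (1 + D) (1 + y), and also
      ln (1 + y) <= C + 2 A. Adding a multiple of F to ln (1 + y) absorbs the
      unbounded factor D, so that y is bounded (gradient_bounded), and then so is
      u (u_bounded).

    - Decay. If the space-time integrals of B1 over [t, t + 1] vanish as t grows,
      the mass of u is contracted by the factor 1 + c per unit of time up to a
      vanishing error (mass_contraction); interpolating between the mass of u and
      the bounded y shows that u tends to 0 uniformly (u_vanishes).

    The time derivatives of int v_x^2 and int u_x^2 are computed although u_x and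
    v_x need not be differentiable in time (derive_integral_sqr_dx). *)

(** * Continuity on a subset *)
Section Continuity.
Context {R : realType} {T : topologicalType} (A : set T).
Implicit Types f g : T -> R.

Definition cont_on f : Prop := {within A, continuous f}.

Lemma cont_onP f :
  cont_on f <-> forall x, A x -> f @ within A (nbhs x) --> f x.
Proof. exact: subspace_continuousP. Qed.

Lemma cont_on_cst (k : R) : cont_on (fun=> k).
Proof. by apply: continuous_subspaceT => x; exact: cvg_cst. Qed.

Lemma cont_onD f g : cont_on f -> cont_on g -> cont_on (fun x => f x + g x).
Proof. by move=> cf cg x; apply: cvgD; [exact: cf|exact: cg]. Qed.

Lemma cont_onN f : cont_on f -> cont_on (fun x => - f x).
Proof. by move=> cf x; apply: cvgN; exact: cf. Qed.

Lemma cont_onM f g : cont_on f -> cont_on g -> cont_on (fun x => f x * g x).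
Proof. by move=> cf cg x; apply: cvgM; [exact: cf|exact: cg]. Qed.

Lemma cont_onX f n : cont_on f -> cont_on (fun x => f x ^+ n).
Proof.
move=> cf; elim: n => [|n IH]; first exact: cont_on_cst.
by under [fun _ => _]eq_fun do rewrite exprS; exact: cont_onM.
Qed.

Lemma cont_on_norm f : cont_on f -> cont_on (fun x => `|f x|).
Proof. by move=> cf x; apply: cvg_norm; exact: cf. Qed.

Lemma cont_on_comp (h : R -> R) f : cont_on f ->
  (forall x, A x -> {for f x, continuous h}) -> cont_on (fun x => h (f x)).
Proof.
move=> /cont_onP cf ch; apply/cont_onP => x Ax.
by apply: (@cvg_comp _ _ _ f h); [exact: cf|exact: ch].
Qed.

Lemma cont_onV f : (forall x, A x -> f x != 0) -> cont_on f ->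
  cont_on (fun x => (f x)^-1).
Proof.
by move=> f0 cf; apply: cont_on_comp => // x /f0; exact: inv_continuous.
Qed.

Lemma cont_on_ln f : (forall x, A x -> 0 < f x) -> cont_on f ->
  cont_on (fun x => ln (f x)).
Proof.
by move=> f0 cf; apply: cont_on_comp => // x /f0; exact: continuous_ln.
Qed.

Lemma cont_on_exp f : cont_on f -> cont_on (fun x => expR (f x)).
Proof.
by move=> cf; apply: cont_on_comp => // x _; exact: continuous_expR.
Qed.

Lemma cont_on_eq f g : {in A, f =1 g} -> cont_on f -> cont_on g.
Proof. exact: subspace_eq_continuous. Qed.

Lemma cont_on_sub (B : set T) f : B `<=` A -> cont_on f ->
  {within B, continuous f}.
Proof. exact: continuous_subspaceW. Qed.

End Continuity.

(** * Integrals of continuous functions over a segment *)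
Section Integral.
Context {R : realType}.
Implicit Types (a b x y : R) (f g : R -> R).

Definition integral_on a b f : R := \int[lebesgue_measure]_(x in `[a, b]) f x.

(** Differentiability is required in the interior only: together with the
    continuity of f and f' up to the boundary it suffices for the fundamental
    theorem of calculus, and it spares one-sided derivatives. *)
Record C1_on a b f f' : Prop := IsC1 {
  C1_cont : cont_on `[a, b] f;
  C1_cont' : cont_on `[a, b] f';
  C1_derive : forall x, x \in `]a, b[ -> is_derive x 1 f (f' x) }.

Lemma cont_on_id a b : cont_on `[a, b] id.
Proof. by apply: continuous_subspaceT => x; exact: cvg_id. Qed.

Lemma cont_on_itv_sub a b x y f : a <= x -> y <= b ->
  cont_on `[a, b] f -> cont_on `[x, y] f.
Proof.
move=> ax yb; apply: cont_on_sub => z /=; rewrite !in_itv/=.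
by move=> /andP[xz zy]; rewrite (le_trans ax)//= (le_trans zy).
Qed.

Lemma cont_on_integrable a b f : cont_on `[a, b] f ->
  lebesgue_measure.-integrable `[a, b] (EFin \o f).
Proof.
by move=> cf; apply: continuous_compact_integrable => //; exact: segment_compact.
Qed.

Lemma cont_on_integrable_oo a b f : cont_on `[a, b] f ->
  lebesgue_measure.-integrable `]a, b[ (EFin \o f).
Proof.
move=> /cont_on_integrable; apply: integrableS => //.
exact: subset_itv_oo_cc.
Qed.

Lemma cont_on_measurable_oo a b f : cont_on `[a, b] f ->
  measurable_fun (`]a, b[%classic : set R) f.
Proof.
move=> /cont_on_integrable_oo fi.
apply/measurable_EFinP; exact: (measurable_int (@lebesgue_measure R)).
Qed.

Section Rules.
Context {a b : R}.
Local Notation I := (integral_on a b).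
Local Notation cont := (cont_on `[a, b]).

Lemma integral_onD f g : cont f -> cont g -> I (fun x => f x + g x) = I f + I g.
Proof. by move=> cf cg; apply: RintegralD => //; exact: cont_on_integrable. Qed.

Lemma integral_onZ k f : cont f -> I (fun x => k * f x) = k * I f.
Proof. by move=> cf; apply: RintegralZl => //; exact: cont_on_integrable. Qed.

Lemma integral_onN f : cont f -> I (fun x => - f x) = - I f.
Proof.
move=> cf; rewrite -mulN1r -integral_onZ//; apply: eq_Rintegral => x _.
by rewrite mulN1r.
Qed.

Lemma integral_onB f g : cont f -> cont g -> I (fun x => f x - g x) = I f - I g.
Proof. by move=> cf cg; apply: RintegralB => //; exact: cont_on_integrable. Qed.

Lemma eq_integral_on f g : {in `[a, b], f =1 g} -> I f = I g.
Proof. by move=> fg; apply: eq_Rintegral => x; rewrite inE => /fg. Qed.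

Lemma integral_oo f : cont f ->
  \int[lebesgue_measure]_(x in `]a, b[) f x = I f.
Proof.
move=> cf; have fi := cont_on_integrable cf.
rewrite Rintegral_itv_bndo_bndc; last first.
  apply: integrableS fi => //.
  exact: subset_itv_oo_cc.
rewrite Rintegral_itv_obnd_cbnd//.
by apply: integrableS fi => //; exact: subset_itv_oc_cc.
Qed.

(** The hypothesis on the open interval suffices because the endpoints have
    measure zero; the differential equations hold only there. *)
Lemma integral_on_le f g : cont f -> cont g ->
  (forall x, x \in `]a, b[ -> f x <= g x) -> I f <= I g.
Proof.
move=> cf cg fg; rewrite -!integral_oo//.
by apply: le_Rintegral => //; exact: cont_on_integrable_oo.
Qed.

Lemma eq_integral_oo f g : cont f -> cont g ->
  (forall x, x \in `]a, b[ -> f x = g x) -> I f = I g.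
Proof.
by move=> cf cg fg; apply/eqP; rewrite eq_le !integral_on_le// => x /fg ->.
Qed.

Lemma integral_on_ge0 f : (forall x, x \in `[a, b] -> 0 <= f x) -> 0 <= I f.
Proof. by move=> f0; apply: Rintegral_ge0 => x; exact: f0. Qed.

Lemma integral_on_cst k : a <= b -> I (fun=> k) = k * (b - a).
Proof.
move=> ab; rewrite /integral_on Rintegral_cst//.
congr (_ * _); rewrite -[RHS]/(fine (b - a)%:E); congr fine.
apply: (etrans (lebesgue_measure_itv `[a, b])); rewrite /= lte_fin.
by case: ltgtP ab => //= -> _; rewrite subrr.
Qed.

Lemma integral_on_norm f : cont f -> `|I f| <= I (fun x => `|f x|).
Proof. by move=> cf; apply: le_normr_Rintegral => //; exact: cont_on_integrable. Qed.

End Rules.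

Lemma integral_sub a b x y f : a <= x -> y <= b -> cont_on `[a, b] f ->
  (forall z, z \in `[a, b] -> 0 <= f z) ->
  integral_on x y f <= integral_on a b f.
Proof.
move=> ax yb cf f0; rewrite /integral_on /Rintegral fine_le//.
- apply: integrable_fin_num => //.
  by apply: cont_on_integrable; exact: cont_on_itv_sub cf.
- by apply: integrable_fin_num => //; exact: cont_on_integrable.
apply: ge0_subset_integral => //=.
- by apply: (measurable_int lebesgue_measure); exact: cont_on_integrable.
- by move=> z /=; rewrite !in_itv/= => /andP[xz zy]; rewrite (le_trans ax)//= (le_trans zy).
Qed.

Lemma FTC a b f f' : a < b -> C1_on a b f f' -> integral_on a b f' = f b - f a.
Proof.
move=> ab [cf cf' df]; rewrite /integral_on /Rintegral.
move: (cf) => /(continuous_within_itvP _ ab)[_ fa fb].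
rewrite (@continuous_FTC2 _ f' f)//.
  by split => // x /df[].
by move=> x /df dfx; rewrite derive1E; exact: derive_val.
Qed.

End Integral.

(* Dispatches on the head symbol of the function: trying all the closure lemmas
   by unification would unfold the ring operations. *)
Ltac solve_cont := lazymatch goal with
  | |- cont_on _ (fun x => @?f x + @?g x) =>
      refine (@cont_onD _ _ _ f g _ _); solve_cont
  | |- cont_on _ (fun x => @?f x * @?g x) =>
      refine (@cont_onM _ _ _ f g _ _); solve_cont
  | |- cont_on _ (fun x => - @?f x) => refine (@cont_onN _ _ _ f _); solve_cont
  | |- cont_on _ (fun x => @?f x ^+ _) => refine (@cont_onX _ _ _ f _ _); solve_cont
  | |- cont_on _ (fun x => `|@?f x|) =>
      refine (@cont_on_norm _ _ _ f _); solve_cont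
  | |- cont_on _ (fun x => x) => exact (@cont_on_id _ _ _)
  | |- cont_on _ ?f => first
      [ match goal with H : cont_on _ ?g |- _ => unify f g; exact H end
      | exact (@cont_on_cst _ _ _ _) ]
  | |- forall _, _ => fail
  | |- _ => by []
  end.

(** * Integration by parts and interpolation in dimension one *)
Section Interpolation.
Context {R : realType} {a b : R} (ab : a < b).
Implicit Types f g : R -> R.
Local Notation I := (integral_on a b).
Local Notation cont := (cont_on `[a, b]).

(** The quadratic polynomial k |-> int (k f - g)^2 is nonnegative. *)
Lemma cauchy_schwarz f g : cont f -> cont g ->
  I (fun x => f x * g x) ^+ 2 <= I (fun x => f x ^+ 2) * I (fun x => g x ^+ 2).
Proof.
move=> cf cg; set p := I (fun x => f x ^+ 2); set q := I (fun x => g x ^+ 2).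
set m := I _.
have cfg : cont (fun x => f x * g x) by solve_cont.
have cff : cont (fun x => f x ^+ 2) by solve_cont.
have cgg : cont (fun x => g x ^+ 2) by solve_cont.
have H k : 0 <= k ^+ 2 * p - 2 * k * m + q.
  have -> : k ^+ 2 * p - 2 * k * m + q = I (fun x => (k * f x - g x) ^+ 2).
    rewrite (@eq_integral_on _ _ _ (fun x => (k * f x - g x) ^+ 2)
      (fun x => k ^+ 2 * f x ^+ 2 - 2 * k * (f x * g x) + g x ^+ 2)).
      by rewrite integral_onD ?integral_onB ?integral_onZ//; solve_cont.
    by move=> x _; ring.
  by apply: integral_on_ge0 => x _; exact: sqr_ge0.
have p0 : 0 <= p by apply: integral_on_ge0 => x _; exact: sqr_ge0.
have [p_eq0|p_neq0] := eqVneq p 0.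
  have [->|m0] := eqVneq m 0; first by rewrite expr0n/= p_eq0 mul0r.
  have := H ((q + 1) / (2 * m)); rewrite p_eq0 mulr0.
  have -> : 2 * ((q + 1) / (2 * m)) * m = q + 1 by field.
  by move=> ?; lra.
have pp : 0 < p by rewrite lt_neqAle eq_sym p_neq0.
have := H (m / p).
have -> : (m / p) ^+ 2 * p - 2 * (m / p) * m + q = (p * q - m ^+ 2) / p by field.
by rewrite pmulr_lge0 ?invr_gt0// subr_ge0.
Qed.

Lemma ex_mean_ge f : cont f ->
  exists2 x, x \in `[a, b] & f x * (b - a) <= I f.
Proof.
move=> cf; have [x xab fx] := EVT_min (ltW ab) cf.
exists x => //; rewrite -integral_on_cst; last exact: ltW.
apply: integral_on_le => //; first exact: cont_on_cst.
by move=> y /subset_itv_oo_cc; exact: fx.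
Qed.

Lemma osc_le f f' : C1_on a b f f' ->
  {in `[a, b] &, forall x y, `|f y - f x| <= I (fun z => `|f' z|)}.
Proof.
move=> df x y xab yab; wlog xy : x y xab yab / x <= y.
  by move=> H; case: (leP x y) => [|/ltW] xy; [|rewrite distrC]; exact: H.
have cf' := C1_cont' df; have cn := cont_on_norm cf'.
move: xy; rewrite le_eqVlt => /predU1P[->|xy].
  by rewrite subrr normr0; apply: integral_on_ge0.
move: xab yab; rewrite !in_itv/= => /andP[ax xb] /andP[ay yb].
rewrite -(@FTC _ x y f f')//.
  apply: (le_trans (integral_on_norm _)); first exact: cont_on_itv_sub cf'.
  exact: integral_sub.
split; [exact: cont_on_itv_sub (C1_cont df)|exact: cont_on_itv_sub cf'|].
move=> z; rewrite in_itv/= => /andP[xz zy]; apply: (C1_derive df).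
by rewrite in_itv/= (le_lt_trans ax)//= (lt_le_trans zy).
Qed.

(** The embedding of W^{1,1} into the bounded functions: f takes a value
    not above its mean, and the integral of |f'| bounds its oscillation. *)
Lemma sup_le_mean f f' : C1_on a b f f' ->
  forall x, x \in `[a, b] -> f x <= I f / (b - a) + I (fun z => `|f' z|).
Proof.
move=> df x xab; have [y yab fy] := ex_mean_ge (C1_cont df).
have := osc_le df yab xab; rewrite ler_norml => /andP[_].
rewrite lerBlDl => /le_trans; apply.
by rewrite lerD2r ler_pdivlMr// subr_gt0.
Qed.

Lemma C1_onM f f' g g' : C1_on a b f f' -> C1_on a b g g' ->
  C1_on a b (fun x => f x * g x) (fun x => f' x * g x + f x * g' x).
Proof.
move=> df dg; have [cf cf' Df] := df; have [cg cg' Dg] := dg; split.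
- exact: cont_onM.
- by apply: cont_onD; exact: cont_onM.
move=> x xab; have dfx := Df _ xab; have dgx := Dg _ xab.
by apply: is_derive_eq => /=; rewrite addrC; congr (_ + _); rewrite mulrC.
Qed.

Lemma integration_by_parts_on f f' g g' : C1_on a b f f' -> C1_on a b g g' ->
  I (fun x => f' x * g x) = f b * g b - f a * g a - I (fun x => f x * g' x).
Proof.
move=> df dg; have := FTC ab (C1_onM df dg); rewrite integral_onD.
- by move=> <-; rewrite addrK.
- by apply: cont_onM; [exact: C1_cont' df|exact: C1_cont dg].
- by apply: cont_onM; [exact: C1_cont df|exact: C1_cont' dg].
Qed.

Lemma C1_on_sqr f f' : C1_on a b f f' ->
  C1_on a b (fun x => f x ^+ 2) (fun x => 2 * f x * f' x).
Proof.
move=> df; have := C1_onM df df.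
have -> : (fun x => f x * f x) = (fun x => f x ^+ 2).
  by apply/funext => x; rewrite expr2.
have -> // : (fun x => f' x * f x + f x * f' x) = (fun x => 2 * f x * f' x).
by apply/funext => x; ring.
Qed.

End Interpolation.

(** * Integrals depending on time *)
Section Parametric.
Context {R : realType} {a b : R} {J : set R} (oJ : open J).
Implicit Types (w : R -> R -> R) (t s : R).
Local Notation I := (integral_on a b).
Local Notation D := ([set` `[a, b]] `*` J).

Lemma open_near t : J t -> \forall s \near t, J s.
Proof. by move=> Jt; apply: open_nbhs_nbhs; split. Qed.

Lemma is_derive_small (F : R -> R) t l :
  (forall e, 0 < e -> \forall s \near t, `|F s - F t - (s - t) * l| <= e * `|s - t|) ->
  is_derive t 1 F l.
Proof.
move=> H.
have cv : h^-1 *: (F (h + t) - F t) @[h --> 0^'] --> l.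
  apply/cvgrPdist_le => e e0; have He := H e e0.
  have : \forall h \near 0, `|F (h + t) - F t - h * l| <= e * `|h|.
    move: He; rewrite (near_shift 0 t) subr0; apply: filterS => h /=.
    by rewrite addrK.
  move/nbhs_dnbhs; rewrite /= => Hd; near=> h.
  have h0 : h != 0 by near: h; exact: nbhs_dnbhs_neq.
  have : `|F (h + t) - F t - h * l| <= e * `|h| by near: h.
  have -> : l - h^-1 *: (F (h + t) - F t) = - (h^-1 * (F (h + t) - F t - h * l)).
    by rewrite /GRing.scale/=; field.
  by rewrite normrN normrM normfV ler_pdivrMl ?normr_gt0// (mulrC `|h|).
have E : (fun h : R => h^-1 *: ((F \o shift t) (h *: 1) - F t)) =
    (fun h => h^-1 *: (F (h + t) - F t)).
  by apply/funext => h /=; rewrite [_%:A]mulr1.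
apply: DeriveDef; first by rewrite /derivable E; apply/cvg_ex; exists l.
by rewrite /derive E; exact: cvg_lim cv.
Unshelve. all: by end_near. Qed.

Lemma continuous_in_near w x t e : continuous_in D w -> x \in `[a, b] -> J t ->
  0 < e ->
  \forall y \near x & s \near t,
    y \in `[a, b] -> J s -> `|w x t - w y s| < e.
Proof.
move=> /subspace_continuousP cw xab t0 e0.
have /cw/cvgrPdist_lt/(_ _ e0) : D (x, t) by [].
rewrite near_withinE => -[[U V] /= [Ux Vt] UV].
exists (U, V) => // -[y s] /= [Uy Vs] yab s0.
exact: (UV (y, s)).
Qed.

Lemma slice_cont w t : continuous_in D w -> J t -> cont_on `[a, b] (w^~ t).
Proof.
move=> cw t0; apply/cont_onP => x xab; apply/cvgrPdist_lt => e e0.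
have [[U V] /= [Ux Vt] UV] := continuous_in_near cw xab t0 e0.
rewrite near_withinE; apply: filterS Ux => y Uy yab.
by apply: (UV (y, t)) => //; split => //=; exact: nbhs_singleton.
Qed.

(** Continuity in time is uniform in x because [a, b] is compact. *)
Lemma tube w t e : continuous_in D w -> J t -> 0 < e ->
  \forall s \near t, forall x, x \in `[a, b] -> `|w x s - w x t| < e.
Proof.
move=> cw t0 e0.
have /compact_near_coveringP/near_covering_withinP := @segment_compact R a b.
move=> /(_ _ (nbhs t) (fun s x => `|w x s - w x t| < e) _); apply => x xab.
have e20 : 0 < e / 2 by rewrite divr_gt0.
have [[U V] /= [Ux Vt] UV] := continuous_in_near cw xab t0 e20.
exists (U, V `&` J) => /=.
  by split => //; apply: filterI => //; exact: open_near.
move=> [y s] /= [Uy [Vs s0]] yab.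
have h1 := UV (y, s) (conj Uy Vs) yab s0.
have h2 := UV (y, t) (conj Uy (nbhs_singleton Vt)) yab t0.
rewrite distrC -(subrKA (w x t)) (splitr e) (le_lt_trans (ler_normD _ _))//.
by rewrite ltrD// distrC.
Qed.

Lemma integral_cvg w t : a < b -> continuous_in D w -> J t ->
  forall e, 0 < e -> \forall s \near t, I (fun x => `|w x s - w x t|) <= e.
Proof.
move=> ab cw t0 e e0; have L0 : 0 < b - a by rewrite subr_gt0.
have d0 : 0 < e / (b - a) by rewrite divr_gt0.
have s0 := open_near t0.
apply: filterS2 s0 (tube cw t0 d0) => s s0 Hs.
have cs := slice_cont cw s0; have ct := slice_cont cw t0.
apply: (@le_trans _ _ (I (fun=> e / (b - a)))).
  apply: integral_on_le; [by solve_cont|exact: cont_on_cst|].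
  by move=> x /subset_itv_oo_cc xab; exact/ltW/Hs.
by rewrite integral_on_cst ?(ltW ab)// divfK// gt_eqF.
Qed.

Lemma MVT_time (w w' : R -> R) (t s : R) :
  (forall r : R, `|r - t| <= `|s - t| -> is_derive r 1 w (w' r)) ->
  exists2 r : R, `|r - t| <= `|s - t| & w s - w t = w' r * (s - t).
Proof.
have H (p q : R) : p <= q -> (forall r : R, p <= r <= q -> is_derive r 1 w (w' r)) ->
    exists2 r, p <= r <= q & w q - w p = w' r * (q - p).
  move=> pq dw; have [| |r] := MVT_segment pq (f := w) (df := w').
  - by move=> r /subset_itv_oo_cc; rewrite in_itv/= => /dw.
  - apply: derivable_within_continuous => r; rewrite in_itv/= => prq.
    by have dr := dw r prq; exact: ex_derive.
  by rewrite in_itv/= => ?; exists r.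
have [ts|/ltW st] := leP t s => dw.
  have E (r : R) : t <= r <= s -> `|r - t| <= `|s - t|.
    by move=> /andP[tr rs]; rewrite !ger0_norm ?subr_ge0// lerD2r.
  have [r trs Er] := H t s ts (fun r h => dw r (E r h)).
  by exists r => //; exact: E.
have E (r : R) : s <= r <= t -> `|r - t| <= `|s - t|.
  by move=> /andP[sr rt]; rewrite !ler0_norm ?subr_le0// lerN2 lerD2r.
have [r trs Er] := H s t st (fun r h => dw r (E r h)).
by exists r; [exact: E|rewrite -opprB Er -mulrN opprB].
Qed.

(** Differentiability in time is uniform in x as well: by the mean value theorem
    the difference quotient is a value of w', to which tube applies. *)
Lemma tube_diff w w' t e : (forall x s : R, x \in `[a, b] -> J s ->
    is_derive s 1 (w x) (w' x s)) ->
  continuous_in D w' -> J t -> 0 < e ->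
  \forall s \near t, forall x, x \in `[a, b] ->
    `|w x s - w x t - (s - t) * w' x t| <= e * `|s - t|.
Proof.
move=> dw cw' t0 e0; have /nbhs_ballP[d /= dgt0 Hd] := tube cw' t0 e0.
have /nbhs_ballP[d' /= d'gt0 Hd'] := open_near t0.
have m0 : 0 < Num.min d d' by rewrite lt_min dgt0.
apply/nbhs_ballP; exists (Num.min d d') => // s; rewrite /ball/= distrC lt_min.
move=> /andP[sd sd'] x xab.
have [|r rt ->] := @MVT_time (w x) (w' x) t s.
  move=> r rt; apply: dw => //; apply: Hd'; rewrite /ball/= distrC.
  exact: le_lt_trans sd'.
rewrite mulrC -mulrBr normrM mulrC ler_wpM2r//.
by apply/ltW/(Hd r) => //; rewrite /ball/= distrC; exact: le_lt_trans sd.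
Qed.

Lemma derive_integral w w' t : a < b ->
  (forall s, J s -> cont_on `[a, b] (w^~ s)) ->
  (forall x s : R, x \in `[a, b] -> J s -> is_derive s 1 (w x) (w' x s)) ->
  continuous_in D w' -> J t ->
  is_derive t 1 (fun s => I (w^~ s)) (I (w'^~ t)).
Proof.
move=> ab cw dw cw' t0; apply: is_derive_small => e e0.
have L0 : 0 < b - a by rewrite subr_gt0.
have d0 : 0 < e / (b - a) by rewrite divr_gt0.
have s0 := open_near t0.
apply: filterS2 s0 (tube_diff dw cw' t0 d0) => s s0 Hs.
have cs := cw _ s0; have ct := cw _ t0; have c't := slice_cont cw' t0.
rewrite -integral_onZ// -!integral_onB//; [|by solve_cont|by solve_cont].
apply: le_trans (integral_on_norm _) _; first by solve_cont.
apply: (@le_trans _ _ (I (fun=> e / (b - a) * `|s - t|))).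
  apply: integral_on_le; [by solve_cont|exact: cont_on_cst|].
  by move=> x /subset_itv_oo_cc xab; exact: Hs.
by rewrite integral_on_cst ?(ltW ab)// mulrAC divfK// gt_eqF.
Qed.

End Parametric.

Section Evolution.
Context {R : realType} {a b : R} (ab : a < b).
Implicit Types (w : R -> R -> R) (t s : R).
Local Notation I := (integral_on a b).
Local Notation D := ([set` `[a, b]] `*` [set s | 0 < s]).

Lemma open_pos : open [set s : R | 0 < s].
Proof. exact: open_gt. Qed.

(** A C^{2,1} function with zero normal derivative, along with its derivatives.
    The second space derivative and the first time derivative are the last
    ones available; in particular wx has no time derivative. *)
Record neumann_smooth w wx wxx wt : Prop := IsNeumannSmooth {
  ns_cont : continuous_in D w;
  ns_contx : continuous_in D wx;
  ns_contxx : continuous_in D wxx;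
  ns_contt : continuous_in D wt;
  ns_derx : forall x t : R, x \in `]a, b[ -> 0 < t ->
    is_derive x 1 (w^~ t) (wx x t);
  ns_derxx : forall x t : R, x \in `]a, b[ -> 0 < t ->
    is_derive x 1 (wx^~ t) (wxx x t);
  ns_dert : forall x t : R, x \in `[a, b] -> 0 < t ->
    is_derive t 1 (w x) (wt x t);
  ns_bdry : forall t, 0 < t -> wx a t = 0 /\ wx b t = 0 }.

Lemma cont_bounded (f : R -> R) : cont_on `[a, b] f ->
  exists2 M, 0 <= M & forall x : R, x \in `[a, b] -> `|f x| <= M.
Proof.
move=> cf; have cn := cont_on_norm cf.
have [x xab Mx] := EVT_max (ltW ab) cn.
by exists `|f x|.
Qed.

Context (w wx wxx wt : R -> R -> R) (sw : neumann_smooth w wx wxx wt).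

Lemma ns_slice t : 0 < t -> [/\ cont_on `[a, b] (w^~ t), cont_on `[a, b] (wx^~ t),
  cont_on `[a, b] (wxx^~ t) & cont_on `[a, b] (wt^~ t)].
Proof.
by move=> t0; split; apply: (@slice_cont _ _ _ [set s | 0 < s]) => //; [exact: ns_cont sw|
  exact: ns_contx sw|exact: ns_contxx sw|exact: ns_contt sw].
Qed.

Lemma ns_C1 t : 0 < t -> C1_on a b (w^~ t) (wx^~ t).
Proof.
move=> t0; have [? ? ? ?] := ns_slice t0.
by split => // x xab; exact: (ns_derx sw xab t0).
Qed.

Lemma ns_C1x t : 0 < t -> C1_on a b (wx^~ t) (wxx^~ t).
Proof.
move=> t0; have [? ? ? ?] := ns_slice t0.
by split => // x xab; exact: (ns_derxx sw xab t0).
Qed.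

Lemma C1_onB (f f' g g' : R -> R) : C1_on a b f f' -> C1_on a b g g' ->
  C1_on a b (fun x => f x - g x) (fun x => f' x - g' x).
Proof.
move=> [cf cf' df] [cg cg' dg]; split; [by solve_cont|by solve_cont|].
by move=> x xab; have dfx := df x xab; have dgx := dg x xab; exact: is_deriveB.
Qed.

Lemma C1_onD (f f' g g' : R -> R) : C1_on a b f f' -> C1_on a b g g' ->
  C1_on a b (fun x => f x + g x) (fun x => f' x + g' x).
Proof.
move=> [cf cf' df] [cg cg' dg]; split; [by solve_cont|by solve_cont|].
by move=> x xab; have dfx := df x xab; have dgx := dg x xab; exact: is_deriveD.
Qed.

(** Formally the derivative of int w_x^2 is 2 int w_x w_xt, but w_xt need not
    exist. Instead the increment between t and s is integrated by parts first:
    it equals - int (w(s) - w(t)) (w_xx(s) + w_xx(t)), where only w is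
    differentiated in time. *)
Lemma derive_integral_sqr_dx t : 0 < t ->
  is_derive t 1 (fun s => I (fun x => wx x s ^+ 2))
    (- 2 * I (fun x => wt x t * wxx x t)).
Proof.
move=> t0; apply: is_derive_small => e e0.
have L0 : 0 < b - a by rewrite subr_gt0.
have [cw cx cxx cw'] := ns_slice t0.
have [W W0 HW] := cont_bounded cw'; have [Q Q0 HQ] := cont_bounded cxx.
pose K := 2 * Q + 1 + W.
have K0 : 0 < K by rewrite /K; lra.
pose d := Num.min 1 (e / (K * (b - a))).
have d0 : 0 < d by rewrite lt_min ltr01 divr_gt0// mulr_gt0.
have d1 : d <= 1 by rewrite ge_min lexx.
have dKe : d * K * (b - a) <= e.
  by rewrite -mulrA -ler_pdivlMr ?mulr_gt0// ge_min lexx orbT.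
have s0 : \forall s \near t, 0 < s by exact: lt_nbhsr.
have := tube_diff open_pos (ns_dert sw) (ns_contt sw) t0 d0.
apply: filterS3 s0 (tube open_pos (ns_contxx sw) t0 d0) => s s0 Hxx Hd.
have [csw csx csxx _] := ns_slice s0.
have E : I (fun x => wx x s ^+ 2) - I (fun x => wx x t ^+ 2) =
    - I (fun x => (w x s - w x t) * (wxx x s + wxx x t)).
  have [wxa wxb] := ns_bdry sw t0; have [wsa wsb] := ns_bdry sw s0.
  have := integration_by_parts_on ab (C1_onB (ns_C1 s0) (ns_C1 t0))
    (C1_onD (ns_C1x s0) (ns_C1x t0)).
  rewrite wxa wxb wsa wsb addr0 !mulr0 subr0 sub0r => <-.
  rewrite -integral_onB; [|by solve_cont|by solve_cont].
  by apply: eq_integral_on => x _; ring.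
rewrite {}E -integral_onN; last by solve_cont.
rewrite mulrA -integral_onZ; last by solve_cont.
rewrite -integral_onB; [|by solve_cont|by solve_cont].
apply: le_trans (integral_on_norm _) _; first by solve_cont.
apply: (@le_trans _ _ (I (fun=> d * K * `|s - t|))); last first.
  by rewrite integral_on_cst ?(ltW ab)// mulrAC ler_wpM2r.
apply: integral_on_le; [by solve_cont|exact: cont_on_cst|].
move=> x /subset_itv_oo_cc xab.
have h1 := Hd x xab; have h2 := HW x xab; have h3 := HQ x xab.
have h4 := ltW (Hxx x xab).
have -> : - ((w x s - w x t) * (wxx x s + wxx x t)) -
    (s - t) * - 2 * (wt x t * wxx x t) =
    - ((w x s - w x t - (s - t) * wt x t) * (wxx x s + wxx x t)
       + (s - t) * wt x t * (wxx x s - wxx x t)) by ring.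
rewrite normrN; apply: le_trans (ler_normD _ _) _; rewrite !normrM.
have h5 : `|wxx x s + wxx x t| <= 2 * Q + 1.
  have -> : wxx x s + wxx x t = (wxx x s - wxx x t) + 2 * wxx x t by ring.
  apply: le_trans (ler_normD _ _) _; rewrite normrM (ger0_norm (ler0n _ 2)); lra.
have -> : d * K * `|s - t| = d * `|s - t| * (2 * Q + 1) + `|s - t| * W * d.
  by rewrite /K; ring.
by apply: lerD; apply: ler_pM => //; rewrite ?mulr_ge0// ler_wpM2l.
Qed.

End Evolution.

Arguments neumann_smooth {R} a b w wx wxx wt.

(** * Relative derivatives at interior points *)
Section RelativeDerivative.
Context {R : realType} {a b : R}.
Implicit Types (f : R -> R) (x t : R).

Lemma within_itv_dnbhs x : x \in `]a, b[ -> within `[a, b] x^' = x^'.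
Proof.
move=> xab; apply/seteqP; split => U HU; last first.
  by apply: filterS HU => y Uy _.
have nab : nbhs x `[a, b]%classic.
  apply: filterS (near_in_itvoo xab) => y /=; exact: subset_itv_oo_cc.
move: HU; rewrite /within/=; apply: filterS2 (nbhs_dnbhs nab) => y yab; exact.
Qed.

Lemma is_derive_dnbhs f x l :
  (f y - f x) / (y - x) @[y --> x^'] --> l <-> is_derive x 1 f l.
Proof.
split=> [/cvgrPdist_le H|df].
  apply: is_derive_small => e e0; have := H e e0.
  rewrite near_withinE; apply: filterS => y Hy.
  have [->|yx] := eqVneq y x; first by rewrite !subrr mul0r subr0 normr0 mulr0.
  have yx0 : y - x != 0 by rewrite subr_eq0.
  have := Hy yx; rewrite distrC -(ler_pM2r (x := `|y - x|)) ?normr_gt0//.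
  by rewrite -normrM mulrBl divfK// (mulrC l).
have [+ E] := df; rewrite /derivable => /cvg_ex[l' Hl'].
have {E} El : l' = l by rewrite -E /derive; apply/esym/cvg_lim.
move: Hl'; rewrite {}El => /cvgrPdist_le H.
apply/cvgrPdist_le => e e0; have := H e e0.
rewrite near_withinE => He; rewrite near_withinE.
suff : \forall y \near x, y != x -> `|l - (f y - f x) / (y - x)| <= e by [].
rewrite (near_shift 0 x).
apply: filterS He => h /= Hh; rewrite subr0 => hx.
have h0 : h != 0 by apply: contra_neq hx => ->; rewrite add0r.
by have := Hh h0; rewrite /GRing.scale/= mulr1 addrK mulrC.
Qed.

Lemma derive_on_is_derive f x : x \in `]a, b[ -> derivable_on `[a, b] f x ->
  is_derive x 1 f (derive_on `[a, b] f x).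
Proof.
move=> xab; rewrite /derivable_on /derive_on (within_itv_dnbhs xab) => df.
by apply/is_derive_dnbhs.
Qed.

Lemma derive_onE f x l : x \in `]a, b[ -> is_derive x 1 f l ->
  derive_on `[a, b] f x = l.
Proof.
move=> xab; rewrite /derive_on (within_itv_dnbhs xab) => /is_derive_dnbhs.
exact: cvg_lim.
Qed.

Lemma C21_neumann_smooth w : C21 a b w ->
  (forall x t, x = a \/ x = b -> 0 < t -> dx a b w x t = 0) ->
  neumann_smooth a b w (dx a b w) (dxx a b w) (dt w).
Proof.
rewrite /C21 set_itvoy => -[dw [cw cx cxx ct]] bdry.
split; [exact: cw|exact: cx|exact: cxx|exact: ct| | | |].
- move=> x t xab t0; apply: derive_on_is_derive => //.
  by have [h _ _] := dw x t (subset_itv_oo_cc xab) t0; exact: h.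
- move=> x t xab t0; apply: derive_on_is_derive => //.
  by have [_ h _] := dw x t (subset_itv_oo_cc xab) t0; exact: h.
- move=> x t xab t0; have [_ _ d] := dw x t xab t0.
  by rewrite /dt derive1E; exact: derivableP.
- by move=> t t0; split; apply: bdry => //; [left|right].
Qed.

End RelativeDerivative.

(** * Differentiation rules *)
Section DerivativeRules.
Context {R : realType}.
Implicit Types (f g : R -> R) (x l m : R).

Lemma derD f g x l m : is_derive x 1 f l -> is_derive x 1 g m ->
  is_derive x 1 (fun y => f y + g y) (l + m).
Proof. by move=> df dg; exact: is_deriveD. Qed.

Lemma derN f x l : is_derive x 1 f l -> is_derive x 1 (fun y => - f y) (- l).
Proof. by move=> df; exact: is_deriveN. Qed.

Lemma derB f g x l m : is_derive x 1 f l -> is_derive x 1 g m ->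
  is_derive x 1 (fun y => f y - g y) (l - m).
Proof. by move=> df dg; exact: is_deriveB. Qed.

Lemma derM f g x l m : is_derive x 1 f l -> is_derive x 1 g m ->
  is_derive x 1 (fun y => f y * g y) (l * g x + f x * m).
Proof.
move=> df dg; have := is_deriveM df dg; rewrite addrC; congr is_derive.
by rewrite /GRing.scale/= (mulrC l).
Qed.

Lemma derZ f x l k : is_derive x 1 f l -> is_derive x 1 (fun y => k * f y) (k * l).
Proof. by move=> df; exact: is_deriveZ. Qed.

Lemma derX f x l n : is_derive x 1 f l ->
  is_derive x 1 (fun y => f y ^+ n) (n%:R * f x ^+ n.-1 * l).
Proof.
move=> df; have := is_deriveX n df.
have -> // : f ^+ n = (fun y => f y ^+ n).
by elim: n => // n IH; rewrite exprS IH; apply/funext => y /=; rewrite exprS.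
Qed.

Lemma derV f x l : f x != 0 -> is_derive x 1 f l ->
  is_derive x 1 (fun y => (f y)^-1) (- l / f x ^+ 2).
Proof.
move=> f0 df; have := is_deriveV f0 df; congr is_derive.
by rewrite /GRing.scale/= mulNr mulrC mulNr.
Qed.

Lemma der_comp (h : R -> R) f x l m : is_derive (f x) 1 h m ->
  is_derive x 1 f l -> is_derive x 1 (fun y => h (f y)) (m * l).
Proof. by move=> dh df; exact: is_derive1_comp. Qed.

Lemma der_ln f x l : 0 < f x -> is_derive x 1 f l ->
  is_derive x 1 (fun y => ln (f y)) (l / f x).
Proof. by move=> f0 df; rewrite mulrC; apply: der_comp => //; exact: is_derive1_ln. Qed.

Lemma der_exp f x l : is_derive x 1 f l ->
  is_derive x 1 (fun y => expR (f y)) (expR (f x) * l).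
Proof. by move=> df; apply: der_comp. Qed.

Lemma der_near f g x l : (\forall y \near x, f y = g y) -> is_derive x 1 f l ->
  is_derive x 1 g l.
Proof.
move=> fg /is_derive_dnbhs df; apply/is_derive_dnbhs; move: df.
apply: cvg_trans; apply: near_eq_cvg; rewrite near_withinE.
by apply: filterS (fg) => y -> _; rewrite (nbhs_singleton fg).
Qed.

End DerivativeRules.

(** * A smooth transition from 0 to 1 *)
Section Smooth.
Context {R : realType}.
Implicit Types (f g : R -> R) (x : R) (n k : nat).

(** Recursion on the derivative of f makes stability under sums, products and
    inverses an induction on n. *)
Fixpoint nderivable n f : Prop :=
  if n is m.+1 then (forall x, derivable f x 1) /\ nderivable m (derive1 f) else True.

Lemma nderivable_derive1n f : (forall n, nderivable n f) ->
  forall n x, derivable (derive1n n f) x 1.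
Proof.
move=> sf n; elim: n f sf => [|n IH] f sf x; first by have [+ _] := sf 1%N; apply.
by rewrite derive1Sn; apply: IH => m; have [] := sf m.+1.
Qed.

Lemma nderivableS n f : nderivable n.+1 f -> nderivable n f.
Proof. by elim: n f => [//|n IH] f [df /IH cf]; split. Qed.

Lemma nderivableP n f f' : (forall x, is_derive x 1 f (f' x)) ->
  nderivable n f' -> nderivable n.+1 f.
Proof.
move=> df cf'; split; first by move=> x; have dfx := df x; exact: ex_derive.
have -> // : derive1 f = f'.
by apply/funext => x; have dfx := df x; rewrite derive1E; exact: derive_val.
Qed.

Lemma nderivable_is_derive n f : nderivable n.+1 f ->
  forall x, is_derive x 1 f (derive1 f x).
Proof. by move=> [df _] x; rewrite derive1E; exact: derivableP. Qed.

Lemma nderivableD n f g : nderivable n f -> nderivable n g ->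
  nderivable n (fun x => f x + g x).
Proof.
elim: n f g => [//|n IH] f g cf cg.
have dfg x := derD (nderivable_is_derive cf x) (nderivable_is_derive cg x).
apply: (nderivableP dfg).
by apply: IH; [case: cf|case: cg].
Qed.

Lemma nderivableZ n f (k : R) : nderivable n f -> nderivable n (fun x => k * f x).
Proof.
elim: n f => [//|n IH] f cf; have df x := derZ k (nderivable_is_derive cf x).
apply: (nderivableP df).
by apply: IH; case: cf.
Qed.

Lemma nderivableM n f g : nderivable n f -> nderivable n g ->
  nderivable n (fun x => f x * g x).
Proof.
elim: n f g => [//|n IH] f g cf cg.
have dfg x := derM (nderivable_is_derive cf x) (nderivable_is_derive cg x).
apply: (nderivableP dfg).
by apply: nderivableD; apply: IH => //; solve [by case: cf|by case: cg|exact: nderivableS].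
Qed.

Lemma nderivableV n f : (forall x, f x != 0) -> nderivable n f ->
  nderivable n (fun x => (f x)^-1).
Proof.
move=> f0; elim: n => [//|n IH] cf.
have df x : is_derive x 1 (fun y => (f y)^-1)
    (- 1 * derive1 f x * ((f x)^-1 * (f x)^-1)).
  have := derV (f0 x) (nderivable_is_derive cf x).
  by congr is_derive; rewrite mulN1r expr2 invfM.
apply: (nderivableP df).
apply: nderivableM; first by apply: nderivableZ; case: cf.
by apply: nderivableM; apply: IH; exact: nderivableS.
Qed.

Lemma nderivable_affine n f (k d : R) : nderivable n f ->
  nderivable n (fun x => f (k * x + d)).
Proof.
elim: n f => [//|n IH] f cf.
have df x : is_derive x 1 (fun y => f (k * y + d)) (k * derive1 f (k * x + d)).
  rewrite mulrC; apply: (@der_comp _ f); first exact: nderivable_is_derive cf _.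
  have := derD (derZ k (is_derive_id x 1)) (is_derive_cst d x 1).
  by rewrite mulr1 addr0.
by apply: (nderivableP df); apply: nderivableZ; apply: IH; case: cf.
Qed.

(** The functions x^-k exp(-1 / x), extended by 0 to the left: their linear span is
    closed under differentiation, so all of them are smooth at the origin. *)
Definition flat k x : R := if 0 < x then x^-1 ^+ k * expR (- x^-1) else 0.

Lemma flat_ge0 k x : 0 <= flat k x.
Proof.
rewrite /flat; case: ifPn => // x0.
by rewrite mulr_ge0 ?expR_ge0// exprn_ge0// invr_ge0 ltW.
Qed.

Lemma flat_gt0 k x : 0 < x -> 0 < flat k x.
Proof. by move=> x0; rewrite /flat x0 mulr_gt0 ?expR_gt0// exprn_gt0// invr_gt0. Qed.

Lemma flat_eq0 k x : x <= 0 -> flat k x = 0.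
Proof. by move=> x0; rewrite /flat ltNge x0. Qed.

(** With y = 1 / x and n = k + 2, this is y^n <= n^n e^y, the n-th power of
    y / n <= e^(y / n). *)
Lemma flat_le k x : 0 < x -> flat k x <= k.+2%:R ^+ k.+2 * x ^+ 2.
Proof.
move=> x0; rewrite /flat x0 expRN ler_pdivrMr ?expR_gt0//.
have xV0 : 0 < x^-1 by rewrite invr_gt0.
suff H : (x^-1 / k.+2%:R) ^+ k.+2 <= expR x^-1.
  have N0 : k.+2%:R ^+ k.+2 != 0 :> R by rewrite expf_neq0.
  have -> : x^-1 ^+ k = k.+2%:R ^+ k.+2 * x ^+ 2 * (x^-1 / k.+2%:R) ^+ k.+2.
    rewrite expr_div_n; move: N0; set P := k.+2%:R ^+ k.+2 => N0.
    rewrite -(addn2 k) exprD; set Y := x^-1 ^+ k; field.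
    by rewrite N0 gt_eqF.
  by rewrite ler_wpM2l// mulr_ge0// exprn_ge0// ltW.
rewrite -[X in expR X](divfK (x := k.+2%:R)) ?gt_eqF//.
rewrite expRM_natr; apply: lerXn2r.
- by rewrite nnegrE divr_ge0// ltW.
- by rewrite nnegrE expR_ge0.
by apply: le_trans (expR_ge1Dx _); rewrite lerDr.
Qed.

Lemma is_derive_flat k x :
  is_derive x 1 (flat k) (flat k.+2 x - k%:R * flat k.+1 x).
Proof.
have [x0|x0|->] := ltgtP x 0.
- rewrite !flat_eq0 ?ltW// mulr0 subr0.
  apply: (@der_near _ (cst 0)).
  near=> y; rewrite flat_eq0//; apply/ltW.
  by near: y; exact: lt_nbhsl.
- apply: (@der_near _ (fun y => y^-1 ^+ k * expR (- y^-1))).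
    near=> y; rewrite /flat ifT//.
    by near: y; exact: lt_nbhsr.
  have xn0 : x != 0 by rewrite gt_eqF.
  have dV : is_derive x 1 (fun y : R => y^-1) (- 1 / x ^+ 2).
    by apply: (@derV _ id).
  have dX : is_derive x 1 (fun y : R => y^-1 ^+ k) (k%:R * x^-1 ^+ k.-1 * (- 1 / x ^+ 2)).
    exact: derX.
  have := derM dX (der_exp (derN dV)).
  rewrite /flat x0; congr is_derive.
  rewrite !exprS; case: k {dX} => [|k] /=; last rewrite exprS; field; exact: xn0.
rewrite !flat_eq0// mulr0 subr0; apply: is_derive_small => e e0.
have [C C0 HC] : exists2 C : R, 0 < C & forall y, 0 < y -> flat k y <= C * y ^+ 2.
  by exists (k.+2%:R ^+ k.+2); [rewrite exprn_gt0|exact: flat_le].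
near=> y; rewrite mulr0 !subr0 (flat_eq0 k (lexx 0)) subr0.
have [y0|y0] := leP y 0; first by rewrite flat_eq0// normr0 mulr_ge0// ltW.
rewrite ger0_norm ?flat_ge0// gtr0_norm//; apply: le_trans (HC y y0) _.
rewrite expr2 mulrA; apply: ler_wpM2r; first exact: ltW.
rewrite mulrC -ler_pdivlMr//; apply/ltW.
by near: y; apply: lt_nbhsl; rewrite divr_gt0.
Unshelve. all: by end_near. Qed.

Lemma nderivable_flat n k : nderivable n (flat k).
Proof.
elim: n k => [//|n IH] k.
have df x : is_derive x 1 (flat k) (flat k.+2 x + - k%:R * flat k.+1 x).
  by rewrite mulNr; exact: is_derive_flat.
by apply: (nderivableP df); apply: nderivableD => //; exact: nderivableZ.
Qed.

Let den x := flat 0 x + flat 0 (1 - x).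

Lemma flat_den_gt0 x : 0 < den x.
Proof.
have [x0|x0] := ltP 0 x; first by rewrite ltr_pwDl ?flat_gt0 ?flat_ge0.
by rewrite ltr_pwDr ?flat_gt0 ?flat_ge0//; lra.
Qed.

(** The classical smooth step: 0 for x <= 0 and 1 for x >= 1. *)
Definition step x : R := flat 0 x / (flat 0 x + flat 0 (1 - x)).

Lemma step_eq0 x : x <= 0 -> step x = 0.
Proof. by move=> x0; rewrite /step flat_eq0// mul0r. Qed.

Lemma step_eq1 x : 1 <= x -> step x = 1.
Proof.
move=> x1; rewrite /step (flat_eq0 _ (x := 1 - x)) ?subr_le0// addr0 divff//.
by rewrite gt_eqF// flat_gt0//; lra.
Qed.

Lemma step_ge0 x : 0 <= step x.
Proof. by rewrite divr_ge0// ?flat_ge0// ltW// flat_den_gt0. Qed.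

Lemma step_le1 x : step x <= 1.
Proof. by rewrite ler_pdivrMr ?flat_den_gt0// mul1r lerDl flat_ge0. Qed.

Lemma nderivable_step n : nderivable n step.
Proof.
apply: nderivableM; first exact: nderivable_flat.
apply: nderivableV; first by move=> x; rewrite gt_eqF// flat_den_gt0.
apply: nderivableD; first exact: nderivable_flat.
have := nderivable_affine (-1) 1 (nderivable_flat n 0).
by congr nderivable; apply/funext => x; congr flat; lra.
Qed.

(** The function flat 0 is nondecreasing, so that the numerator given by the quotient
    rule is a sum of products of nonnegative terms. *)
Lemma step_deriv_ge0 x : 0 <= derive1 step x.
Proof.
have d1 : is_derive x 1 (flat 0) (flat 2 x).
  by have := is_derive_flat 0 x; rewrite mul0r subr0.
have d2 : is_derive x 1 (fun y => flat 0 (1 - y)) (flat 2 (1 - x) * - 1).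
  apply: (@der_comp _ (flat 0)).
    by have := is_derive_flat 0 (1 - x); rewrite mul0r subr0.
  by have := derB (is_derive_cst (1 : R) x (1 : R)) (is_derive_id x (1 : R)); rewrite sub0r.
have n0 : den x != 0 by rewrite gt_eqF// flat_den_gt0.
have := derM d1 (derV n0 (derD d1 d2)).
move=> d; rewrite derive1E (@derive_val _ _ _ _ _ _ _ d) -/(den x).
have -> : flat 2 x * (den x)^-1 +
   flat 0 x * (- (flat 2 x + flat 2 (1 - x) * -1) / den x ^+ 2) =
  (flat 2 x * flat 0 (1 - x) + flat 0 x * flat 2 (1 - x)) / den x ^+ 2.
  by move: n0; rewrite /den => n0; field.
by rewrite divr_ge0 ?sqr_ge0// addr_ge0// mulr_ge0// flat_ge0.
Qed.

End Smooth.

(** * Weak derivatives control oscillations *)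
Section WeakDerivative.
Context {R : realType} {a b : R} (ab : a < b).
Implicit Types (f g : R -> R) (x y z d : R).
Local Notation I := (integral_on a b).
Local Notation mu := (@lebesgue_measure R).

(** The step rescaled so as to climb from 0 to 1 between x and x + d. *)
Definition ramp x d z : R := step (d^-1 * z + - (x / d)).
Definition bump x d z : R := d^-1 * derive1 (@step R) (d^-1 * z + - (x / d)).

Lemma is_derive_ramp x d z : is_derive z 1 (ramp x d) (bump x d z).
Proof.
rewrite /bump mulrC; apply: (@der_comp _ step).
  exact: (nderivable_is_derive (nderivable_step 1)).
have := derD (derZ d^-1 (is_derive_id z 1)) (is_derive_cst (- (x / d)) z 1).
by rewrite mulr1 addr0.
Qed.

Lemma nderivable_ramp n x d : nderivable n (ramp x d).
Proof. by apply: (@nderivable_affine _ n step); exact: nderivable_step. Qed.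

Lemma ramp_eq0 x d z : 0 < d -> z <= x -> ramp x d z = 0.
Proof.
move=> d0 zx; rewrite /ramp step_eq0// (mulrC _ z) -mulrBl pmulr_lle0 ?invr_gt0//.
by rewrite subr_le0.
Qed.

Lemma ramp_eq1 x d z : 0 < d -> x + d <= z -> ramp x d z = 1.
Proof.
move=> d0 zx; rewrite /ramp step_eq1// (mulrC _ z) -mulrBl ler_pdivlMr// mul1r.
by rewrite lerBrDl.
Qed.

Lemma bump_ge0 x d z : 0 < d -> 0 <= bump x d z.
Proof. by move=> d0; rewrite mulr_ge0 ?step_deriv_ge0// invr_ge0 ltW. Qed.

Lemma bump_eq0 x d z : 0 < d -> z < x \/ x + d < z -> bump x d z = 0.
Proof.
move=> d0 H; have dr := is_derive_ramp x d z.
rewrite -(@derive_val _ _ _ _ _ _ _ dr).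
suff dz : is_derive z 1 (ramp x d) 0 by rewrite derive_val.
case: H => H.
  apply: (@der_near _ (cst 0)); near=> y; rewrite ramp_eq0//.
  by apply/ltW; near: y; exact: lt_nbhsl.
apply: (@der_near _ (cst 1)); near=> y; rewrite ramp_eq1//.
by apply/ltW; near: y; exact: lt_nbhsr.
Unshelve. all: by end_near. Qed.

Lemma derivable_cont f (p q : R) : (forall z, derivable f z 1) -> cont_on `[p, q] f.
Proof.
move=> df; apply: continuous_subspaceT => z.
by apply/differentiable_continuous; rewrite -derivable1_diffP.
Qed.

Lemma cont_bump x d : cont_on `[a, b] (bump x d).
Proof.
apply: derivable_cont => z; have [_] := nderivable_ramp 2 x d.
have -> : derive1 (ramp x d) = bump x d; last by case=> + _; apply.
apply/funext => y; have dr := is_derive_ramp x d y.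
by rewrite derive1E derive_val.
Qed.

Lemma C1_ramp x d : C1_on a b (ramp x d) (bump x d).
Proof.
split; last by move=> z _; exact: is_derive_ramp.
- by apply: derivable_cont => z; have [+ _] := nderivable_ramp 1 x d; apply.
- exact: cont_bump.
Qed.

(** As d tends to 0 the bumps concentrate at x: they form an approximation of
    the Dirac mass. *)
Lemma integral_bump f x e : cont_on `[a, b] f -> x \in `]a, b[ -> 0 < e ->
  exists2 d0, 0 < d0 & forall d, 0 < d -> d < d0 ->
    `|I (fun z => f z * bump x d z) - f x| <= e.
Proof.
move=> cf xab e0; have xab' := subset_itv_oo_cc xab.
move: (xab); rewrite in_itv/= => /andP[ax xb].
move/cont_onP: (cf) => /(_ x xab')/cvgrPdist_le/(_ e e0).
rewrite near_withinE => /nbhs_ballP[d1 /= d10 Hd1].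
exists (Num.min d1 (b - x)); first by rewrite lt_min d10 subr_gt0.
move=> d d0; rewrite lt_min => /andP[dd1 dbx].
have cb : cont_on `[a, b] (bump x d) by exact: cont_bump.
have I1 : I (bump x d) = 1.
  rewrite (FTC ab (C1_ramp x d)) ramp_eq1 ?ramp_eq0 ?subr0//; first exact: ltW.
  by rewrite -lerBrDl ltW.
rewrite -[X in _ - X]mulr1 -I1 -integral_onZ// -integral_onB; [|by solve_cont..].
apply: le_trans (integral_on_norm _) _; first by solve_cont.
rewrite -[leRHS]mulr1 -I1 -integral_onZ//.
apply: integral_on_le; [by solve_cont|by solve_cont|] => z /subset_itv_oo_cc zab.
rewrite -mulrBl normrM (ger0_norm (bump_ge0 _ _ d0)).
have [zx|xz] := ltP z x; first by rewrite bump_eq0 ?mulr0//; left.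
have [xdz|zxd] := ltP (x + d) z; first by rewrite bump_eq0 ?mulr0//; right.
rewrite ler_wpM2r ?bump_ge0// distrC; apply: Hd1 => //=.
by rewrite /ball/= distrC ger0_norm ?subr_ge0//; lra.
Qed.

Lemma ler_dist_itv01 (p q : R) : 0 <= p -> p <= 1 -> 0 <= q -> q <= 1 ->
  `|p - q| <= 1.
Proof. by move=> *; rewrite ler_norml; lra. Qed.

Lemma ler_dist_approx (p q s G y z e : R) : p - q = - s -> `|s| <= G ->
  `|p - y| <= e / 2 -> `|q - z| <= e / 2 -> `|y - z| <= G + e.
Proof.
rewrite !ler_norml => E /andP[G1 G2] /andP[Hx1 Hx2] /andP[Hy1 Hy2].
by apply/andP; split; lra.
Qed.

(** Test with the difference of the ramps that start at x and at y: its derivative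
    approximates the difference of the Dirac masses at x and y, while the test
    function itself is bounded by 1, whatever the width of the ramps. *)
Lemma weak_derivative_osc f f0 g :
  is_weak_derivative `]a, b[ f0 g -> cont_on `[a, b] f ->
  {in `]a, b[, f0 =1 f} -> mu.-integrable `]a, b[ (EFin \o g) ->
  {in `]a, b[ &, forall x y,
    `|f x - f y| <= \int[mu]_(z in `]a, b[) `|g z|}.
Proof.
move=> [_ _ wd] cf f0f ig x y xab yab.
wlog xy : x y xab yab / x < y.
  move=> H; case: (ltgtP x y) => [| |->]; [exact: H|rewrite distrC; exact: H|].
  by rewrite subrr normr0; apply: Rintegral_ge0.
apply/ler_addgt0Pr => e e0.
have e20 : 0 < e / 2 by rewrite divr_gt0.
have [dx dx0 Hx] := integral_bump cf xab e20.
have [dy dy0 Hy] := integral_bump cf yab e20.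
move: (xab) (yab); rewrite !in_itv/= => /andP[ax xb] /andP[ay yb].
pose d := Num.min (Num.min dx dy) (b - y) / 2.
have m0 : 0 < Num.min (Num.min dx dy) (b - y) by rewrite !lt_min dx0 dy0 subr_gt0.
have d0 : 0 < d by rewrite divr_gt0.
have : d < Num.min (Num.min dx dy) (b - y) by rewrite /d; lra.
rewrite !lt_min => /andP[/andP[ddx ddy] dby].
pose phi z := ramp x d z - ramp y d z.
have dphi z : is_derive z 1 phi (bump x d z - bump y d z).
  by apply: derB; exact: is_derive_ramp.
have tphi : test_function `]a, b[ phi.
  split.
    apply: nderivable_derive1n => n.
    have := nderivableD (nderivable_ramp n x d) (nderivableZ (-1) (nderivable_ramp n y d)).
    by congr nderivable; apply/funext => z; rewrite mulN1r.
  exists `[x, y + d]%classic; split; first exact: segment_compact.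
    move=> z /=; rewrite !in_itv/= => /andP[xz zy].
    by rewrite (lt_le_trans ax)//= (le_lt_trans zy)// -ltrBrDl.
  move=> z /=; rewrite in_itv/= => /negP; rewrite negb_and -!ltNge => /orP[zx|yz].
    rewrite /phi ramp_eq0 ?(ltW zx)// ramp_eq0 ?subr0//.
    exact/ltW/(lt_trans zx xy).
  rewrite /phi ramp_eq1//; last by apply/ltW; apply: lt_trans yz; rewrite ltrD2r.
  by rewrite ramp_eq1 ?subrr// ltW.
have := wd phi tphi.
have cbx : cont_on `[a, b] (bump x d) by exact: cont_bump.
have cby : cont_on `[a, b] (bump y d) by exact: cont_bump.
have -> : \int[mu]_(z in `]a, b[) (f0 z * derive1 phi z) =
    I (fun z => f z * bump x d z) - I (fun z => f z * bump y d z).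
  rewrite -integral_onB; [|by solve_cont..]; rewrite -integral_oo; last by solve_cont.
  apply: eq_Rintegral => z; rewrite inE => zab; rewrite f0f//.
  by have dz := dphi z; rewrite derive1E derive_val mulrBr.
move=> E; have {}Hx := Hx d d0 ddx; have {}Hy := Hy d d0 ddy.
have phi1 z : `|phi z| <= 1.
  by apply: ler_dist_itv01; [exact: step_ge0|exact: step_le1|
    exact: step_ge0|exact: step_le1].
have mphi : measurable_fun `]a, b[ phi.
  apply: cont_on_measurable_oo; apply: derivable_cont => z.
  by have dz := dphi z; exact: ex_derive.
have igphi : mu.-integrable `]a, b[ (EFin \o (fun z => g z * phi z)).
  apply: (le_integrable _ _ _ ig) => //.
    apply/measurable_EFinP; apply: measurable_funM => //.
    by apply/measurable_EFinP; exact: (measurable_int mu ig).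
  by move=> z _; rewrite lee_fin normrM ler_piMr.
have G : `|\int[mu]_(z in `]a, b[) (g z * phi z)| <= \int[mu]_(z in `]a, b[) `|g z|.
  apply: le_trans (le_normr_Rintegral _ igphi) _ => //.
  apply: le_Rintegral => //.
  - exact: (integrable_abse igphi).
  - exact: (integrable_abse ig).
  - by move=> z _; rewrite normrM ler_piMr.
exact: ler_dist_approx E G Hx Hy.
Qed.

End WeakDerivative.

(** * Uniform convergence at the initial time *)
Section InitialTrace.
Context {R : realType} {a b : R} (ab : a < b).
Implicit Types (f g : R -> R) (x y z d : R).
Local Notation I := (integral_on a b).
Local Notation mu := (@lebesgue_measure R).
Local Notation Omega := (`]a, b[%classic : set R).

(** Hoelder's inequality against the indicator function of the bounded interval. *)
Lemma L1_le_Lr r : 1 < r -> exists2 c, 0 <= c & forall g,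
  measurable_fun Omega g ->
  (\int[mu]_(x in Omega) `|g x|%:E <= LpNorm Omega r%:E g * c%:E)%E.
Proof.
move=> r1; have r0 : 0 < r by rewrite (lt_trans _ r1).
pose q := (1 - r^-1)^-1.
have rV1 : r^-1 < 1 by rewrite invf_lt1.
have q0 : 0 < q by rewrite invr_gt0 subr_gt0.
have pq : r^-1 + q^-1 = 1 by rewrite /q invrK addrC subrK.
pose c := Lnorm mu q%:E (EFin \o \1_Omega).
have cfin : c \is a fin_num.
  have -> : c = (mu Omega `^ q^-1)%E.
    rewrite /c unlock; congr poweR.
    rewrite -[RHS]mul1e -(integral_cst mu (measurable_itv `]a, b[) 1).
    rewrite [RHS]integral_mkcond; apply: eq_integral => x _ /=.
    rewrite patchE indicE; case: (x \in Omega); first by rewrite normr1 powR1.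
    by rewrite normr0 powR0// gt_eqF.
  by rewrite lebesgue_measure_itv/= lte_fin ab -EFinB.
exists (fine c) => [|g mg]; first by rewrite fine_ge0// Lnorm_ge0.
rewrite fineK//; have mgO : measurable_fun setT (g \_ Omega).
  by apply: (measurable_restrictT g (measurable_itv `]a, b[)).1.
have := hoelder mu mgO (measurable_indic (measurable_itv `]a, b[)) r0 q0 pq.
apply: le_trans; rewrite Lnorm1 le_eqVlt; apply/orP; left; apply/eqP.
rewrite [LHS]integral_mkcond; apply: eq_integral => x _ /=.
rewrite !patchE indicE.
by case: (x \in Omega); rewrite ?mulr1 ?mulr0 ?normr0.
Qed.

Lemma Lr_integrable r g : 1 < r -> measurable_fun Omega g ->
  (LpNorm Omega r%:E g < +oo)%E -> mu.-integrable Omega (EFin \o g).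
Proof.
move=> r1 mg fg; have [c c0 Hc] := L1_le_Lr r1.
apply/integrableP; split; first exact/measurable_EFinP.
apply: le_lt_trans (Hc g mg) _.
apply: lte_mul_pinfty; [exact: Lnorm_ge0| |by rewrite ltry].
by rewrite ge0_fin_numE//; exact: Lnorm_ge0.
Qed.

(** The finite L^r norms make all the products with test functions integrable, so
    that the defining identities may be subtracted. *)
Lemma weak_derivativeB r f1 f2 g1 g2 : 1 < r ->
  is_weak_derivative Omega f1 g1 -> is_weak_derivative Omega f2 g2 ->
  (LpNorm Omega r%:E f1 < +oo)%E -> (LpNorm Omega r%:E f2 < +oo)%E ->
  (LpNorm Omega r%:E g1 < +oo)%E -> (LpNorm Omega r%:E g2 < +oo)%E ->
  is_weak_derivative Omega (fun x => f1 x - f2 x) (fun x => g1 x - g2 x).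
Proof.
move=> r1 [lf1 lg1 H1] [lf2 lg2 H2] nf1 nf2 ng1 ng2.
have if1 := Lr_integrable r1 (let: And3 m _ _ := lf1 in m) nf1.
have if2 := Lr_integrable r1 (let: And3 m _ _ := lf2 in m) nf2.
have ig1 := Lr_integrable r1 (let: And3 m _ _ := lg1 in m) ng1.
have ig2 := Lr_integrable r1 (let: And3 m _ _ := lg2 in m) ng2.
split; [exact: locally_integrableB|exact: locally_integrableB|].
move=> phi tphi; have [dphi _] := tphi.
have intM h psi : mu.-integrable Omega (EFin \o h) ->
    (forall x, derivable psi x 1) ->
    mu.-integrable Omega (EFin \o (fun x => h x * psi x)).
  move=> ih dpsi; have cpsi : cont_on `[a, b] psi by exact: derivable_cont.
  have [M M0 HM] := cont_bounded ab cpsi.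
  have iMh : mu.-integrable Omega (EFin \o (fun x => M * h x)).
    by apply: (integrableZl _ M ih).
  apply: (le_integrable _ _ _ iMh) => //.
    apply/measurable_EFinP; apply: measurable_funM.
      by apply/measurable_EFinP; exact: (measurable_int mu ih).
    exact: cont_on_measurable_oo.
  move=> x xO; rewrite /= lee_fin !normrM mulrC (ger0_norm M0) ler_wpM2r//.
  by apply: HM; exact: subset_itv_oo_cc xO.
have := H1 phi tphi; have := H2 phi tphi => E2 E1.
have d0 x : derivable phi x 1 by exact: (dphi 0%N x).
have d1 x : derivable (derive1 phi) x 1 by exact: (dphi 1%N x).
under eq_Rintegral do rewrite mulrBl.
rewrite RintegralB//; [|exact: intM|exact: intM].
under [in RHS]eq_Rintegral do rewrite mulrBl.
rewrite RintegralB//; [|exact: intM|exact: intM].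
by rewrite E1 E2 opprB opprK addrC.
Qed.

(** The embedding of W^{1,r} into the continuous functions, in dimension one. *)
Lemma W1_sup r : 1 < r -> exists2 c, 0 <= c & forall f f0 e,
  cont_on `[a, b] f -> {in `]a, b[, f0 =1 f} ->
  (exists g, is_weak_derivative Omega f0 g) ->
  (W1norm Omega r%:E f0 <= e%:E)%E ->
  forall x, x \in `]a, b[ -> `|f x| <= c * e.
Proof.
move=> r1; have [c c0 Hc] := L1_le_Lr r1.
have L0 : 0 < b - a by rewrite subr_gt0.
exists (c / (b - a) + c).
  by rewrite addr_ge0// divr_ge0// ltW.
move=> f f0 e cf f0f [g1 wg1] We x xab.
set g := weak_derivative Omega f0.
have wg : is_weak_derivative Omega f0 g.
  exact: (@getPex _ [set g | is_weak_derivative Omega f0 g] (ex_intro _ g1 wg1)).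
have [lf lg _] := wg; have [mf _ _] := lf; have [mg _ _] := lg.
have nf : (LpNorm Omega r%:E f0 <= e%:E)%E.
  by apply: le_trans We; rewrite leeDl// Lnorm_ge0.
have ng : (LpNorm Omega r%:E g <= e%:E)%E.
  by apply: le_trans We; rewrite leeDr// Lnorm_ge0.
have bnd h : measurable_fun Omega h -> (LpNorm Omega r%:E h <= e%:E)%E ->
    mu.-integrable Omega (EFin \o h) /\ \int[mu]_(x in Omega) `|h x| <= c * e.
  move=> mh nh.
  have ih : mu.-integrable Omega (EFin \o h).
    by apply: (Lr_integrable r1) => //; apply: le_lt_trans nh _; rewrite ltry.
  split => //; rewrite -lee_fin /Rintegral fineK; last first.
    exact: (integrable_fin_num _ (integrable_abse ih)).
  apply: le_trans (Hc h mh) _; rewrite mulrC EFinM.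
  by rewrite lee_wpmul2r.
have [_ nf'] := bnd _ mf nf; have [ig ng'] := bnd _ mg ng.
have osc := weak_derivative_osc ab wg cf f0f ig.
have nf'' : I (fun x => `|f x|) <= c * e.
  apply: le_trans nf'; rewrite -integral_oo; last exact: cont_on_norm.
  by rewrite le_eqVlt; apply/orP; left; apply/eqP/eq_Rintegral => y; rewrite inE => /f0f ->.
have H : `|f x| * (b - a) <= c * e + c * e * (b - a).
  rewrite -!(integral_on_cst _ (ltW ab)).
  apply: le_trans (lerD nf'' (lexx _)); rewrite -integral_onD; first last.
  - exact: cont_on_cst.
  - exact: cont_on_norm.
  apply: integral_on_le; [exact: cont_on_cst| |].
    by apply: cont_onD; [exact: cont_on_norm|exact: cont_on_cst].
  move=> y yab; have := le_trans (osc x y xab yab) ng'.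
  have := ler_normD (f x - f y) (f y); rewrite subrK; lra.
have -> : (c / (b - a) + c) * e = (c * e + c * e * (b - a)) / (b - a).
  by field; rewrite gt_eqF.
by rewrite ler_pdivlMr.
Qed.

(** The continuity of t |-> v(t) into W^{1,r} enters the whole argument through
    this uniform convergence. *)
Lemma initial_trace r (v : R -> R -> R) v0 : 1 < r ->
  continuous_W1 Omega r%:E v -> (forall t, 0 < t -> cont_on `[a, b] (v^~ t)) ->
  cont_on `[a, b] v0 -> {in `]a, b[, v^~ 0 =1 v0} ->
  forall e, 0 < e -> exists2 d, 0 < d & forall t x, 0 < t -> t < d ->
    x \in `]a, b[ -> `|v x t - v0 x| <= e.
Proof.
move=> r1 [vW vc] cv cv0 v00 e e0; have [c c0 Hc] := W1_sup r1.
have e10 : 0 < e / (c + 1) by rewrite divr_gt0// ltr_wpDl.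
have fin f : Lp Omega r%:E f -> (LpNorm Omega r%:E f < +oo)%E.
  by move=> /sub_Lfun_finLfun; rewrite inE.
have := vc 0 (lexx 0) [set u | (u < (e / (c + 1))%:E)%E].
case; first by apply: open_ereal_lt'; rewrite lte_fin.
move=> d /= d0 Hd; exists d => // t x t0 td xab.
have [Lf1 [g1 wg1 Lg1]] := vW t (ltW t0); have [Lf2 [g2 wg2 Lg2]] := vW 0 (lexx 0).
apply: (@le_trans _ _ (c * (e / (c + 1)))); last first.
  by rewrite mulrCA ger_pMr// ler_pdivrMr ?mul1r ?lerDl// ltr_wpDl.
apply: (Hc (fun x => v x t - v0 x) (fun x => v x t - v x 0)) => //.
- by have := cv t t0; move=> ?; solve_cont.
- by move=> y yab /=; rewrite v00.
- exists (fun x => g1 x - g2 x); apply: (weak_derivativeB r1) => //; exact: fin.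
apply/ltW/Hd => //=; last by rewrite in_itv/= ltW.
by rewrite sub0r normrN gtr0_norm.
Qed.

End InitialTrace.

(** * Scalar differential inequalities *)
Section DifferentialInequalities.
Context {R : realType}.
Implicit Types (F : R -> R) (p q t : R).

Lemma nondecreasing_of_derive F F' p q : p <= q ->
  (forall t, p <= t <= q -> is_derive t 1 F (F' t)) ->
  (forall t, p <= t <= q -> 0 <= F' t) -> F p <= F q.
Proof.
move=> pq dF F'0; have [| |t] := MVT_segment pq (f := F) (df := F').
- by move=> t /subset_itv_oo_cc; rewrite in_itv/= => /dF.
- apply: derivable_within_continuous => t; rewrite in_itv/= => ptq.
  by have dt := dF t ptq; exact: ex_derive.
rewrite in_itv/= => ptq E; rewrite -subr_ge0 E mulr_ge0 ?F'0//.
by rewrite subr_ge0.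
Qed.

(** The function (F - C / e) exp(e t) is nonincreasing. *)
Lemma gronwall_exp F F' C e p : 0 < e ->
  (forall t, p <= t -> is_derive t 1 F (F' t)) ->
  (forall t, p <= t -> F' t <= C - e * F t) ->
  forall t, p <= t -> F t - C / e <= (F p - C / e) * expR (- (e * (t - p))).
Proof.
move=> e0 dF F'le t pt.
have := @nondecreasing_of_derive (fun s => - ((F s - C / e) * expR (e * s)))
  (fun s => - ((F' s - 0) * expR (e * s) + (F s - C / e) * (expR (e * s) * (e * 1)))) p t pt.
move=> H; have {H} : (F t - C / e) * expR (e * t) <= (F p - C / e) * expR (e * p).
  rewrite -lerN2; apply: H => s /andP[ps st].
    exact: (derN (derM (derB (dF s ps) (is_derive_cst (C / e) s (1 : R)))
      (der_exp (derZ e (is_derive_id s (1 : R)))))).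
  have := F'le s ps; rewrite -subr_ge0 => H.
  have -> : - ((F' s - 0) * expR (e * s) + (F s - C / e) * (expR (e * s) * (e * 1))) =
      (C - e * F s - F' s) * expR (e * s) by field; rewrite gt_eqF.
  by rewrite mulr_ge0// expR_ge0.
have -> : - (e * (t - p)) = e * p - e * t by ring.
by rewrite expRB mulrA ler_pdivlMr ?expR_gt0.
Qed.

Lemma gronwall F F' C e p : 0 < e ->
  (forall t, p <= t -> is_derive t 1 F (F' t)) ->
  (forall t, p <= t -> F' t <= C - e * F t) ->
  forall t, p <= t -> F t <= Num.max (F p) (C / e).
Proof.
move=> e0 dF F'le t pt; have := gronwall_exp e0 dF F'le pt.
have E1 : expR (- (e * (t - p))) <= 1.
  by rewrite -expR0 ler_expR oppr_le0 mulr_ge0 ?subr_ge0// ltW.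
have E0 := expR_ge0 (- (e * (t - p))).
rewrite le_max; have [h|/ltW h] := leP (F p) (C / e) => H; apply/orP.
  right; rewrite -subr_le0; apply: le_trans H _.
  by rewrite mulr_le0_ge0// subr_le0.
left; rewrite -(lerD2r (- (C / e))); apply: le_trans H _.
by rewrite ler_piMr// subr_ge0.
Qed.

End DifferentialInequalities.

(** * The backward heat kernel as a test function *)
Section HeatKernel.
Context {R : realType} {a b : R} (ab : a < b).
Implicit Types (x t : R).
Local Notation I := (integral_on a b).

Definition heat_exponent x0 t0 x t : R :=
  - (2^-1 * ln (t0 - t)) - (x - x0) ^+ 2 / 4 * (t0 - t)^-1 - (t0 - t).

(** Up to a constant factor, the backward heat kernel with pole (x0, t0),
    damped so as to solve the adjoint of v_t = v_xx - v. *)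
Definition heat_kernel x0 t0 x t : R := expR (heat_exponent x0 t0 x t).

Definition heat_exponent_t x0 t0 x t : R :=
  2^-1 * (t0 - t)^-1 - (x - x0) ^+ 2 / 4 * (t0 - t)^-1 ^+ 2 + 1.

Definition heat_exponent_x x0 t0 x t : R := - ((x - x0) / 2 * (t0 - t)^-1).

Context (x0 t0 : R) (xab : x0 \in `]a, b[).
Local Notation K := (heat_kernel x0 t0).
Local Notation J := [set t | 0 < t < t0].
Local Notation D := ([set` `[a, b]] `*` J).

Lemma open_before : open J.
Proof.
have -> : J = [set t | 0 < t] `&` [set t | t < t0].
  by apply/seteqP; split => t /= => [/andP[]|[-> ->]].
by apply: openI; [exact: open_gt|exact: open_lt].
Qed.

Lemma der_heat_t x t : J t -> is_derive t 1 (K x) (K x t * heat_exponent_t x0 t0 x t).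
Proof.
move=> /andP[_ tt0]; have T0 : 0 < t0 - t by rewrite subr_gt0.
have d0 : is_derive t 1 (fun s => t0 - s) (0 - 1) by apply: derB.
have := derB (derB (derN (derZ 2^-1 (der_ln (f := fun s => t0 - s) T0 d0)))
  (derZ ((x - x0) ^+ 2 / 4) (derV (f := fun s => t0 - s) (lt0r_neq0 T0) d0))) d0.
move/der_exp; congr is_derive; congr (_ * _).
by rewrite /heat_exponent_t; field; rewrite gt_eqF.
Qed.

Lemma der_heat_x x t : J t -> is_derive x 1 (K^~ t) (K x t * heat_exponent_x x0 t0 x t).
Proof.
move=> /andP[_ tt0]; have T0 : 0 < t0 - t by rewrite subr_gt0.
have d0 : is_derive x 1 (fun y => y - x0) (1 - 0) by apply: derB.
have c (k : R) : is_derive x 1 (fun=> k) 0 by exact: is_derive_cst.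
have := derB (derB (c (- (2^-1 * ln (t0 - t))))
  (derM (derM (derX 2 d0) (c 4^-1)) (c (t0 - t)^-1))) (c (t0 - t)).
move/der_exp; congr is_derive; congr (_ * _).
by rewrite /heat_exponent_x; field; rewrite gt_eqF.
Qed.

Lemma C1_heat t : J t -> C1_on a b (K^~ t) (fun x => K x t * heat_exponent_x x0 t0 x t).
Proof.
move=> Jt; have cid := @cont_on_id R a b.
have cK : cont_on `[a, b] (K^~ t).
  by apply: derivable_cont => x; have d := der_heat_x x Jt; exact: ex_derive.
split => //; last by move=> x _; exact: der_heat_x.
by rewrite /heat_exponent_x; solve_cont.
Qed.

Lemma C1_heatx t : J t -> C1_on a b (fun x => K x t * heat_exponent_x x0 t0 x t)
  (fun x => K x t * (heat_exponent_x x0 t0 x t ^+ 2 - 2^-1 * (t0 - t)^-1)).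
Proof.
move=> Jt; have [cK cKx dK] := C1_heat Jt; have cid := @cont_on_id R a b.
split => //.
  by rewrite /heat_exponent_x; solve_cont.
move=> x xab'; have d0 : is_derive x 1 (fun y => y - x0) (1 - 0) by apply: derB.
have c (k : R) : is_derive x 1 (fun=> k) 0 by exact: is_derive_cst.
have := derM (dK x xab') (derN (derM (derM d0 (c 2^-1)) (c (t0 - t)^-1))).
by congr is_derive; rewrite /heat_exponent_x; ring.
Qed.

Context (v vx vxx vt : R -> R -> R) (sv : neumann_smooth a b v vx vxx vt).
Context (v_ge0 : forall x t, x \in `[a, b] -> 0 < t -> 0 <= v x t).
Context (v_super : forall x t, x \in `]a, b[ -> 0 < t -> vxx x t - v x t <= vt x t).

(** The kernel K solves K_t + K_xx - K = 0, so two integrations by parts leave the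
    nonnegative defect of the supersolution v and the boundary terms
    - K_x v at b and K_x v at a. These are nonnegative since K decreases away
    from its pole, which lies inside the interval. *)
Lemma der_heat_integral t : J t ->
  exists2 l, is_derive t 1 (fun s => I (fun x => K x s * v x s)) l & 0 <= l.
Proof.
move=> Jt; have /andP[tpos tt0] := Jt.
pose w' x s := K x s * heat_exponent_t x0 t0 x s * v x s + K x s * vt x s.
have [cv cvx cvxx cvt] := ns_slice sv tpos.
have c1 : cont_on D (fun z : R * R => z.1).
  by apply: continuous_subspaceT => z; exact: cvg_fst.
have c2 : cont_on D (fun z : R * R => z.2).
  by apply: continuous_subspaceT => z; exact: cvg_snd.
have subD : D `<=` [set` `[a, b]] `*` [set s | 0 < s].
  by move=> [y s] /= [yab /andP[s0 _]].
have Dv : cont_on D (fun z => v z.1 z.2) by exact: cont_on_sub subD (ns_cont sv).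
have Dvt : cont_on D (fun z => vt z.1 z.2) by exact: cont_on_sub subD (ns_contt sv).
have Dlt (z : R * R) : D z -> 0 < t0 - z.2.
  by move=> [_ /andP[_ h]]; rewrite subr_gt0.
have cT : cont_on D (fun z : R * R => t0 - z.2) by solve_cont.
have cln := cont_on_ln Dlt cT.
have cV := cont_onV (fun z Dz => lt0r_neq0 (Dlt z Dz)) cT.
have cE : cont_on D (fun z : R * R => heat_exponent x0 t0 z.1 z.2).
  by rewrite /heat_exponent; solve_cont.
have cK := cont_on_exp cE.
have cEt : cont_on D (fun z : R * R => heat_exponent_t x0 t0 z.1 z.2).
  by rewrite /heat_exponent_t; solve_cont.
have cw' : continuous_in D w'.
  suff : cont_on D (fun z => expR (heat_exponent x0 t0 z.1 z.2) *
    heat_exponent_t x0 t0 z.1 z.2 * v z.1 z.2 +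
    expR (heat_exponent x0 t0 z.1 z.2) * vt z.1 z.2) by [].
  by solve_cont.
exists (I (w'^~ t)).
  apply: (@derive_integral _ _ _ _ open_before (fun x s => K x s * v x s) w' t ab).
  - move=> s /[dup] Js /andP[s0 _]; have [? _ _ _] := ns_slice sv s0.
    by have [? _ _] := C1_heat Js; solve_cont.
  - move=> x s xab' Js; have /andP[s0 _] := Js.
    exact: (derM (der_heat_t x Js) (ns_dert sv xab' s0)).
  - exact: cw'.
  - exact: Jt.
have [cKt cKx _] := C1_heat Jt; have [_ cKxx _] := C1_heatx Jt.
have cEt' : cont_on `[a, b] (heat_exponent_t x0 t0 ^~ t).
  by have cid := @cont_on_id R a b; rewrite /heat_exponent_t; solve_cont.
have [vxa vxb] := ns_bdry sv tpos.
have E1 := integration_by_parts_on ab (ns_C1x sv tpos) (C1_heat Jt).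
have E2 := integration_by_parts_on ab (ns_C1 sv tpos) (C1_heatx Jt).
rewrite vxa vxb !mul0r subrr sub0r in E1.
apply: (@le_trans _ _ (I (fun x => K x t * heat_exponent_t x0 t0 x t * v x t
    + (vxx x t * K x t - K x t * v x t)))); last first.
  apply: integral_on_le; [by solve_cont|by rewrite /w'; solve_cont|].
  move=> x xab'; rewrite /w' lerD2l (mulrC (vxx x t)) -mulrBr ler_wpM2l//.
    exact: expR_ge0.
  exact: v_super.
rewrite integral_onD; [|by solve_cont..].
rewrite integral_onB; [|by solve_cont..].
rewrite E1 E2 opprB.
have T0 : t0 - t != 0 by rewrite gt_eqF ?subr_gt0.
have -> : I (fun x => v x t * (K x t * (heat_exponent_x x0 t0 x t ^+ 2
      - 2^-1 * (t0 - t)^-1))) =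
    I (fun x => K x t * v x t) - I (fun x => K x t * heat_exponent_t x0 t0 x t * v x t).
  rewrite -integral_onB; [|by solve_cont..]; apply: eq_integral_on => x _.
  by rewrite /heat_exponent_x /heat_exponent_t; field.
set A := I _; set B := I _.
have Ha : 0 <= v a t * (K a t * heat_exponent_x x0 t0 a t).
  apply: mulr_ge0; first by apply: v_ge0 => //; rewrite bound_itvE ltW.
  apply: mulr_ge0; first exact: expR_ge0.
  rewrite oppr_ge0; apply: mulr_le0_ge0; last by rewrite invr_ge0 subr_ge0 ltW.
  by move: xab; rewrite in_itv/= => /andP[? _]; rewrite pmulr_lle0 ?invr_gt0// subr_le0 ltW.
have Hb : v b t * (K b t * heat_exponent_x x0 t0 b t) <= 0.
  apply: mulr_ge0_le0; first by apply: v_ge0 => //; rewrite bound_itvE ltW.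
  apply: mulr_ge0_le0; first exact: expR_ge0.
  rewrite oppr_le0; apply: mulr_ge0; last by rewrite invr_ge0 subr_ge0 ltW.
  by move: xab; rewrite in_itv/= => /andP[_ ?]; rewrite divr_ge0// subr_ge0 ltW.
lra.
Qed.

End HeatKernel.

(** * From the mass of a supersolution to a pointwise lower bound *)
Section PointwiseLowerBound.
Context {R : realType} {a b : R} (ab : a < b).
Implicit Types (x t : R).
Local Notation I := (integral_on a b).

(** The square root of the time that remains before the pole. *)
Definition heat_scale t0 t : R := expR (2^-1 * ln (t0 - t)).

Lemma heat_scale_sqr t0 t : t < t0 -> heat_scale t0 t ^+ 2 = t0 - t.
Proof.
move=> tt0; rewrite /heat_scale -expRM_natr mulrAC mulVf// mul1r lnK//.
by rewrite posrE subr_gt0.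
Qed.

Lemma heat_kernelE x0 t0 x t : heat_kernel x0 t0 x t =
  (heat_scale t0 t)^-1 * expR (- ((x - x0) ^+ 2 / 4 * (t0 - t)^-1)) *
  expR (- (t0 - t)).
Proof. by rewrite /heat_kernel /heat_exponent /heat_scale -expRN !expRD. Qed.

(** From exp(-y) <= 1 / (1 + y). This bound integrates to an arctangent, and
    the factor 2 pi that results only affects the constant of the lower bound. *)
Lemma heat_kernel_le_atan x0 t0 x t : t < t0 -> heat_kernel x0 t0 x t <=
  (heat_scale t0 t)^-1 * (1 + ((x - x0) / (2 * heat_scale t0 t)) ^+ 2)^-1.
Proof.
move=> tt0; have s0 : 0 < heat_scale t0 t by exact: expR_gt0.
have T0 : 0 < t0 - t by rewrite subr_gt0.
rewrite heat_kernelE -mulrA; apply: ler_wpM2l; first by rewrite invr_ge0 ltW.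
have -> : ((x - x0) / (2 * heat_scale t0 t)) ^+ 2 = (x - x0) ^+ 2 / 4 * (t0 - t)^-1.
  by rewrite -(heat_scale_sqr tt0); field; rewrite gt_eqF.
set y := (X in 1 + X); have y0 : 0 <= y.
  by apply: mulr_ge0; [rewrite divr_ge0 ?sqr_ge0|rewrite invr_ge0 ltW].
apply: (@le_trans _ _ (expR (- y) * 1)).
  apply: ler_wpM2l; first exact: expR_ge0.
  by rewrite -[leRHS]expR0 ler_expR oppr_le0 ltW.
rewrite mulr1 expRN lef_pV2 ?posrE ?expR_gt0 ?expR_ge1Dx//.
by rewrite ltr_pwDl.
Qed.

Lemma heat_kernel_moment x0 t0 x t : t < t0 ->
  heat_kernel x0 t0 x t * (x - x0) ^+ 2 <= 4 * heat_scale t0 t.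
Proof.
move=> tt0; have s0 : 0 < heat_scale t0 t by exact: expR_gt0.
apply: le_trans (ler_wpM2r (sqr_ge0 _) (heat_kernel_le_atan x0 x tt0)) _.
set s := heat_scale t0 t; have {}s0 : 0 < s by [].
have -> : ((x - x0) / (2 * s)) ^+ 2 = (x - x0) ^+ 2 / (4 * s ^+ 2).
  by field; rewrite gt_eqF.
set y := (x - x0) ^+ 2; have y0 : 0 <= y by exact: sqr_ge0.
have s20 : 0 < 4 * s ^+ 2 by rewrite mulr_gt0// exprn_gt0.
have d0 : 0 < 4 * s ^+ 2 + y by rewrite ltr_pwDl.
have -> : s^-1 * (1 + y / (4 * s ^+ 2))^-1 * y = 4 * s * (y / (4 * s ^+ 2 + y)).
  by field; rewrite !gt_eqF.
rewrite -[leRHS]mulr1; apply: ler_wpM2l; first by rewrite mulr_ge0// ltW.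
by rewrite ltW// ltr_pdivrMr// mul1r ltrDr.
Qed.

Lemma integral_atan_le (x0 s : R) : 0 < s ->
  I (fun x => s^-1 * (1 + ((x - x0) / (2 * s)) ^+ 2)^-1) <= 2 * pi.
Proof.
move=> s0; pose F x := 2 * atan ((x - x0) / (2 * s)).
have s20 : 0 < 2 * s by rewrite mulr_gt0.
have dF x : is_derive x 1 F (s^-1 * (1 + ((x - x0) / (2 * s)) ^+ 2)^-1).
  have d1 : is_derive x 1 (fun y => (y - x0) / (2 * s))
    ((1 - 0) * (2 * s)^-1 + (x - x0) * 0).
    by apply: derM; apply: derB.
  have := derZ 2 (@der_comp _ atan (fun y => (y - x0) / (2 * s)) _ _ _
    (is_derive1_atan _) d1).
  congr is_derive; field; rewrite gt_eqF//=.
  have : 0 < 1 + ((x - x0) / (2 * s)) ^+ 2 by rewrite ltr_pwDl// sqr_ge0.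
  have -> : 1 + ((x - x0) / (2 * s)) ^+ 2 =
    (4 * s ^+ 2 + (x - x0) ^+ 2) / (4 * s ^+ 2) by field; rewrite gt_eqF.
  move=> h; rewrite gt_eqF//.
  by move: h; rewrite pmulr_lgt0 ?invr_gt0 ?mulr_gt0 ?exprn_gt0//; lra.
have CF : C1_on a b F (fun x => s^-1 * (1 + ((x - x0) / (2 * s)) ^+ 2)^-1).
  split; last by move=> x _; exact: dF.
    by apply: derivable_cont => x; have dx := dF x; exact: ex_derive.
  have cid := @cont_on_id R a b.
  have c1 : cont_on `[a, b] (fun x => 1 + ((x - x0) / (2 * s)) ^+ 2) by solve_cont.
  have h (x : R) : `[a, b]%classic x -> 1 + ((x - x0) / (2 * s)) ^+ 2 != 0.
    by move=> _; rewrite gt_eqF// ltr_pwDl// sqr_ge0.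
  by have c2 := cont_onV h c1; solve_cont.
rewrite (FTC ab CF) /F.
have := atan_ltpi2 ((b - x0) / (2 * s)); have := atan_gtNpi2 ((a - x0) / (2 * s)).
lra.
Qed.

Context (v vx vxx vt : R -> R -> R) (sv : neumann_smooth a b v vx vxx vt).
Context (v_ge0 : forall x t, x \in `[a, b] -> 0 < t -> 0 <= v x t).
Context (v_super : forall x t, x \in `]a, b[ -> 0 < t -> vxx x t - v x t <= vt x t).

Lemma heat_integral_nondecreasing x0 t0 s t : x0 \in `]a, b[ -> 0 < s -> s <= t ->
  t < t0 ->
  I (fun x => heat_kernel x0 t0 x s * v x s) <= I (fun x => heat_kernel x0 t0 x t * v x t).
Proof.
move=> x0ab s0 st tt0; have t00 : 0 < t0 by rewrite (lt_trans s0)// (le_lt_trans st).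
have H r : s <= r <= t -> exists l, is_derive r 1
    (fun s => I (fun x => heat_kernel x0 t0 x s * v x s)) l /\ 0 <= l.
  move=> /andP[sr rt]; have Jr : [set r | 0 < r < t0] r.
    by rewrite /= (lt_le_trans s0)//= (le_lt_trans rt).
  by have [l ? ?] := der_heat_integral ab x0ab sv v_ge0 v_super Jr; exists l.
apply: (@nondecreasing_of_derive _ (fun s => I (fun x => heat_kernel x0 t0 x s * v x s))
   (derive1 (fun s => I (fun x => heat_kernel x0 t0 x s * v x s)))) => // r /H[l [dl l0]].
  by rewrite derive1E; apply: derivableP; exact: ex_derive.
by rewrite derive1E (@derive_val _ _ _ _ _ _ _ dl).
Qed.

(** Close to (x0, t0) the function v exceeds v(x0, t0) by at most n; elsewhere it is
    bounded by M + 1 <= Q (x - x0)^2, and the second moment of the kernel tends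
    to 0 with its width. *)
Lemma heat_integral_limit x0 t0 e : x0 \in `]a, b[ -> 0 < t0 -> 0 < e ->
  exists2 d, 0 < d & forall t, 0 < t -> t0 - d < t -> t < t0 ->
    I (fun x => heat_kernel x0 t0 x t * v x t) <= 2 * pi * v x0 t0 + e.
Proof.
move=> x0ab t00 e0; have x0ab' := subset_itv_oo_cc x0ab.
have L0 : 0 < b - a by rewrite subr_gt0.
have p0 : 0 < 2 * pi :> R by rewrite mulr_gt0// pi_gt0.
have [cv0 _ _ _] := ns_slice sv t00; have [M M0 HM] := cont_bounded ab cv0.
pose n := e / 2 / (2 * pi); have n0 : 0 < n by rewrite !divr_gt0.
have [[U V] /= [Ux Vt] UV] := continuous_in_near (ns_cont sv) x0ab' t00 n0.
have [h /= h0 Uh] : exists2 h : R, 0 < h & forall x, `|x - x0| < h -> U x.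
  by move/nbhs_ballP: Ux => [h h0 H]; exists h => // x xh; apply: H; rewrite /ball/= distrC.
pose Q := (M + 1) / h ^+ 2.
have Q0 : 0 <= Q by rewrite divr_ge0 ?sqr_ge0// addr_ge0.
pose s := e / 2 / (4 * (Q + 1) * (b - a)).
have s0 : 0 < s by rewrite !divr_gt0// !mulr_gt0// ltr_wpDl.
have H1 := tube open_pos (ns_cont sv) t00 ltr01.
have /nbhs_ballP[d /= d0 Hd] : \forall t \near t0,
    V t /\ forall x, x \in `[a, b] -> `|v x t - v x t0| < 1.
  by apply: filterS2 Vt H1.
exists (Num.min d (s ^+ 2)); first by rewrite lt_min d0 exprn_gt0.
move=> t tpos; rewrite ltrBlDr -ltrBlDl lt_min => /andP[td ts] tt0.
have [Vt1 T1] : V t /\ forall x, x \in `[a, b] -> `|v x t - v x t0| < 1.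
  by apply: Hd; rewrite /ball/= ger0_norm// subr_ge0 ltW.
have ss : heat_scale t0 t <= s.
  by rewrite -(ler_pXn2r (n := 2))// ?nnegrE ?expR_ge0 ?(ltW s0)// heat_scale_sqr// ltW.
set S := heat_scale t0 t in ss *; have S0 : 0 < S by exact: expR_gt0.
have vx0 := v_ge0 x0ab' t00.
have [cvt _ _ _] := ns_slice sv tpos.
have Jt : [set r | 0 < r < t0] t by rewrite /= tpos.
have [cK _ _] := @C1_heat _ a b x0 _ _ Jt.
have cid := @cont_on_id R a b.
have c1 : cont_on `[a, b] (fun x => 1 + ((x - x0) / (2 * S)) ^+ 2) by solve_cont.
have hn (x : R) : `[a, b]%classic x -> 1 + ((x - x0) / (2 * S)) ^+ 2 != 0.
  by move=> _; rewrite gt_eqF// ltr_pwDl// sqr_ge0.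
have c2 := cont_onV hn c1.
have cA : cont_on `[a, b] (fun x => S^-1 * (1 + ((x - x0) / (2 * S)) ^+ 2)^-1).
  by solve_cont.
apply: (@le_trans _ _ (I (fun x => (v x0 t0 + n) *
    (S^-1 * (1 + ((x - x0) / (2 * S)) ^+ 2)^-1) + Q * (4 * s)))).
  apply: integral_on_le; [by solve_cont|by solve_cont|].
  move=> x /subset_itv_oo_cc xab'.
  have K0 : 0 <= heat_kernel x0 t0 x t by exact: expR_ge0.
  have vle : v x t <= (v x0 t0 + n) + Q * (x - x0) ^+ 2.
    have [xh|hx] := ltP `|x - x0| h.
      have := UV (x, t) (conj (Uh x xh) Vt1) xab' tpos.
      rewrite ltr_norml => /andP[/= h1 _].
      have : 0 <= Q * (x - x0) ^+ 2 by rewrite mulr_ge0 ?sqr_ge0.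
      lra.
    have : M + 1 <= Q * (x - x0) ^+ 2.
      rewrite /Q mulrAC ler_pdivlMr ?exprn_gt0// ler_wpM2l ?addr_ge0//.
      by rewrite -[leRHS]real_normK ?num_real// lerXn2r// nnegrE ltW.
    have := T1 x xab'; have := HM x xab'; rewrite ler_norml ltr_norml.
    move=> /andP[_ h2] /andP[_ h3]; lra.
  apply: le_trans (ler_wpM2l K0 vle) _; rewrite mulrDr; apply: lerD.
    rewrite mulrC ler_wpM2l ?heat_kernel_le_atan//.
    by rewrite addr_ge0// ltW.
  rewrite mulrCA ler_wpM2l//; apply: le_trans (heat_kernel_moment x0 x tt0) _.
  by rewrite ler_wpM2l.
rewrite integral_onD; [|by solve_cont..].
rewrite integral_onZ// integral_on_cst ?(ltW ab)//.
have A1 := integral_atan_le x0 S0.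
have A2 : Q * (4 * s) * (b - a) <= e / 2.
  have -> : Q * (4 * s) * (b - a) = e / 2 * (Q / (Q + 1)).
    by rewrite /s; field; rewrite !gt_eqF// ltr_wpDl.
  by rewrite ler_piMr ?divr_ge0 ?(ltW e0)// ler_pdivrMr ?mul1r ?lerDl// ltr_wpDl.
have A3 : (v x0 t0 + n) * I (fun x => S^-1 * (1 + ((x - x0) / (2 * S)) ^+ 2)^-1) <=
    (v x0 t0 + n) * (2 * pi) by rewrite ler_wpM2l// addr_ge0// ltW.
have A4 : n * (2 * pi) = e / 2 by rewrite /n divfK// gt_eqF.
apply: le_trans (lerD A3 A2) _; rewrite mulrDl A4; lra.
Qed.

(** The integral of K v does not decrease between t - 1, when K is bounded from
    below on [a, b], and the time t of the pole, where its limit is at most 2 pi v. *)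
Lemma supersolution_lower_bound : exists2 k, 0 < k & forall x t,
  x \in `]a, b[ -> 1 < t -> k * I (v^~ (t - 1)) <= v x t.
Proof.
have L0 : 0 < b - a by rewrite subr_gt0.
have p0 : 0 < 2 * pi :> R by rewrite mulr_gt0// pi_gt0.
pose k0 := expR (- ((b - a) ^+ 2 / 4) - 1) : R.
exists (k0 / (2 * pi)); first by rewrite divr_gt0// expR_gt0.
move=> x0 t0 x0ab t01; have t00 : 0 < t0 by rewrite (lt_trans _ t01).
rewrite mulrAC ler_pdivrMr// mulrC (mulrC (v x0 t0)).
apply/ler_addgt0Pr => e e0.
have [d d0 Hd] := heat_integral_limit x0ab t00 e0.
have s0 : 0 < t0 - 1 by rewrite subr_gt0.
pose t := t0 - Num.min d 1 / 2.
have m0 : 0 < Num.min d 1 by rewrite lt_min d0 ltr01.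
have m1 : Num.min d 1 <= 1 by rewrite ge_min lexx orbT.
have md : Num.min d 1 <= d by rewrite ge_min lexx.
have tpos : 0 < t by rewrite /t; lra.
apply: le_trans (Hd t tpos _ _); [|by rewrite /t; lra|by rewrite /t; lra].
apply: le_trans (heat_integral_nondecreasing x0ab s0 (t := t) _ _);
  [|by rewrite /t; lra|by rewrite /t; lra].
have [cv _ _ _] := ns_slice sv s0.
have Js : [set r | 0 < r < t0] (t0 - 1) by rewrite /= s0/= ltrBlDr ltrDl.
have [cK _ _] := @C1_heat _ a b x0 _ _ Js.
rewrite mulrC -integral_onZ//; apply: integral_on_le; [by solve_cont|by solve_cont|].
move=> x xab; have xab' := subset_itv_oo_cc xab; rewrite ler_wpM2r ?v_ge0//.
rewrite ler_expR /heat_exponent; have -> : t0 - (t0 - 1) = 1 by ring.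
rewrite ln1 mulr0 oppr0 sub0r invr1 mulr1 lerD2r lerN2 ler_wpM2r ?invr_ge0//.
move: xab x0ab; rewrite !in_itv/= => /andP[ax xb] /andP[ax0 x0b].
rewrite -[leLHS]real_normK ?num_real// lerXn2r ?nnegrE ?(ltW L0)//.
by rewrite ler_norml; lra.
Qed.

End PointwiseLowerBound.

(** * Quadratic interpolation inequalities *)
Section Inequalities.
Context {R : realType} {a b : R} (ab : a < b).
Implicit Types f g : R -> R.
Local Notation I := (integral_on a b).
Local Notation cont := (cont_on `[a, b]).

Lemma integral_on_gt0 f : cont f -> (forall x, x \in `[a, b] -> 0 < f x) -> 0 < I f.
Proof.
move=> cf f0; have [x xab fx] := ex_mean_ge ab cf.
by apply: lt_le_trans fx; rewrite mulr_gt0 ?f0// subr_gt0.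
Qed.

Lemma young_integral f g d : 0 < d -> cont f -> cont g ->
  2 * I (fun x => `|f x * g x|) <= d * I (fun x => f x ^+ 2) + d^-1 * I (fun x => g x ^+ 2).
Proof.
move=> d0 cf cg; rewrite -!integral_onZ -?integral_onD; [|by solve_cont..].
apply: integral_on_le; [by solve_cont..|] => x _.
rewrite normrM -(real_normK (num_real (f x))) -(real_normK (num_real (g x))).
set p := `|f x|; set q := `|g x|; rewrite -subr_ge0.
have -> : d * p ^+ 2 + d^-1 * q ^+ 2 - 2 * (p * q) = d * (p - d^-1 * q) ^+ 2.
  by field; rewrite gt_eqF.
by rewrite mulr_ge0 ?sqr_ge0// ltW.
Qed.

Lemma cauchy_schwarz_norm f g : cont f -> cont g ->
  I (fun x => `|f x * g x|) ^+ 2 <= I (fun x => f x ^+ 2) * I (fun x => g x ^+ 2).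
Proof.
move=> cf cg; have H h : I (fun x => h x ^+ 2) = I (fun x => `|h x| ^+ 2).
  by apply: eq_integral_on => x _; rewrite real_normK ?num_real.
rewrite (H f) (H g) (@eq_integral_on _ _ _ _ (fun x => `|f x| * `|g x|)); last first.
  by move=> x _; rewrite normrM.
by apply: cauchy_schwarz => //; solve_cont.
Qed.

Lemma sqr_integral_norm_le f : cont f ->
  I (fun x => `|f x|) ^+ 2 <= (b - a) * I (fun x => f x ^+ 2).
Proof.
move=> cf; have c1 : cont (fun _ : R => 1 : R) by exact: cont_on_cst.
have := cauchy_schwarz_norm cf c1.
rewrite (@eq_integral_on _ _ _ _ (fun x => `|f x|)); last by move=> x _; rewrite mulr1.
rewrite (@eq_integral_on _ _ _ (fun=> 1 ^+ 2) (fun=> 1)); last by move=> x _; rewrite expr1n.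
by rewrite integral_on_cst ?(ltW ab)// mul1r mulrC.
Qed.

Lemma integral_2norm f g : cont f -> cont g ->
  I (fun x => `|2 * f x * g x|) = 2 * I (fun x => `|f x * g x|).
Proof.
move=> cf cg; rewrite -integral_onZ; last by solve_cont.
by apply: eq_integral_on => x _; rewrite -mulrA normrM ger0_norm.
Qed.

Lemma sup_sqr_le f f' : C1_on a b f f' -> forall x, x \in `[a, b] ->
  f x ^+ 2 <= I (fun x => f x ^+ 2) / (b - a) + 2 * I (fun x => `|f x * f' x|).
Proof.
move=> df x xab; have [cf cf' _] := df.
by have := sup_le_mean ab (C1_on_sqr df) xab; rewrite integral_2norm.
Qed.

Lemma sup_sqr_le_root f f' : C1_on a b f f' -> f a = 0 -> forall x, x \in `[a, b] ->
  f x ^+ 2 <= 2 * I (fun x => `|f x * f' x|).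
Proof.
move=> df fa0 x xab; have [cf cf' _] := df.
have aab : a \in `[a, b] by rewrite bound_itvE ltW.
have := osc_le (C1_on_sqr df) aab xab; rewrite integral_2norm//.
by rewrite fa0 expr0n/= subr0 ger0_norm ?sqr_ge0.
Qed.

Lemma sup_sqr_le_energy f f' : C1_on a b f f' -> (forall x, x \in `[a, b] -> 0 <= f x) ->
  forall x, x \in `[a, b] ->
  f x ^+ 2 <= 2 * (I f / (b - a)) ^+ 2 + 2 * (b - a) * I (fun x => f' x ^+ 2).
Proof.
move=> df f0 x xab; have [cf cf' _] := df.
have h1 := sup_le_mean ab df xab; have h2 := sqr_integral_norm_le cf'.
have fx0 := f0 x xab; set m := I f / (b - a) in h1 *.
set n := I (fun z => `|f' z|) in h1 h2.
apply: (@le_trans _ _ ((m + n) ^+ 2)).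
  by rewrite lerXn2r// nnegrE// (le_trans fx0).
have : 0 <= (m - n) ^+ 2 by exact: sqr_ge0.
rewrite !expr2 in h2 *; lra.
Qed.

End Inequalities.

(** * Solutions with continuous sources *)
Section RegularSolution.
Context {R : realType} {a b : R} (ab : a < b).
Implicit Types (x t : R).
Local Notation I := (integral_on a b).
Local Notation cont := (cont_on `[a, b]).
Local Notation L := (b - a).

(** The system with the flux differentiated: the bracket after chi is the
    derivative in x of u v_x / v. *)
Record regular_solution chi B (B1 B2 u ux uxx ut v vx vxx vt : R -> R -> R) : Prop :=
  IsRegularSolution {
  rs_u : neumann_smooth a b u ux uxx ut;
  rs_v : neumann_smooth a b v vx vxx vt;
  rs_upos : forall x t, x \in `[a, b] -> 0 < t -> 0 < u x t;
  rs_vpos : forall x t, x \in `[a, b] -> 0 < t -> 0 < v x t;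
  rs_cB1 : forall t, 0 < t -> cont (B1^~ t);
  rs_cB2 : forall t, 0 < t -> cont (B2^~ t);
  rs_B1 : forall x t, x \in `]a, b[ -> 0 < t -> 0 <= B1 x t <= B;
  rs_B2 : forall x t, x \in `]a, b[ -> 0 < t -> 0 <= B2 x t <= B;
  rs_ueq : forall x t, x \in `]a, b[ -> 0 < t -> ut x t = uxx x t
    - chi * (ux x t * vx x t * (v x t)^-1 + u x t * vxx x t * (v x t)^-1
             - u x t * vx x t ^+ 2 * (v x t)^-1 ^+ 2)
    - u x t * v x t + B1 x t;
  rs_veq : forall x t, x \in `]a, b[ -> 0 < t ->
    vt x t = vxx x t + u x t * v x t - v x t + B2 x t }.

Context (chi B : R) (B1 B2 u ux uxx ut v vx vxx vt : R -> R -> R).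
Context (S : regular_solution chi B B1 B2 u ux uxx ut v vx vxx vt).

Definition mass w t : R := I (w^~ t).

Lemma slices_inv t : 0 < t -> [/\ cont (fun x => (u x t)^-1),
  cont (fun x => (v x t)^-1) & cont (fun x => ln (u x t))].
Proof.
move=> t0; have [cu _ _ _] := ns_slice (rs_u S) t0.
have [cv _ _ _] := ns_slice (rs_v S) t0.
split.
- by apply: cont_onV => // x xab; rewrite gt_eqF// (rs_upos S).
- by apply: cont_onV => // x xab; rewrite gt_eqF// (rs_vpos S).
- by apply: cont_on_ln => // x xab; exact: (rs_upos S).
Qed.

Lemma bound_ge0 : 0 <= B.
Proof.
have mab : (a + b) / 2 \in `]a, b[ by rewrite in_itv/= !midf_lt.
by have /andP[h1 h2] := rs_B1 S mab ltr01; exact: le_trans h2.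
Qed.

Lemma derive_mass w wx wxx wt t : neumann_smooth a b w wx wxx wt -> 0 < t ->
  is_derive t 1 (mass w) (I (wt^~ t)).
Proof.
move=> sw t0; apply: (derive_integral open_pos ab) => //.
- by move=> s s0; have [] := ns_slice sw s0.
- exact: (ns_dert sw).
- exact: (ns_contt sw).
Qed.

Lemma integral_dxx w wx wxx wt t : neumann_smooth a b w wx wxx wt -> 0 < t ->
  I (wxx^~ t) = 0.
Proof.
move=> sw t0; rewrite (FTC ab (ns_C1x sw t0)).
by have [-> ->] := ns_bdry sw t0; rewrite subrr.
Qed.

Lemma C1_flux t : 0 < t ->
  C1_on a b (fun x => u x t * vx x t * (v x t)^-1)
   (fun x => ux x t * vx x t * (v x t)^-1 + u x t * vxx x t * (v x t)^-1
             - u x t * vx x t ^+ 2 * (v x t)^-1 ^+ 2).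
Proof.
move=> t0; have [cu cux cuxx cut] := ns_slice (rs_u S) t0.
have [cv cvx cvxx cvt] := ns_slice (rs_v S) t0.
have [cui cvi clu] := slices_inv t0.
split; [by solve_cont|by solve_cont|] => x xab.
have xab' := subset_itv_oo_cc xab.
have v0 : v x t != 0 by rewrite gt_eqF// (rs_vpos S).
have := derM (derM (ns_derx (rs_u S) xab t0) (ns_derxx (rs_v S) xab t0))
  (derV v0 (ns_derx (rs_v S) xab t0)).
by congr is_derive; field.
Qed.

(** The flux u v_x / v vanishes on the boundary because v_x does. *)
Lemma integral_flux t g g' : 0 < t -> C1_on a b g g' ->
  I (fun x => (ux x t * vx x t * (v x t)^-1 + u x t * vxx x t * (v x t)^-1
     - u x t * vx x t ^+ 2 * (v x t)^-1 ^+ 2) * g x) =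
  - I (fun x => u x t * vx x t * (v x t)^-1 * g' x).
Proof.
move=> t0 dg; rewrite (integration_by_parts_on ab (C1_flux t0) dg).
have [va vb] := ns_bdry (rs_v S) t0.
by rewrite va vb !mulr0 !mul0r subrr sub0r.
Qed.

Lemma mass_v_derivative t : 0 < t ->
  I (vt^~ t) = I (fun x => u x t * v x t) - mass v t + I (B2^~ t).
Proof.
move=> t0; have [cu cux cuxx cut] := ns_slice (rs_u S) t0.
have [cv cvx cvxx cvt] := ns_slice (rs_v S) t0; have cB := rs_cB2 S t0.
rewrite -[RHS]add0r -(integral_dxx (rs_v S) t0) /mass.
rewrite -integral_onB -?integral_onD; [|by solve_cont..].
by apply: eq_integral_oo => // [|x xab]; [by solve_cont|rewrite (rs_veq S)//; ring].
Qed.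

Lemma mass_u_derivative t : 0 < t ->
  I (ut^~ t) = - I (fun x => u x t * v x t) + I (B1^~ t).
Proof.
move=> t0; have [cu cux cuxx cut] := ns_slice (rs_u S) t0.
have [cv cvx cvxx cvt] := ns_slice (rs_v S) t0; have cB := rs_cB1 S t0.
have [cui cvi clu] := slices_inv t0.
have C1one : C1_on a b (fun=> 1) (fun=> 0).
  by split; [exact: cont_on_cst|exact: cont_on_cst|move=> x _; exact: is_derive_cst].
have E := integral_flux t0 C1one.
transitivity (I (uxx^~ t) - chi * I (fun x => (ux x t * vx x t * (v x t)^-1
    + u x t * vxx x t * (v x t)^-1 - u x t * vx x t ^+ 2 * (v x t)^-1 ^+ 2) * 1)
    - I (fun x => u x t * v x t) + I (B1^~ t)).
  rewrite -integral_onZ -?integral_onB -?integral_onD; [|by solve_cont..].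
  apply: eq_integral_oo => // [|x xab]; [by solve_cont|rewrite (rs_ueq S)//; ring].
rewrite E (integral_dxx (rs_u S) t0).
rewrite (@eq_integral_on _ _ _ (fun x => u x t * vx x t * (v x t)^-1 * 0) (fun=> 0)).
  by rewrite integral_on_cst ?ltW//; ring.
by move=> x _; rewrite mulr0.
Qed.

End RegularSolution.

Arguments regular_solution {R} a b chi B B1 B2 u ux uxx ut v vx vxx vt.
Arguments mass {R} a b w t.

(** * Bounds of the masses *)
Section MassBounds.
Context {R : realType} {a b : R} (ab : a < b).
Implicit Types (x t : R).
Local Notation I := (integral_on a b).
Local Notation cont := (cont_on `[a, b]).
Local Notation L := (b - a).
Context (chi B : R) (B1 B2 u ux uxx ut v vx vxx vt : R -> R -> R).
Context (S : regular_solution a b chi B B1 B2 u ux uxx ut v vx vxx vt).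

Let L0 : 0 < L. Proof. by rewrite subr_gt0. Qed.

Lemma mass_v_lower beta : 0 < beta -> (forall t, 0 < t -> beta <= I (B2^~ t)) ->
  exists2 m, 0 < m & forall t, 1 <= t -> m <= mass a b v t.
Proof.
move=> beta0 Hbeta.
have pos t : 0 < t -> 0 < mass a b v t.
  move=> t0; have [cv _ _ _] := ns_slice (rs_v S) t0.
  by apply: integral_on_gt0 => // x xab; exact: (rs_vpos S).
have [m1 m10 Hm1] : exists2 m1, 0 < m1 & m1 <= mass a b v 1.
  by exists (mass a b v 1) => //; exact: pos.
exists (Num.min m1 beta) => [|t t1]; first by rewrite lt_min m10.
have : - mass a b v t <=
    Num.max (- mass a b v 1) (- beta / 1).
  apply: (@gronwall R (fun t => - mass a b v t)
    (fun t => - I (vt^~ t)) (- beta) 1 1) => // s s1.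
    by apply: derN; apply: (derive_mass ab (rs_v S)); exact: lt_le_trans s1.
  have s0 : 0 < s by exact: lt_le_trans s1.
  rewrite (mass_v_derivative ab S s0).
  have h1 := Hbeta s s0.
  have h2 : 0 <= I (fun x => u x s * v x s).
    by apply: integral_on_ge0 => x xab; rewrite mulr_ge0// ltW// ?(rs_upos S)// (rs_vpos S).
  lra.
rewrite le_max divr1 !lerN2 ge_min => /orP[h|->]; last by rewrite orbT.
by rewrite (le_trans Hm1 h).
Qed.

(** The terms u v and B2 are nonnegative, so v is a supersolution whose mass one
    unit of time earlier is bounded from below. *)
Lemma v_lower beta : 0 < beta -> (forall t, 0 < t -> beta <= I (B2^~ t)) ->
  exists2 c, 0 < c & forall x t, x \in `]a, b[ -> 2 <= t -> c <= v x t.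
Proof.
move=> beta0 Hbeta; have [m m0 Hm] := mass_v_lower beta0 Hbeta.
have [|x t xab t0|k k0 Hk] := supersolution_lower_bound ab (rs_v S).
- by move=> x t xab t0; rewrite ltW// (rs_vpos S).
- rewrite (rs_veq S)//; have /andP[h _] := rs_B2 S xab t0.
  have : 0 <= u x t * v x t.
    have xab' := subset_itv_oo_cc xab.
    by rewrite mulr_ge0// ltW// ?(rs_upos S)// (rs_vpos S).
  lra.
exists (k * m) => [|x t xab t2]; first exact: mulr_gt0.
apply: le_trans (Hk x t xab _); last by lra.
by rewrite ler_wpM2l ?(ltW k0)//; apply: Hm; lra.
Qed.

(** In the derivative of 2 int u + int v the exchange term int u v keeps the
    coefficient -1, and int u v >= c int u makes it a damping of int u. *)
Lemma mass_upper c : 0 < c -> (forall x t, x \in `]a, b[ -> 2 <= t -> c <= v x t) ->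
  exists2 M, 0 < M & forall t, 2 <= t -> mass a b u t <= M /\
    mass a b v t <= M.
Proof.
move=> c0 Hc; pose e := Num.min (c / 2) 1.
have e0 : 0 < e by rewrite lt_min divr_gt0 ?ltr01.
have ec : e <= c / 2 by rewrite ge_min lexx.
have e1 : e <= 1 by rewrite ge_min lexx orbT.
have BL := mulr_ge0 (bound_ge0 ab S) (ltW L0).
have pos (w : R -> R -> R) t : (forall x, x \in `[a, b] -> 0 < w x t) -> 0 <= mass a b w t.
  by move=> w0; apply: integral_on_ge0 => x xab; rewrite ltW// w0.
have pu t : 0 < t -> 0 <= mass a b u t.
  by move=> t0; apply: pos => x xab; exact: (rs_upos S).
have pv t : 0 < t -> 0 <= mass a b v t.
  by move=> t0; apply: pos => x xab; exact: (rs_vpos S).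
pose F t := 2 * mass a b u t + mass a b v t.
have H t : 2 <= t -> F t <= Num.max (F 2) (3 * (B * L) / e).
  apply: (@gronwall R F (fun t => 2 * I (ut^~ t) + I (vt^~ t))) => // s s2.
    have s0 : 0 < s by lra.
    by apply: derD; [apply: derZ; exact: (derive_mass ab (rs_u S))|
      exact: (derive_mass ab (rs_v S))].
  have s0 : 0 < s by lra.
  rewrite (mass_v_derivative ab S s0) (mass_u_derivative ab S s0).
  have [cu _ _ _] := ns_slice (rs_u S) s0; have [cv _ _ _] := ns_slice (rs_v S) s0.
  have cB1 := rs_cB1 S s0; have cB2 := rs_cB2 S s0.
  have cst : cont (fun _ : R => B) by exact: cont_on_cst.
  have h1 : I (B1^~ s) <= B * L.
    rewrite -integral_on_cst ?(ltW ab)//; apply: integral_on_le => // x xab.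
    by have /andP[] := rs_B1 S xab s0.
  have h2 : I (B2^~ s) <= B * L.
    rewrite -integral_on_cst ?(ltW ab)//; apply: integral_on_le => // x xab.
    by have /andP[] := rs_B2 S xab s0.
  have h3 : c * mass a b u s <= I (fun x => u x s * v x s).
    rewrite -integral_onZ//; apply: integral_on_le; [by solve_cont..|] => x xab.
    have xab' := subset_itv_oo_cc xab.
    by rewrite mulrC ler_wpM2l ?(ltW (rs_upos S xab' s0))// Hc.
  have h4 : e * mass a b u s <= c / 2 * mass a b u s.
    by rewrite ler_wpM2r// pu.
  have h5 : e * mass a b v s <= 1 * mass a b v s.
    by rewrite ler_wpM2r// pv.
  rewrite /F; lra.
exists (Num.max (F 2) (3 * (B * L) / e) + 1).
  rewrite ltr_pwDr// le_max; apply/orP; right; apply: divr_ge0; last exact: ltW.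
  exact: mulr_ge0.
move=> t t2; have := H t t2; set K := Num.max _ _ => Ht; have t0 : 0 < t by lra.
have := pu t t0; have := pv t t0; rewrite /F in Ht; split; lra.
Qed.

End MassBounds.

(** * Interpolation of the solution between masses and dissipation *)
Section Energy.
Context {R : realType} {a b : R} (ab : a < b).
Implicit Types (x t : R).
Local Notation I := (integral_on a b).
Local Notation cont := (cont_on `[a, b]).
Local Notation L := (b - a).
Context (chi B : R) (B1 B2 u ux uxx ut v vx vxx vt : R -> R -> R).
Context (S : regular_solution a b chi B B1 B2 u ux uxx ut v vx vxx vt).
Context (c M : R) (c0 : 0 < c) (M0 : 0 < M).
Context (Hc : forall x t, x \in `]a, b[ -> 2 <= t -> c <= v x t).
Context (HM : forall t, 2 <= t -> mass a b u t <= M /\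
    mass a b v t <= M).

Let L0 : 0 < L. Proof. by rewrite subr_gt0. Qed.

(** The Fisher information of u. *)
Definition fisher t : R := I (fun x => ux x t ^+ 2 * (u x t)^-1).
Definition dirichlet t : R := I (fun x => vx x t ^+ 2).
Definition hessian t : R := I (fun x => vxx x t ^+ 2).

Lemma dirichlet_ge0 t : 0 <= dirichlet t.
Proof. by apply: integral_on_ge0 => x _; exact: sqr_ge0. Qed.

Lemma hessian_ge0 t : 0 <= hessian t.
Proof. by apply: integral_on_ge0 => x _; exact: sqr_ge0. Qed.

Lemma fisher_ge0 t : 0 < t -> 0 <= fisher t.
Proof.
move=> t0; apply: integral_on_ge0 => x xab.
by rewrite mulr_ge0 ?sqr_ge0// invr_ge0 ltW// (rs_upos S).
Qed.

Lemma dirichletE t : 0 < t -> dirichlet t = - I (fun x => v x t * vxx x t).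
Proof.
move=> t0; have := integration_by_parts_on ab (ns_C1 (rs_v S) t0) (ns_C1x (rs_v S) t0).
have [-> ->] := ns_bdry (rs_v S) t0; rewrite !mulr0 subrr sub0r => <-.
by apply: eq_integral_on => x _; rewrite expr2.
Qed.

Lemma integral_sqr_le w t V : 0 < t -> cont (w^~ t) ->
  (forall x, x \in `[a, b] -> 0 < w x t) -> (forall x, x \in `[a, b] -> w x t <= V) ->
  I (fun x => w x t ^+ 2) <= V * mass a b w t.
Proof.
move=> t0 cw w0 wV; rewrite -integral_onZ//; apply: integral_on_le; [by solve_cont..|].
move=> x /subset_itv_oo_cc xab; rewrite expr2 ler_wpM2r ?wV// ltW// w0//.
Qed.

(** Here int v_x^2 = - int v v_xx and int v^2 <= V M. *)
Lemma dirichlet_le t V d : 2 <= t -> 0 < d -> (forall x, x \in `[a, b] -> v x t <= V) ->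
  dirichlet t <= d * hessian t + V * M / d.
Proof.
move=> t2 d0 HV; have t0 : 0 < t by lra.
have [cv cvx cvxx _] := ns_slice (rs_v S) t0.
have := young_integral d0 cvxx cv; have := integral_sqr_le t0 cv (fun x h => rs_vpos S h t0) HV.
have [_ Mv] := HM t2; rewrite -/(hessian t).
have V0 : 0 <= V.
  apply: le_trans (HV a _); rewrite ?bound_itvE ?ltW//.
  by rewrite (rs_vpos S)// bound_itvE ltW.
have h1 : dirichlet t <= I (fun x => `|vxx x t * v x t|).
  rewrite dirichletE// -integral_onN; last by solve_cont.
  apply: integral_on_le; [by solve_cont..|] => x _; rewrite mulrC -normrN; exact: ler_norm.
have h2 : V * mass a b v t <= V * M by rewrite ler_wpM2l.
move=> h3 h4; have h5 : d^-1 * I (fun x => v x t ^+ 2) <= V * M / d.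
  by rewrite (mulrC _ d^-1) ler_wpM2l ?invr_ge0 ?(ltW d0)//; exact: le_trans h2.
have := dirichlet_ge0 t; have := hessian_ge0 t; lra.
Qed.

(** The Gagliardo-Nirenberg inequality that bounds sup v by the 2/5-th power of the
    norm of v_xx in L^2, given the mass. The exponent five leaves room to absorb V^4
    into the hessian term. *)
Lemma v_fifth_power : exists2 C, 0 <= C & forall t, 2 <= t -> exists V,
  [/\ 0 <= V, (forall x, x \in `[a, b] -> v x t <= V) & V ^+ 5 <= C * (1 + hessian t)].
Proof.
have M2L : 0 <= 2 * M / L by rewrite divr_ge0 ?(ltW L0)// mulr_ge0// ltW.
have E1 : 0 <= (2 * M / L) ^+ 5 by exact: exprn_ge0.
have E2 : 0 <= 16 ^+ 2 * M ^+ 3 by rewrite mulr_ge0 ?sqr_ge0// exprn_ge0// ltW.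
exists ((2 * M / L) ^+ 5 + 16 ^+ 2 * M ^+ 3); first exact: addr_ge0.
move=> t t2; have t0 : 0 < t by lra.
have [cv cvx cvxx _] := ns_slice (rs_v S) t0.
have [xm xmab Hxm] := EVT_max (ltW ab) cv.
set V := v xm t in Hxm; have V0 : 0 < V by exact: (rs_vpos S).
exists V; split; [exact: ltW|exact: Hxm|].
have D0 := hessian_ge0 t; have X0 := dirichlet_ge0 t.
have [Vs|Vl] := leP V (2 * M / L).
  have : V ^+ 5 <= (2 * M / L) ^+ 5 by rewrite lerXn2r// nnegrE ltW.
  have := mulr_ge0 E1 D0; have := mulr_ge0 E2 D0; lra.
have [_ Mv] := HM t2.
have hI := integral_sqr_le t0 cv (fun x h => rs_vpos S h t0) Hxm.
have hI2 : I (fun x => v x t ^+ 2) <= V * M by rewrite (le_trans hI)// ler_wpM2l ?(ltW V0).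
have := sup_sqr_le ab (ns_C1 (rs_v S) t0) xmab; rewrite -/V.
have := cauchy_schwarz_norm cv cvx; rewrite -/(dirichlet t).
set Y := I (fun x => `|v x t * vx x t|) => hY hV.
have Y0 : 0 <= Y by apply: integral_on_ge0.
have hX : dirichlet t ^+ 2 <= V * M * hessian t.
  rewrite dirichletE// sqrrN.
  apply: le_trans (cauchy_schwarz cv cvxx) _.
  by rewrite -/(hessian t) ler_wpM2r.
have hh1 : I (fun x => v x t ^+ 2) / L <= V ^+ 2 / 2.
  rewrite ler_pdivrMr//; apply: le_trans hI2 _.
  move: Vl; rewrite ltr_pdivrMr// => Vl; rewrite expr2.
  have : 0 < V * (V * L - 2 * M) by rewrite mulr_gt0// subr_gt0.
  lra.
have hh2 : V ^+ 2 <= 4 * Y by lra.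
have hh3 : V ^+ 4 <= 16 * (V * M * dirichlet t).
  have -> : V ^+ 4 = (V ^+ 2) ^+ 2 by rewrite -exprM.
  apply: (@le_trans _ _ ((4 * Y) ^+ 2)).
    by rewrite lerXn2r// ?nnegrE ?sqr_ge0// mulr_ge0.
  have -> : (4 * Y) ^+ 2 = 16 * Y ^+ 2 by ring.
  rewrite ler_wpM2l//; apply: le_trans hY _.
  by rewrite ler_wpM2r.
have hh4 : V ^+ 3 <= 16 * M * dirichlet t.
  rewrite -(ler_pM2l V0); apply: le_trans (le_trans hh3 _); rewrite ?exprS ?expr0 ?mulr1//.
  by rewrite le_eqVlt; apply/orP; left; apply/eqP; ring.
have hh5 : V ^+ 6 <= 16 ^+ 2 * M ^+ 2 * (V * M * hessian t).
  have -> : V ^+ 6 = (V ^+ 3) ^+ 2 by rewrite -exprM.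
  apply: (@le_trans _ _ ((16 * M * dirichlet t) ^+ 2)).
    by rewrite lerXn2r// ?nnegrE ?exprn_ge0 ?(ltW V0)// !mulr_ge0// ltW.
  have -> : (16 * M * dirichlet t) ^+ 2 = 16 ^+ 2 * M ^+ 2 * dirichlet t ^+ 2 by ring.
  by apply: ler_wpM2l hX; rewrite mulr_ge0 ?sqr_ge0.
have : V ^+ 5 <= 16 ^+ 2 * M ^+ 3 * hessian t.
  rewrite -(ler_pM2l V0); apply: le_trans (le_trans hh5 _); rewrite ?exprS ?expr0 ?mulr1//.
  by rewrite le_eqVlt; apply/orP; left; apply/eqP; ring.
have := mulr_ge0 E1 D0; lra.
Qed.

(** As v_x vanishes at a, its square is at most 2 int |v_x v_xx|; Young's inequality
    is used with weight 1 / d, then dirichlet_le with weight d^2. *)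
Lemma vx_sup t V d : 2 <= t -> 0 < d -> (forall x, x \in `[a, b] -> v x t <= V) ->
  forall x, x \in `[a, b] ->
  vx x t ^+ 2 <= 2 * d * hessian t + V * M / (2 * d ^+ 3) * 2.
Proof.
move=> t2 d0 HV x xab; have t0 : 0 < t by lra.
have [cv cvx cvxx _] := ns_slice (rs_v S) t0.
have [vxa _] := ns_bdry (rs_v S) t0.
have h1 := sup_sqr_le_root ab (ns_C1x (rs_v S) t0) vxa xab.
have dV0 : 0 < d^-1 by rewrite invr_gt0.
have := young_integral dV0 cvx cvxx; rewrite invrK -/(hessian t) -/(dirichlet t) => h2.
have d20 : 0 < d ^+ 2 by rewrite exprn_gt0.
have h3 := dirichlet_le t2 d20 HV.
have h4 : d^-1 * dirichlet t <= d^-1 * (d ^+ 2 * hessian t + V * M / d ^+ 2).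
  by rewrite ler_wpM2l// ltW.
have E : d^-1 * (d ^+ 2 * hessian t + V * M / d ^+ 2) =
   d * hessian t + V * M / (2 * d ^+ 3) * 2 by field; rewrite gt_eqF.
by rewrite {}E in h4; lra.
Qed.

(** From |u_x| <= (l / 2) u_x^2 / u + u / (2 l). *)
Lemma u_sup t l : 2 <= t -> 0 < l -> forall x, x \in `[a, b] ->
  u x t <= M / L + l / 2 * fisher t + M / (2 * l).
Proof.
move=> t2 l0 x xab; have t0 : 0 < t by lra.
have [cu cux cuxx _] := ns_slice (rs_u S) t0.
have [cui _ _] := slices_inv S t0; have [Mu _] := HM t2.
have h1 := sup_le_mean ab (ns_C1 (rs_u S) t0) xab.
have h2 : I (u^~ t) / L <= M / L by rewrite ler_wpM2r// invr_ge0 ltW.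
have h3 : I (fun x => `|ux x t|) <= l / 2 * fisher t + (2 * l)^-1 * mass a b u t.
  rewrite -!integral_onZ -?integral_onD; [|by solve_cont..].
  apply: integral_on_le; [by solve_cont..|] => y /subset_itv_oo_cc yab.
  have uy := rs_upos S yab t0; rewrite -(real_normK (num_real (ux y t))).
  set p := `|ux y t|; rewrite -subr_ge0.
  have -> : l / 2 * (p ^+ 2 * (u y t)^-1) + (2 * l)^-1 * u y t - p =
    (l * p - u y t) ^+ 2 * (2 * l * u y t)^-1 by field; rewrite !gt_eqF.
  by rewrite mulr_ge0 ?sqr_ge0// invr_ge0 ltW// !mulr_gt0.
have h4 : (2 * l)^-1 * mass a b u t <= M / (2 * l).
  by rewrite mulrC ler_wpM2r// invr_ge0 ltW// mulr_gt0.
lra.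
Qed.

End Energy.

Arguments fisher {R} a b u ux t.
Arguments dirichlet {R} a b vx t.
Arguments hessian {R} a b vxx t.

(** * The energy inequality *)
Section EnergyInequality.
Context {R : realType} {a b : R} (ab : a < b).
Implicit Types (x t : R).
Local Notation I := (integral_on a b).
Local Notation cont := (cont_on `[a, b]).
Local Notation L := (b - a).

Lemma ln_le_sub1 (y : R) : 0 < y -> ln y <= y - 1.
Proof.
move=> y0; have := @le_ln1Dx R (y - 1).
have -> : 1 + (y - 1) = y by ring.
by apply; lra.
Qed.

Lemma xlnx_ge (y : R) : 0 < y -> y - 1 <= y * ln y.
Proof.
move=> y0; have yV : 0 < y^-1 by rewrite invr_gt0.
have := ln_le_sub1 yV; rewrite lnV ?posrE// => h.
have : y * (1 - y^-1) <= y * ln y by rewrite ler_wpM2l ?(ltW y0)//; lra.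
by rewrite mulrBr mulr1 divff// gt_eqF.
Qed.

(** Young's inequality between V^4 and V^5. *)
Lemma absorb_fifth_power (K C5 : R) : 0 <= K -> 0 <= C5 -> exists C, forall V D,
  0 <= V -> 0 <= D -> V ^+ 5 <= C5 * (1 + D) -> K * (1 + V ^+ 4) <= C + D / 4.
Proof.
move=> K0 C50; pose n := 4 * (K * C5 + 1).
have KC : 0 <= K * C5 by exact: mulr_ge0.
have n0 : 0 < n by rewrite /n; lra.
exists (K + K * n ^+ 4 + 1) => V D V0 D0 HV.
have Kn : 0 <= K * n ^+ 4 by rewrite mulr_ge0// exprn_ge0// ltW.
have [Vn|nV] := leP V n.
  have : K * V ^+ 4 <= K * n ^+ 4.
    apply: ler_wpM2l => //; apply: lerXn2r; rewrite ?nnegrE//; exact: ltW.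
  lra.
have h1 : n * V ^+ 4 <= C5 * (1 + D).
  by apply: le_trans HV; rewrite [leRHS]exprS; apply: ler_wpM2r; [exact: exprn_ge0|exact: ltW].
have h2 : K * (n * V ^+ 4) <= K * (C5 * (1 + D)) by rewrite ler_wpM2l.
have h3 : K * C5 * (1 + D) <= n / 4 * (1 + D) by rewrite ler_wpM2r//; rewrite /n; lra.
have h4 : n * (K * V ^+ 4) <= n * ((1 + D) / 4) by lra.
by move: h4; rewrite ler_pM2l//; lra.
Qed.

Context (chi B : R) (B1 B2 u ux uxx ut v vx vxx vt : R -> R -> R).
Context (S : regular_solution a b chi B B1 B2 u ux uxx ut v vx vxx vt).

Definition entropy t : R := I (fun x => u x t * ln (u x t)).

Lemma derive_entropy t : 0 < t ->
  is_derive t 1 entropy (I (fun x => ut x t * (ln (u x t) + 1))).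
Proof.
move=> t0; apply: (@derive_integral _ _ _ _ open_pos (fun x s => u x s * ln (u x s))
  (fun x s => ut x s * (ln (u x s) + 1)) t ab) => //.
- move=> s s0; have [cu _ _ _] := ns_slice (rs_u S) s0.
  by have [_ _ clu] := slices_inv S s0; solve_cont.
- move=> x s xab s0; have u0 := rs_upos S xab s0.
  have du := ns_dert (rs_u S) xab s0.
  have := derM du (der_ln u0 du); congr is_derive.
  by rewrite mulrDr mulr1; congr (_ + _); field; rewrite gt_eqF.
- set D := `[a, b]%classic `*` [set s | 0 < s].
  have cu : cont_on D (fun z : R * R => u z.1 z.2) := ns_cont (rs_u S).
  have cut : cont_on D (fun z : R * R => ut z.1 z.2) := ns_contt (rs_u S).
  have clu : cont_on D (fun z : R * R => ln (u z.1 z.2)).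
    by apply: cont_on_ln => // z [zab z0]; exact: (rs_upos S).
  suff : cont_on D (fun z : R * R => ut z.1 z.2 * (ln (u z.1 z.2) + 1)) by [].
  by solve_cont.
Qed.

(** Integration by parts moves one derivative from u_xx and from the flux to
    ln u + 1. *)
Lemma entropy_production t : 0 < t -> I (fun x => ut x t * (ln (u x t) + 1)) =
  I (fun x => - (ux x t ^+ 2 * (u x t)^-1)
     + chi * (u x t * vx x t * (v x t)^-1 * (ux x t * (u x t)^-1))
     + (- (u x t * v x t) + B1 x t) * (ln (u x t) + 1)).
Proof.
move=> t0; have [cu cux cuxx cut] := ns_slice (rs_u S) t0.
have [cv cvx cvxx cvt] := ns_slice (rs_v S) t0.
have [cui cvi clu] := slices_inv S t0; have cB := rs_cB1 S t0.
have dg : C1_on a b (fun x => ln (u x t) + 1) (fun x => ux x t * (u x t)^-1).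
  split; [by solve_cont..|] => x xab.
  have := derD (der_ln (f := u^~ t)
    (rs_upos S (subset_itv_oo_cc xab) t0) (ns_derx (rs_u S) xab t0))
    (is_derive_cst (1 : R) x (1 : R)).
  by rewrite addr0.
have E1 := integration_by_parts_on ab (ns_C1x (rs_u S) t0) dg.
have [ua ub] := ns_bdry (rs_u S) t0; rewrite ua ub !mul0r subrr sub0r in E1.
have E2 := integral_flux ab S t0 dg.
transitivity (I (fun x => uxx x t * (ln (u x t) + 1))
  - chi * I (fun x => (ux x t * vx x t * (v x t)^-1 + u x t * vxx x t * (v x t)^-1
     - u x t * vx x t ^+ 2 * (v x t)^-1 ^+ 2) * (ln (u x t) + 1))
  + I (fun x => (- (u x t * v x t) + B1 x t) * (ln (u x t) + 1))).
  rewrite -integral_onZ -?integral_onB -?integral_onD; [|by solve_cont..].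
  by apply: eq_integral_oo => // [| |x xab]; [by solve_cont|by solve_cont|
    rewrite (rs_ueq S)//; ring].
rewrite E1 E2 mulrN opprK -integral_onN; last by solve_cont.
rewrite -integral_onZ -?integral_onD; [|by solve_cont..].
by apply: eq_integral_on => x _; ring.
Qed.

Context (c M : R) (c0 : 0 < c) (M0 : 0 < M).
Context (Hc : forall x t, x \in `]a, b[ -> 2 <= t -> c <= v x t).
Context (HM : forall t, 2 <= t -> mass a b u t <= M /\
    mass a b v t <= M).

Let L0 : 0 < L. Proof. by rewrite subr_gt0. Qed.

Local Notation fisher := (fisher a b u ux).
Local Notation dirichlet := (dirichlet a b vx).
Local Notation hessian := (hessian a b vxx).

(** Half of the Fisher information absorbs the taxis term by completing a square;
    u - 1 <= u ln u and ln u <= u - 1 control the reaction terms. *)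
Lemma entropy_dissipation t P : 2 <= t ->
  (forall x, x \in `[a, b] -> vx x t ^+ 2 <= P) ->
  I (fun x => ut x t * (ln (u x t) + 1)) <=
  - (fisher t / 2) + chi ^+ 2 / (2 * c ^+ 2) * M * P + M + B * M.
Proof.
move=> t2 HP; have t0 : 0 < t by lra.
have [cu cux cuxx cut] := ns_slice (rs_u S) t0.
have [cv cvx cvxx cvt] := ns_slice (rs_v S) t0.
have [cui cvi clu] := slices_inv S t0; have cB := rs_cB1 S t0.
have [Mu Mv] := HM t2; have B0 := bound_ge0 ab S.
have P0 : 0 <= P by apply: le_trans (HP a _); rewrite ?sqr_ge0// bound_itvE ltW.
pose k := chi ^+ 2 / (2 * c ^+ 2) * P.
have k0 : 0 <= k.
  by apply: mulr_ge0 => //; apply: divr_ge0; [exact: sqr_ge0|rewrite mulr_ge0// sqr_ge0].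
rewrite entropy_production//.
apply: (@le_trans _ _ (I (fun x =>
    - 2^-1 * (ux x t ^+ 2 * (u x t)^-1) + (k + B) * u x t + v x t))).
  apply: integral_on_le; [by solve_cont..|] => x xab.
  have xab' := subset_itv_oo_cc xab.
  have u0 := rs_upos S xab' t0; have v0 := rs_vpos S xab' t0.
  have hB := rs_B1 S xab t0; have hv := Hc xab t2; have hP := HP x xab'.
  have hln1 := ln_le_sub1 u0; have hln2 := xlnx_ge u0.
  set p := ux x t; set q := vx x t in hP *; set r := u x t in u0 hln1 hln2 *.
  set w := v x t in v0 hv *; set l := ln r in hln1 hln2 *.
  have h1 : (- (r * w) + B1 x t) * (l + 1) <= B * r + w.
    have : 0 <= w * (r * l - r + 1) by rewrite mulr_ge0 ?(ltW v0)//; lra.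
    have : 0 <= w * r by rewrite mulr_ge0 ?ltW.
    have : 0 <= B1 x t * (r - 1 - l) by rewrite mulr_ge0//; [case/andP: hB|lra].
    have : 0 <= (B - B1 x t) * r by rewrite mulr_ge0 ?(ltW u0)// subr_ge0; case/andP: hB.
    lra.
  have h2 : - (p ^+ 2 * r^-1) + chi * (r * q * w^-1 * (p * r^-1)) <=
     - 2^-1 * (p ^+ 2 * r^-1) + chi ^+ 2 / 2 * q ^+ 2 * (w^-1) ^+ 2 * r.
    rewrite -subr_ge0.
    have -> : - 2^-1 * (p ^+ 2 * r^-1) + chi ^+ 2 / 2 * q ^+ 2 * (w^-1) ^+ 2 * r -
      (- (p ^+ 2 * r^-1) + chi * (r * q * w^-1 * (p * r^-1))) =
      (p - chi * q * w^-1 * r) ^+ 2 * (2 * r)^-1 by field; rewrite !gt_eqF.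
    by rewrite mulr_ge0 ?sqr_ge0// invr_ge0 mulr_ge0// ltW.
  have h3 : chi ^+ 2 / 2 * q ^+ 2 * (w^-1) ^+ 2 * r <= k * r.
    rewrite ler_wpM2r ?(ltW u0)//.
    have -> : k = chi ^+ 2 / 2 * P * (c^-1) ^+ 2 by rewrite /k; field; rewrite gt_eqF.
    apply: ler_pM.
    - by apply: mulr_ge0; [apply: divr_ge0 => //|]; exact: sqr_ge0.
    - exact: sqr_ge0.
    - by apply: ler_wpM2l => //; apply: divr_ge0 => //; exact: sqr_ge0.
    apply: lerXn2r; rewrite ?nnegrE ?invr_ge0 ?(ltW v0) ?(ltW c0)//.
    by rewrite lef_pV2 ?posrE.
  lra.
rewrite !integral_onD ?integral_onZ; [|by solve_cont..].
rewrite -/(fisher t) -/(mass a b u t) -/(mass a b v t).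
have : (k + B) * mass a b u t <= (k + B) * M.
  by rewrite ler_wpM2l// addr_ge0.
have -> : chi ^+ 2 / (2 * c ^+ 2) * M * P = k * M by rewrite /k mulrAC.
rewrite /mass in Mv *; lra.
Qed.

(** By the second equation v_t = v_xx + f with f = u v - v + B2, so that
    - 2 v_t v_xx <= - v_xx^2 + f^2. *)
Lemma dirichlet_dissipation t V : 2 <= t -> (forall x, x \in `[a, b] -> v x t <= V) ->
  - 2 * I (fun x => vt x t * vxx x t) <= - hessian t
    + 3 * V ^+ 2 * I (fun x => u x t ^+ 2) + 3 * (V ^+ 2 + B ^+ 2) * L.
Proof.
move=> t2 HV; have t0 : 0 < t by lra.
have [cu cux cuxx cut] := ns_slice (rs_u S) t0.
have [cv cvx cvxx cvt] := ns_slice (rs_v S) t0.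
have cst : cont (fun _ : R => V ^+ 2 + B ^+ 2) by exact: cont_on_cst.
rewrite -integral_onZ; last by solve_cont.
apply: (@le_trans _ _ (I (fun x => - 1 * vxx x t ^+ 2 + 3 * V ^+ 2 * u x t ^+ 2
   + 3 * (V ^+ 2 + B ^+ 2)))).
  apply: integral_on_le; [by solve_cont..|] => x xab.
  have xab' := subset_itv_oo_cc xab.
  have u0 := rs_upos S xab' t0; have v0 := rs_vpos S xab' t0.
  have /andP[b0 bB] := rs_B2 S xab t0; have hv := HV x xab'.
  rewrite (rs_veq S)//.
  set q := vxx x t; set w := v x t in v0 hv *; set z := u x t in u0 *.
  have h1 : w ^+ 2 <= V ^+ 2 by rewrite lerXn2r// nnegrE ltW// (lt_le_trans v0).
  have h2 : B2 x t ^+ 2 <= B ^+ 2 by rewrite lerXn2r// nnegrE// (le_trans b0).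
  have h3 : z ^+ 2 * w ^+ 2 <= z ^+ 2 * V ^+ 2 by rewrite ler_wpM2l// sqr_ge0.
  have h4 : 0 <= (q + (z * w - w + B2 x t)) ^+ 2 by exact: sqr_ge0.
  have h5 : 0 <= (z * w + w) ^+ 2 by exact: sqr_ge0.
  have h6 : 0 <= (z * w - B2 x t) ^+ 2 by exact: sqr_ge0.
  have h7 : 0 <= (w + B2 x t) ^+ 2 by exact: sqr_ge0.
  lra.
rewrite !integral_onD ?integral_onZ; [|by solve_cont..].
rewrite integral_on_cst ?(ltW ab)// -/(hessian t); lra.
Qed.

Lemma entropy_ge t : 0 < t -> - L <= entropy t.
Proof.
move=> t0; have [cu _ _ _] := ns_slice (rs_u S) t0.
have [_ _ clu] := slices_inv S t0.
rewrite -mulN1r -integral_on_cst ?(ltW ab)//.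
apply: integral_on_le; [exact: cont_on_cst|by solve_cont|] => x xab.
have u0 := rs_upos S (subset_itv_oo_cc xab) t0.
by apply: le_trans (xlnx_ge u0); lra.
Qed.

Lemma integral_u_sqr t l : 2 <= t -> 0 < l -> I (fun x => u x t ^+ 2) <=
  (M / L + l / 2 * fisher t + M / (2 * l)) * M.
Proof.
move=> t2 l0; have t0 : 0 < t by lra.
have [cu _ _ _] := ns_slice (rs_u S) t0.
have H := u_sup ab S HM t2 l0.
apply: le_trans (integral_sqr_le t0 cu (fun x h => rs_upos S h t0) H) _.
rewrite ler_wpM2l//; last by have [] := HM t2.
have aab : a \in `[a, b] by rewrite bound_itvE ltW.
by apply: le_trans (H a aab); rewrite ltW// (rs_upos S).
Qed.

(** The width d is so small that the taxis term takes a quarter of the hessian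
    term, and l so small, depending on V, that int u^2 v^2 takes a quarter of the
    Fisher information. What remains is a polynomial of degree four in V. *)
Lemma energy_dissipation : exists C, forall t, 2 <= t ->
  I (fun x => ut x t * (ln (u x t) + 1)) - 2 * I (fun x => vt x t * vxx x t) <=
  C - (fisher t + hessian t) / 4.
Proof.
have [C5 C50 HV5] := v_fifth_power ab S M0 HM.
have B0 := bound_ge0 ab S.
pose K1 := chi ^+ 2 / (2 * c ^+ 2) * M.
have K10 : 0 <= K1.
  apply: mulr_ge0; last exact: ltW.
  by apply: divr_ge0; [exact: sqr_ge0|rewrite mulr_ge0// sqr_ge0].
pose d := (8 * (K1 + 1))^-1.
have d0 : 0 < d by rewrite invr_gt0; lra.
have K1d : K1 * (2 * d) <= 4^-1.
  rewrite /d -subr_ge0; have -> : 4^-1 - K1 * (2 / (8 * (K1 + 1))) = (4 * (K1 + 1))^-1.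
    by field; rewrite gt_eqF//; lra.
  by rewrite invr_ge0; lra.
pose k1 := K1 * (M / (2 * d ^+ 3) * 2).
have k10 : 0 <= k1.
  apply: mulr_ge0 => //; apply: mulr_ge0 => //; apply: divr_ge0; first exact: ltW.
  by rewrite mulr_ge0// exprn_ge0// ltW.
pose k2 := 3 * M * (M / L + 3 * M) + 3 * L.
have ML0 : 0 <= M / L by rewrite divr_ge0// ltW.
have k20 : 0 <= k2.
  apply: addr_ge0; last by rewrite mulr_ge0// ltW.
  apply: mulr_ge0; first by rewrite mulr_ge0// ltW.
  by rewrite addr_ge0// mulr_ge0// ltW.
pose k4 := 9 * M ^+ 3.
have k40 : 0 <= k4 by rewrite mulr_ge0// exprn_ge0// ltW.
have [C HC] := absorb_fifth_power (addr_ge0 (addr_ge0 k10 k20) k40) C50.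
exists (C + M + B * M + 3 * B ^+ 2 * L) => t t2; have t0 : 0 < t by lra.
have [V [V0 HV V5]] := HV5 t t2.
have D0 := hessian_ge0 (a := a) (b := b) vxx t; have A0 := fisher_ge0 S t0.
have {}HC := HC V (hessian t) V0 D0 V5.
have h1 := entropy_dissipation t2 (vx_sup ab S HM t2 d0 HV).
have h2 := dirichlet_dissipation t2 HV.
pose l := (6 * (V ^+ 2 * M + 1))^-1.
have VM0 : 0 <= V ^+ 2 * M by rewrite mulr_ge0 ?sqr_ge0// ltW.
have l0 : 0 < l by rewrite invr_gt0; lra.
have h3 := integral_u_sqr t2 l0.
have h4 : 3 * V ^+ 2 * I (fun x => u x t ^+ 2) <=
   3 * V ^+ 2 * ((M / L + l / 2 * fisher t + M / (2 * l)) * M).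
  by rewrite ler_wpM2l// mulr_ge0// sqr_ge0.
have h5 : 3 * V ^+ 2 * ((M / L + l / 2 * fisher t + M / (2 * l)) * M) <=
   3 * M * V ^+ 2 * (M / L + 3 * M * (V ^+ 2 * M + 1)) + fisher t / 4.
  have -> : 3 * V ^+ 2 * ((M / L + l / 2 * fisher t + M / (2 * l)) * M) =
    3 * M * V ^+ 2 * (M / L + 3 * M * (V ^+ 2 * M + 1)) +
    (V ^+ 2 * M) / (V ^+ 2 * M + 1) * (fisher t / 4).
    by rewrite /l; field; rewrite !gt_eqF//; lra.
  rewrite lerD2l ler_piMl ?divr_ge0// ler_pdivrMr ?mul1r; lra.
have h6 : chi ^+ 2 / (2 * c ^+ 2) * M * (2 * d * hessian t + V * M / (2 * d ^+ 3) * 2) <=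
    hessian t / 4 + k1 * V.
  rewrite -/K1; have -> : K1 * (2 * d * hessian t + V * M / (2 * d ^+ 3) * 2) =
    K1 * (2 * d) * hessian t + k1 * V by rewrite /k1; ring.
  by rewrite lerD2r mulrC ler_wpM2l.
have V1 : V <= 1 + V ^+ 4.
  have : 0 <= (V ^+ 2 - 2^-1) ^+ 2 by exact: sqr_ge0.
  have : 0 <= (V - 2^-1) ^+ 2 by exact: sqr_ge0.
  lra.
have V2 : V ^+ 2 <= 1 + V ^+ 4.
  have : 0 <= (V ^+ 2 - 2^-1) ^+ 2 by exact: sqr_ge0.
  lra.
have V40 : 0 <= V ^+ 4 by exact: exprn_ge0.
have h7 : k1 * V <= k1 * (1 + V ^+ 4) by rewrite ler_wpM2l.
have h8 : k2 * V ^+ 2 <= k2 * (1 + V ^+ 4) by rewrite ler_wpM2l.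
have h9 : 0 <= k4 by [].
rewrite /k2 /k4 in h8 h9 HC; lra.
Qed.

Local Notation energy := (fun t => entropy t + dirichlet t).

Lemma energy_le : exists2 C, 0 <= C & forall t, 2 <= t ->
  energy t <= C * (1 + fisher t + hessian t).
Proof.
have [C5 C50 HV5] := v_fifth_power ab S M0 HM.
have [C HC] := absorb_fifth_power (ltW M0) C50.
have ML0 : 0 <= M / L by rewrite divr_ge0// ltW.
exists (`|C| + 2 + M * (M / L) + M + M ^+ 2).
  have h1 := normr_ge0 C; have h2 := mulr_ge0 (ltW M0) ML0; have h3 := sqr_ge0 M.
  have h4 := ltW M0; rewrite !addr_ge0//.
move=> t t2; have t0 : 0 < t by lra.
have [V [V0 HV V5]] := HV5 t t2.
have D0 := hessian_ge0 (a := a) (b := b) vxx t; have A0 := fisher_ge0 S t0.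
have {}HC := HC V (hessian t) V0 D0 V5.
have h1 := dirichlet_le ab S HM t2 ltr01 HV.
have h2 := integral_u_sqr t2 (@ltr01 R).
have [cu _ _ _] := ns_slice (rs_u S) t0.
have [_ _ clu] := slices_inv S t0.
have h3 : entropy t <= I (fun x => u x t ^+ 2).
  apply: integral_on_le; [by solve_cont..|] => x xab.
  have u0 := rs_upos S (subset_itv_oo_cc xab) t0; rewrite expr2 ler_wpM2l ?(ltW u0)//.
  by apply: le_trans (ln_le_sub1 u0) _; lra.
have V1 : V <= 1 + V ^+ 4.
  have : 0 <= (V ^+ 2 - 2^-1) ^+ 2 by exact: sqr_ge0.
  have : 0 <= (V - 2^-1) ^+ 2 by exact: sqr_ge0.
  lra.
have h4 : M * V <= M * (1 + V ^+ 4) by rewrite ler_wpM2l// ltW.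
have h5 := ler_norm C.
have h6 := mulr_ge0 (normr_ge0 C) A0; have h7 := mulr_ge0 (normr_ge0 C) D0.
have h8 := mulr_ge0 (ltW M0) ML0.
have h9 := mulr_ge0 h8 A0; have h10 := mulr_ge0 h8 D0.
have h11 := mulr_ge0 (ltW M0) A0; have h12 := mulr_ge0 (ltW M0) D0.
have h13 := mulr_ge0 (sqr_ge0 M) A0; have h14 := mulr_ge0 (sqr_ge0 M) D0.
have h15 := sqr_ge0 M; have h16 := ltW M0.
rewrite mul1r divr1 in h1; rewrite mulr1 mul1r in h2.
move: (M / L) (`|C|) ML0 h2 h5 h6 h7 h8 h9 h10 => m n *; lra.
Qed.

Lemma derive_energy t : 0 < t -> is_derive t 1 energy
  (I (fun x => ut x t * (ln (u x t) + 1)) - 2 * I (fun x => vt x t * vxx x t)).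
Proof.
move=> t0; have := derD (derive_entropy t0) (derive_integral_sqr_dx ab (rs_v S) t0).
by congr is_derive; rewrite mulNr.
Qed.

(** By energy_le the dissipation dominates the energy itself, up to a constant. *)
Lemma energy_bounded : exists2 C, 0 <= C & forall t, 2 <= t -> `|energy t| <= C.
Proof.
have [C1 H1] := energy_dissipation; have [C2 C20 H2] := energy_le.
pose e := (4 * (C2 + 1))^-1; have e0 : 0 < e by rewrite invr_gt0; lra.
have H t : 2 <= t -> energy t <= Num.max (energy 2) ((C1 + 4^-1) / e).
  apply: (@gronwall R energy _ _ _ _ e0) => s s2.
    by apply: derive_energy; lra.
  apply: le_trans (H1 s s2) _; have := H2 s s2.
  set F := entropy s + dirichlet s; set G := fisher s; set Q := hessian s => h.
  have G0 : 0 <= G by apply: (fisher_ge0 S); lra.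
  have Q0 : 0 <= Q by exact: hessian_ge0.
  have : e * F <= e * ((C2 + 1) * (1 + G + Q)).
    by rewrite ler_wpM2l ?(ltW e0)//; lra.
  have -> : e * ((C2 + 1) * (1 + G + Q)) = (1 + G + Q) / 4.
    by rewrite /e; field; rewrite gt_eqF//; lra.
  lra.
move: H; set K := Num.max _ _ => H; exists (L + `|K|); first by rewrite addr_ge0// ltW.
move=> t t2; have t0 : 0 < t by lra.
have /= h1 := H t t2; have h2 := entropy_ge t0.
have h3 := dirichlet_ge0 (a := a) (b := b) vx t.
have h4 := ler_norm K; have h5 := normr_ge0 K; have h6 := ltW L0.
by rewrite /= ler_norml; apply/andP; split; lra.
Qed.

Lemma v_upper : exists2 C, 0 <= C & forall t, 2 <= t ->
  dirichlet t <= C /\ forall x, x \in `[a, b] -> v x t <= C.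
Proof.
have [C C0 HC] := energy_bounded.
have q0 := sqr_ge0 (M / L); have LC0 := mulr_ge0 (ltW L0) (addr_ge0 C0 (ltW L0)).
have l0 := ltW L0; exists ((C + L) + 2 * (M / L) ^+ 2 + 2 * (L * (C + L)) + 1).
  by move: ((M / L) ^+ 2) (L * (C + L)) q0 LC0 => p q *; lra.
move=> t t2; have t0 : 0 < t by lra.
have h1 : dirichlet t <= C + L.
  have := HC t t2; have := entropy_ge t0; rewrite ler_norml /= => ? /andP[_]; lra.
have X0 := dirichlet_ge0 (a := a) (b := b) vx t.
have h3 : L * dirichlet t <= L * (C + L) by rewrite ler_wpM2l.
split=> [|x xab].
  by move: ((M / L) ^+ 2) (L * (C + L)) q0 LC0 => p q *; lra.
have := sup_sqr_le_energy ab (ns_C1 (rs_v S) t0) (fun x h => ltW (rs_vpos S h t0)) xab.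
rewrite -/(dirichlet t) -/(mass a b v t) => h5.
have [_ Mv] := HM t2.
have h6 : (mass a b v t / L) ^+ 2 <= (M / L) ^+ 2.
  have mv0 : 0 <= mass a b v t.
    by apply: integral_on_ge0 => z zab; rewrite ltW// (rs_vpos S).
  by rewrite lerXn2r// ?nnegrE ?divr_ge0 ?(ltW M0) ?(ltW L0)// ler_wpM2r// invr_ge0 ltW.
have h7 : 0 <= (v x t - 2^-1) ^+ 2 by exact: sqr_ge0.
rewrite -mulrA in h5; move: ((M / L) ^+ 2) ((_ / L) ^+ 2) (L * (C + L)) (L * dirichlet t)
  q0 LC0 h3 h5 h6 => p q y z *; lra.
Qed.

End EnergyInequality.

Arguments entropy {R} a b u t.

(** * The gradient of u *)
Section GradientBound.
Context {R : realType} {a b : R} (ab : a < b).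
Implicit Types (x t : R).
Local Notation I := (integral_on a b).
Local Notation cont := (cont_on `[a, b]).
Local Notation L := (b - a).
Context (chi B : R) (B1 B2 u ux uxx ut v vx vxx vt : R -> R -> R).
Context (S : regular_solution a b chi B B1 B2 u ux uxx ut v vx vxx vt).
Context (c M : R) (c0 : 0 < c) (M0 : 0 < M).
Context (Hc : forall x t, x \in `]a, b[ -> 2 <= t -> c <= v x t).
Context (HM : forall t, 2 <= t -> mass a b u t <= M /\
    mass a b v t <= M).

Let L0 : 0 < L. Proof. by rewrite subr_gt0. Qed.

Local Notation fisher := (fisher a b u ux).
Local Notation vgrad := (dirichlet a b vx).
Local Notation hessian := (hessian a b vxx).
Local Notation ugrad := (dirichlet a b ux).

Let CU : R := 2 * (M / L) ^+ 2 + 2 * L.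

Let CU0 : 0 <= CU.
Proof. by rewrite addr_ge0// mulr_ge0// ?sqr_ge0// ltW. Qed.

Lemma u_sqr_le t x : 2 <= t -> x \in `[a, b] -> u x t ^+ 2 <= CU * (1 + ugrad t).
Proof.
move=> t2 xab; have t0 : 0 < t by lra.
have := sup_sqr_le_energy ab (ns_C1 (rs_u S) t0) (fun x h => ltW (rs_upos S h t0)) xab.
rewrite -/(mass a b u t) -/(vgrad t) => h5.
have [Mu _] := HM t2.
have h6 : (mass a b u t / L) ^+ 2 <= (M / L) ^+ 2.
  have mu0 : 0 <= mass a b u t.
    by apply: integral_on_ge0 => z zab; rewrite ltW// (rs_upos S).
  by rewrite lerXn2r// ?nnegrE ?divr_ge0 ?(ltW M0) ?(ltW L0)// ler_wpM2r// invr_ge0 ltW.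
have g0 : 0 <= ugrad t by exact: dirichlet_ge0.
have l0 := ltW L0; have q0 := sqr_ge0 (M / L); have qg := mulr_ge0 q0 g0.
apply: le_trans h5 _; rewrite /CU /= /dirichlet in g0 qg *.
move: ((M / L) ^+ 2) ((_ / L) ^+ 2) (I (fun x => ux x t ^+ 2)) q0 h6 g0 qg => p q g *.
lra.
Qed.

(** Write u_t = u_xx - s. Then - 2 u_t u_xx = - 2 u_xx^2 + 2 s u_xx is at most s^2,
    and s is a sum of five terms. *)
Lemma gradient_production t P U V : 2 <= t -> 0 <= V -> 0 <= P -> 0 <= U ->
  (forall x, x \in `[a, b] -> vx x t ^+ 2 <= P) ->
  (forall x, x \in `[a, b] -> u x t ^+ 2 <= U) ->
  (forall x, x \in `[a, b] -> v x t <= V) ->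
  - 2 * I (fun x => ut x t * uxx x t) <=
  5 * (chi ^+ 2 * (c ^- 2 * P * ugrad t + c ^- 2 * U * hessian t
    + c ^- 2 ^+ 2 * U * P * vgrad t) + (U * V ^+ 2 + B ^+ 2) * L).
Proof.
move=> t2 V0 P0 U0 HP HU HV; have t0 : 0 < t by lra.
have [cu cux cuxx cut] := ns_slice (rs_u S) t0.
have [cv cvx cvxx cvt] := ns_slice (rs_v S) t0.
set k := c ^- 2; have k0 : 0 <= k by rewrite invr_ge0 sqr_ge0.
rewrite -integral_onZ; last by solve_cont.
apply: (@le_trans _ _ (I (fun x => 5 * chi ^+ 2 * k * P * ux x t ^+ 2
   + 5 * chi ^+ 2 * k * U * vxx x t ^+ 2
   + 5 * chi ^+ 2 * k ^+ 2 * U * P * vx x t ^+ 2 + 5 * (U * V ^+ 2 + B ^+ 2)))).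
  apply: integral_on_le; [by solve_cont..|] => x xab.
  have xab' := subset_itv_oo_cc xab.
  have u0 := rs_upos S xab' t0; have v0 := rs_vpos S xab' t0.
  have /andP[b0 bB] := rs_B1 S xab t0; have hv := HV x xab'.
  have hP := HP x xab'; have hU := HU x xab'; have hc := Hc xab t2.
  rewrite (rs_ueq S)//.
  set p := ux x t; set q := vx x t in hP *; set r := u x t in u0 hU *.
  set w := v x t in v0 hv hc *; set m := vxx x t; set n := uxx x t.
  have wk : w^-1 ^+ 2 <= k.
    rewrite /k -exprVn; apply: lerXn2r; rewrite ?nnegrE ?invr_ge0 ?(ltW v0) ?(ltW c0)//.
    by rewrite lef_pV2 ?posrE.
  have w20 : 0 <= w^-1 ^+ 2 by exact: sqr_ge0.
  have q20 : 0 <= q ^+ 2 by exact: sqr_ge0.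
  have r20 : 0 <= r ^+ 2 by exact: sqr_ge0.
  set e1 := p * q * w^-1; set e2 := r * m * w^-1; set e3 := r * q ^+ 2 * w^-1 ^+ 2.
  have h1 : e1 ^+ 2 <= k * P * p ^+ 2.
    have -> : e1 ^+ 2 = w^-1 ^+ 2 * q ^+ 2 * p ^+ 2 by rewrite /e1; ring.
    by rewrite ler_wpM2r ?sqr_ge0//; exact: ler_pM.
  have h2 : e2 ^+ 2 <= k * U * m ^+ 2.
    have -> : e2 ^+ 2 = w^-1 ^+ 2 * r ^+ 2 * m ^+ 2 by rewrite /e2; ring.
    by rewrite ler_wpM2r ?sqr_ge0//; exact: ler_pM.
  have h3 : e3 ^+ 2 <= k ^+ 2 * U * P * q ^+ 2.
    have -> : e3 ^+ 2 = (w^-1 ^+ 2) ^+ 2 * r ^+ 2 * q ^+ 2 * q ^+ 2 by rewrite /e3; ring.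
    rewrite ler_wpM2r//; apply: ler_pM => //.
      by apply: mulr_ge0 => //; exact: sqr_ge0.
    apply: ler_pM => //; first exact: sqr_ge0.
    by apply: lerXn2r; rewrite ?nnegrE.
  have h4 : (r * w) ^+ 2 <= U * V ^+ 2.
    rewrite exprMn; apply: ler_pM => //; first exact: sqr_ge0.
    by apply: lerXn2r; rewrite ?nnegrE// ltW.
  have h5 : B1 x t ^+ 2 <= B ^+ 2 by apply: lerXn2r; rewrite ?nnegrE// (le_trans b0).
  set g1 := chi * e1; set g2 := chi * e2; set g3 := chi * e3.
  have chi20 := sqr_ge0 chi.
  have h6 : g1 ^+ 2 <= chi ^+ 2 * (k * P * p ^+ 2) by rewrite exprMn ler_wpM2l.
  have h7 : g2 ^+ 2 <= chi ^+ 2 * (k * U * m ^+ 2) by rewrite exprMn ler_wpM2l.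
  have h8 : g3 ^+ 2 <= chi ^+ 2 * (k ^+ 2 * U * P * q ^+ 2) by rewrite exprMn ler_wpM2l.
  set g4 := r * w in h4 *; set g5 := B1 x t in h5 *.
  have -> : - 2 * ((n - chi * (e1 + e2 - e3) - g4 + g5) * n) =
    - 2 * n ^+ 2 + 2 * n * (g1 + g2 - g3 + g4 - g5) by rewrite /g1 /g2 /g3; ring.
  have s1 : 2 * n * (g1 + g2 - g3 + g4 - g5) <= 2 * n ^+ 2 + (g1 + g2 - g3 + g4 - g5) ^+ 2.
    have := sqr_ge0 (n - (g1 + g2 - g3 + g4 - g5)); have := sqr_ge0 n.
    set z := g1 + g2 - g3 + g4 - g5; rewrite !expr2; lra.
  have s2 : (g1 + g2 - g3 + g4 - g5) ^+ 2 <=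
    5 * (g1 ^+ 2 + g2 ^+ 2 + g3 ^+ 2 + g4 ^+ 2 + g5 ^+ 2).
    rewrite -subr_ge0.
    have -> : 5 * (g1 ^+ 2 + g2 ^+ 2 + g3 ^+ 2 + g4 ^+ 2 + g5 ^+ 2)
      - (g1 + g2 - g3 + g4 - g5) ^+ 2 =
      (g1 - g2) ^+ 2 + (g1 + g3) ^+ 2 + (g1 - g4) ^+ 2 + (g1 + g5) ^+ 2
      + (g2 + g3) ^+ 2 + (g2 - g4) ^+ 2 + (g2 + g5) ^+ 2
      + (g3 + g4) ^+ 2 + (g3 - g5) ^+ 2 + (g4 + g5) ^+ 2 by ring.
    by rewrite !addr_ge0// sqr_ge0.
  rewrite /e1 /e2 /e3 in h1 h2 h3; clear -s1 s2 h4 h5 h6 h7 h8.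
  move: (g1 ^+ 2) (g2 ^+ 2) (g3 ^+ 2) (g4 ^+ 2) (g5 ^+ 2) ((g1 + g2 - g3 + g4 - g5) ^+ 2)
    (2 * n * _) s1 s2 h4 h5 h6 h7 h8 => ? ? ? ? ? ? ? *; lra.
rewrite !integral_onD ?integral_onZ; [|by solve_cont..].
rewrite integral_on_cst ?(ltW ab)// -/(hessian t) -/(vgrad t) -/(ugrad t) /=.
rewrite /dirichlet; lra.
Qed.

Lemma gradient_inequality : exists2 C, 0 <= C & forall t, 2 <= t ->
  - 2 * I (fun x => ut x t * uxx x t) <= C * (1 + hessian t) * (1 + ugrad t).
Proof.
have [V V0 HV] := v_upper ab S c0 M0 Hc HM.
pose k : R := c ^- 2; have k0 : 0 <= k by rewrite invr_ge0 sqr_ge0.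
pose Cp := 2 + V * M; have Cp0 : 0 <= Cp by rewrite addr_ge0// mulr_ge0// ltW.
have chi20 := sqr_ge0 chi; have B20 := sqr_ge0 B; have V20 := sqr_ge0 V.
have kCp0 : 0 <= k * Cp by exact: mulr_ge0.
have kCU0 : 0 <= k * CU by exact: mulr_ge0.
have kk0 : 0 <= k ^+ 2 * CU * Cp * V by rewrite !mulr_ge0// sqr_ge0.
have z0 : 0 <= CU * V ^+ 2 * L by rewrite !mulr_ge0// ltW.
have y0 : 0 <= B ^+ 2 * L by rewrite mulr_ge0// ltW.
exists (5 * (chi ^+ 2 * (k * Cp + k * CU + k ^+ 2 * CU * Cp * V)
   + CU * V ^+ 2 * L + B ^+ 2 * L)).
  by rewrite mulr_ge0// !addr_ge0// mulr_ge0// !addr_ge0.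
move=> t t2; have [X1 vV] := HV t t2; have t0 : 0 < t by lra.
have H0 := hessian_ge0 (a := a) (b := b) vxx t.
have g0 : 0 <= ugrad t by exact: dirichlet_ge0.
have X0 := dirichlet_ge0 (a := a) (b := b) vx t.
have P0 : 0 <= Cp * (1 + hessian t) by rewrite mulr_ge0// addr_ge0.
have U0 : 0 <= CU * (1 + ugrad t) by rewrite mulr_ge0// addr_ge0.
have HP x : x \in `[a, b] -> vx x t ^+ 2 <= Cp * (1 + hessian t).
  move=> xab; apply: le_trans (vx_sup ab S HM t2 ltr01 vV xab) _.
  rewrite !expr1n !mulr1 divfK// /Cp.
  have VM0 : 0 <= V * M by rewrite mulr_ge0// ltW.
  by have := mulr_ge0 VM0 H0; lra.
have := gradient_production t2 V0 P0 U0 HP (fun x => u_sqr_le t2) vV.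
move=> /le_trans; apply; rewrite -/k -!mulrA ler_wpM2l// !mulrA /=.
set H := hessian t in H0 P0 HP *; set g := dirichlet a b ux t in g0 U0 *.
set X := vgrad t in X0 X1 *.
have T1 : (1 + H) <= (1 + H) * (1 + g) by rewrite ler_peMr ?addr_ge0// lerDl.
have T2 : (1 + g) <= (1 + H) * (1 + g) by rewrite ler_peMl ?addr_ge0// lerDl.
have T3 : 1 <= (1 + H) * (1 + g) by apply: le_trans T1; rewrite lerDl.
have T4 : (1 + H) * g <= (1 + H) * (1 + g) by rewrite ler_wpM2l ?addr_ge0// lerDr.
have T5 : H * (1 + g) <= (1 + H) * (1 + g) by rewrite ler_wpM2r ?addr_ge0// lerDr.
set T := (1 + H) * (1 + g) in T1 T2 T3 T4 T5 *.
have e1 : k * (Cp * (1 + H)) * g <= k * Cp * T.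
  by rewrite -!mulrA !(mulrA k) ler_wpM2l.
have e2 : k * (CU * (1 + g)) * H <= k * CU * T.
  by rewrite -!mulrA !(mulrA k) ler_wpM2l// mulrC.
have e3 : k ^+ 2 * (CU * (1 + g)) * (Cp * (1 + H)) * X <= k ^+ 2 * CU * Cp * V * T.
  have -> : k ^+ 2 * (CU * (1 + g)) * (Cp * (1 + H)) * X = k ^+ 2 * CU * Cp * T * X.
    by rewrite /T; ring.
  have -> : k ^+ 2 * CU * Cp * V * T = k ^+ 2 * CU * Cp * T * V by ring.
  have T0 : 0 <= T by apply: le_trans T3.
  have k20 : 0 <= k ^+ 2 by exact: sqr_ge0.
  apply: ler_wpM2l => //; apply: mulr_ge0 => //.
  by apply: mulr_ge0 => //; exact: mulr_ge0.
have e4 : CU * (1 + g) * V ^+ 2 * L <= CU * V ^+ 2 * L * T.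
  have -> : CU * (1 + g) * V ^+ 2 * L = CU * V ^+ 2 * L * (1 + g) by ring.
  by rewrite ler_wpM2l.
have e5 : B ^+ 2 * L <= B ^+ 2 * L * T by rewrite ler_peMr.
have e6 := ler_wpM2l chi20 (lerD (lerD e1 e2) e3).
have h := lerD (lerD e6 e4) e5; rewrite -subr_ge0 in h; rewrite -subr_ge0.
by apply: le_trans h _; rewrite le_eqVlt; apply/orP; left; apply/eqP; rewrite /T; ring.
Qed.

(** With U = sup u, int u_x^2 <= U A for the Fisher information A, while U^2 is at
    most a multiple of 1 + int u_x^2; hence 1 + int u_x^2 <= C (1 + A)^2. *)
Lemma ln_gradient_le : exists C, forall t, 2 <= t ->
  ln (1 + ugrad t) <= C + 2 * fisher t.
Proof.
exists (ln (2 + 2 * CU)) => t t2; have t0 : 0 < t by lra.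
have [cu cux _ _] := ns_slice (rs_u S) t0; have [cui _ _] := slices_inv S t0.
have [xm xmab Hxm] := EVT_max (ltW ab) cu.
have U2 := u_sqr_le t2 xmab; have A0 := fisher_ge0 S t0.
set U := u xm t in Hxm U2; have U0 : 0 < U by exact: (rs_upos S).
have g0 : 0 <= ugrad t by exact: dirichlet_ge0.
have h1 : ugrad t <= U * fisher t.
  rewrite -integral_onZ; last by solve_cont.
  apply: integral_on_le; [by solve_cont..|] => x /subset_itv_oo_cc xab.
  have u0 := rs_upos S xab t0.
  have -> : U * (ux x t ^+ 2 * (u x t)^-1) = ux x t ^+ 2 * (U / u x t) by ring.
  by rewrite ler_peMr ?sqr_ge0// ler_pdivlMr// mul1r Hxm.
move: (ugrad t) (fisher t) (CU) CU0 U2 A0 g0 h1 => g A K K0 U2 A0 g0 h1.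
have g1 : 0 < 1 + g by lra.
have A1 : 0 < 1 + A by lra.
have K1 : 0 < 2 + 2 * K by rewrite ltr_pwDl// mulr_ge0.
have h2 : g ^+ 2 <= K * (1 + g) * A ^+ 2.
  apply: (@le_trans _ _ ((U * A) ^+ 2)).
    by apply: lerXn2r; rewrite ?nnegrE// mulr_ge0// ltW.
  by rewrite exprMn ler_wpM2r// sqr_ge0.
have h3 : 1 + g <= (2 + 2 * K) * (1 + A) ^+ 2.
  apply: (@le_trans _ _ (2 + 2 * K * A ^+ 2)); last first.
    have := mulr_ge0 K0 A0; have := sqr_ge0 A; rewrite !expr2; lra.
  rewrite -(ler_pM2l g1); have := sqr_ge0 (g - 1); rewrite !expr2 in h2 *; lra.
apply: (@le_trans _ _ (ln ((2 + 2 * K) * (1 + A) ^+ 2))).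
  by rewrite ler_ln// posrE// mulr_gt0// exprn_gt0.
rewrite lnM ?posrE ?exprn_gt0// lerD2l lnXn// -(mulr_natl (ln _)).
by apply: ler_wpM2l => //; apply: le_trans (ln_le_sub1 A1) _; lra.
Qed.

(** The derivative of ln (1 + int u_x^2) is at most C5 (1 + D), D being the hessian
    term; K times the energy dissipates (C5 + 2) (A + D). What is left contains
    - 2 A, a damping by ln_gradient_le. *)
Lemma gradient_bounded : exists C, forall t, 2 <= t -> ugrad t <= C.
Proof.
have [C5 C50 H5] := gradient_inequality; have [C7 H7] := ln_gradient_le.
have [C1 H1] := energy_dissipation ab S c0 M0 Hc HM.
have [C2 C20 H2] := energy_bounded ab S c0 M0 Hc HM.
pose K := 4 * (C5 + 2); have K0 : 0 <= K by rewrite /K; lra.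
pose W t := entropy a b u t + vgrad t.
pose G t := ln (1 + ugrad t) + K * W t.
have H t : 2 <= t -> G t <= Num.max (G 2) ((C5 + K * C1 + C7 + K * C2) / 1).
  apply: (@gronwall R G (fun s => (0 + - 2 * I (fun x => ut x s * uxx x s)) / (1 + ugrad s)
    + K * (I (fun x => ut x s * (ln (u x s) + 1)) - 2 * I (fun x => vt x s * vxx x s)))) => //.
    move=> s s2; have s0 : 0 < s by lra.
    apply: derD; last by apply: derZ; exact: (derive_energy ab S).
    apply: (@der_ln _ (fun s => 1 + ugrad s)).
      by rewrite ltr_pwDl//; exact: dirichlet_ge0.
    by apply: derD; exact: (derive_integral_sqr_dx ab (rs_u S)).
  move=> s s2; have s0 : 0 < s by lra.
  have := H5 s s2; have := H7 s s2; have := H1 s s2; have := H2 s s2.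
  rewrite -/(W s) add0r /G.
  set p := I _; set q := I _; set r := I _.
  have g0 : 0 <= ugrad s by exact: dirichlet_ge0.
  have A0 := fisher_ge0 S s0; have D0 := hessian_ge0 (a := a) (b := b) vxx s.
  move: (ugrad s) (fisher s) (hessian s) (W s) g0 A0 D0 => g A D w g0 A0 D0.
  move=> wC h1 h7 h5.
  have g1 : 0 < 1 + g by lra.
  have e1 : - 2 * r / (1 + g) <= C5 * (1 + D) by rewrite ler_pdivrMr.
  have e2 : K * (p - 2 * q) <= K * (C1 - (A + D) / 4) by rewrite ler_wpM2l.
  have e3 : K * w <= K * C2 by rewrite ler_wpM2l// (le_trans (ler_norm _)).
  have e4 := mulr_ge0 C50 A0.
  have e5 : K * (C1 - (A + D) / 4) = K * C1 - (C5 + 2) * (A + D) by rewrite /K; field.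
  rewrite e5 in e2; lra.
move: H; set N := Num.max _ _ => H.
exists (expR (N + K * C2)) => t t2.
have g0 : 0 <= ugrad t by exact: dirichlet_ge0.
have h1 := H t t2; have h2 := H2 t t2; rewrite -/(W t) in h2.
have h3 : - (K * C2) <= K * W t.
  by rewrite -mulrN ler_wpM2l//; move: h2; rewrite ler_norml => /andP[].
have h4 : ln (1 + ugrad t) <= N + K * C2 by move: h1; rewrite /G; lra.
have g1 : 0 < 1 + ugrad t by lra.
by rewrite -ler_expR lnK ?posrE// in h4; lra.
Qed.

End GradientBound.

(** * Decay of u *)
Section Decay.
Context {R : realType} {a b : R} (ab : a < b).
Implicit Types (x t : R).
Local Notation I := (integral_on a b).
Local Notation cont := (cont_on `[a, b]).
Local Notation L := (b - a).

Lemma cont_on_integral (w : R -> R -> R) (p q : R) : 0 < p ->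
  continuous_in ([set` `[a, b]] `*` [set s : R | 0 < s]) w ->
  cont_on `[p, q] (fun s => I (w^~ s)).
Proof.
move=> p0 cw; apply/cont_onP => s; rewrite /= in_itv/= => /andP[ps _].
have s0 : 0 < s by exact: lt_le_trans ps.
apply: cvg_within_filter; apply/cvgrPdist_le => e e0.
apply: filterS2 (open_near open_pos s0) (integral_cvg open_pos ab cw s0 e0) => r r0 Hr.
have cs := @slice_cont _ a b [set s | 0 < s] w s cw s0.
have cr := @slice_cont _ a b [set s | 0 < s] w r cw r0.
rewrite -integral_onB//; apply: le_trans (integral_on_norm _) _; first by solve_cont.
by apply: le_trans Hr; apply: integral_on_le; [by solve_cont..|] => x _; rewrite distrC.
Qed.

Lemma bernoulli (c : R) n : 0 <= c -> 1 + n%:R * c <= (1 + c) ^+ n.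
Proof.
move=> c0; elim: n => [|n IH]; first by rewrite mul0r addr0 expr0.
rewrite exprS -natr1; apply: le_trans (ler_wpM2l _ IH); last by rewrite addr_ge0.
have : 0 <= n%:R * c * c by rewrite !mulr_ge0.
lra.
Qed.

(** Iterating the inequality contracts Z by the factor 1 + c per unit of time. *)
Lemma contraction_decay (Z beta : R -> R) c M : 0 < c ->
  (forall t, 2 <= t -> Z t <= M) ->
  (forall t, 2 <= t -> (1 + c) * Z (t + 1) <= Z t + (1 + c) * beta t) ->
  (forall e, 0 < e -> exists T, forall t, T <= t -> beta t <= e) ->
  forall e, 0 < e -> exists T, forall t, T <= t -> Z t <= e.
Proof.
move=> c0 HM HZ Hbeta e e0; have c1 : 0 < 1 + c by lra.
have e20 : 0 < e / 2 * (c / (1 + c)) by rewrite mulr_gt0 ?divr_gt0.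
have [T0 HT0] := Hbeta _ e20; pose T := Num.max 2 T0.
have T2 : 2 <= T by rewrite le_max lexx.
have TT0 : T0 <= T by rewrite le_max lexx orbT.
have H n : forall t, T + n%:R <= t -> Z t <= (1 + c) ^- n * `|M| + e / 2.
  elim: n => [|n IH] t Tt.
    rewrite expr0 invr1 mul1r; have := HM t; have := ler_norm M.
    by rewrite addr0 in Tt => h1 /(_ (le_trans T2 Tt)); lra.
  rewrite -natr1 in Tt; have n0 : 0 <= n%:R :> R by [].
  have := IH (t - 1); have := HZ (t - 1); have := HT0 (t - 1).
  rewrite subrK => h1 h2 h3.
  have {}h1 : beta (t - 1) <= e / 2 * (c / (1 + c)) by apply: h1; lra.
  have {}h2 : (1 + c) * Z t <= Z (t - 1) + (1 + c) * beta (t - 1) by apply: h2; lra.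
  have {}h3 : Z (t - 1) <= (1 + c) ^- n * `|M| + e / 2 by apply: h3; lra.
  have h4 : (1 + c) * beta (t - 1) <= e / 2 * c.
    apply: le_trans (ler_wpM2l (ltW c1) h1) _.
    by rewrite le_eqVlt; apply/orP; left; apply/eqP; field; rewrite gt_eqF.
  rewrite -(ler_pM2l c1); apply: le_trans (le_trans h2 (lerD h3 h4)) _.
  rewrite exprS invfM mulrDr !mulrA divff ?gt_eqF// mul1r; lra.
pose n := Num.bound (`|M| / (e / 2 * c)).
exists (T + n%:R) => t Tt; apply: le_trans (H n t Tt) _.
suff : (1 + c) ^- n * `|M| <= e / 2 by lra.
rewrite mulrC ler_pdivrMr ?exprn_gt0//.
have ec : 0 < e / 2 * c by rewrite mulr_gt0// divr_gt0.
have : `|M| / (e / 2 * c) <= n%:R.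
  by apply/ltW/archi_boundP/divr_ge0 => //; exact: ltW.
rewrite ler_pdivrMr// => h.
have := ler_wpM2l (ltW (divr_gt0 e0 (ltr0Sn R 1))) (bernoulli n (ltW c0)).
apply: le_trans; lra.
Qed.

Context (chi B : R) (B1 B2 u ux uxx ut v vx vxx vt : R -> R -> R).
Context (S : regular_solution a b chi B B1 B2 u ux uxx ut v vx vxx vt).
Context (c M : R) (c0 : 0 < c) (M0 : 0 < M).
Context (Hc : forall x t, x \in `]a, b[ -> 2 <= t -> c <= v x t).
Context (HM : forall t, 2 <= t -> mass a b u t <= M /\
    mass a b v t <= M).

Let L0 : 0 < L. Proof. by rewrite subr_gt0. Qed.

Let beta t := integral_on t (t + 1) (fun s => I (B1^~ s)).
Local Notation Z := (mass a b u).

(** On [t, t + 1] the mass Z of u gains at most beta t, so that Z(s) is at least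
    Z(t + 1) - beta t there; insert this into Z' <= - c Z + int B1 and integrate. *)
Lemma mass_contraction t : 2 <= t -> (1 + c) * Z (t + 1) <= Z t + (1 + c) * beta t.
Proof.
move=> t2; have t0 : 0 < t by lra.
have tt1 : t < t + 1 by rewrite ltrDl.
have cut := cont_on_integral (q := t + 1) t0 (ns_contt (rs_u S)).
have cuv : cont_on `[t, t + 1] (fun s => I (fun x => u x s * v x s)).
  apply: (@cont_on_integral (fun x s => u x s * v x s)) => //.
  have c1 : cont_on ([set` `[a, b]] `*` [set s : R | 0 < s])
    (fun z : R * R => u z.1 z.2) := ns_cont (rs_u S).
  have c2 : cont_on ([set` `[a, b]] `*` [set s : R | 0 < s])
    (fun z : R * R => v z.1 z.2) := ns_cont (rs_v S).
  suff : cont_on ([set` `[a, b]] `*` [set s : R | 0 < s])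
    (fun z : R * R => u z.1 z.2 * v z.1 z.2) by [].
  by solve_cont.
have cB : cont_on `[t, t + 1] (fun s => I (B1^~ s)).
  apply: (@cont_on_eq _ _ _ (fun s => I (ut^~ s) + I (fun x => u x s * v x s))).
    move=> s; rewrite inE /= in_itv/= => /andP[ts _].
    by rewrite (mass_u_derivative ab S (lt_le_trans t0 ts)); ring.
  by solve_cont.
have dZ : C1_on t (t + 1) Z (fun s => I (ut^~ s)).
  split => //; first exact: (cont_on_integral (q := t + 1) t0 (ns_cont (rs_u S))).
  move=> s; rewrite in_itv/= => /andP[ts _]; apply: (derive_mass ab (rs_u S)).
  exact: lt_trans ts.
have B0 s : 0 < s -> 0 <= I (B1^~ s).
  move=> s0; rewrite -(mul0r L) -integral_on_cst ?(ltW ab)//.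
  apply: integral_on_le; [exact: cont_on_cst|exact: (rs_cB1 S)|] => x xab.
  by have /andP[] := rs_B1 S xab s0.
have uvZ s : t <= s -> c * Z s <= I (fun x => u x s * v x s).
  move=> ts; have s0 : 0 < s by exact: lt_le_trans ts.
  have [cu _ _ _] := ns_slice (rs_u S) s0; have [cv _ _ _] := ns_slice (rs_v S) s0.
  rewrite -integral_onZ//; apply: integral_on_le; [by solve_cont..|] => x xab.
  rewrite mulrC ler_wpM2l ?(ltW (rs_upos S (subset_itv_oo_cc xab) s0))//.
  by apply: Hc => //; exact: le_trans ts.
have Z0 s : 0 < s -> 0 <= Z s.
  by move=> s0; apply: integral_on_ge0 => x xab; rewrite ltW// (rs_upos S).
have h1 s : s \in `]t, (t + 1)[ -> Z (t + 1) - Z s <= beta t.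
  rewrite in_itv/= => /andP[ts st].
  have dZs : C1_on s (t + 1) Z (fun s => I (ut^~ s)).
    have [k1 k2 k3] := dZ; split.
    - exact: cont_on_itv_sub (ltW ts) (lexx _) k1.
    - exact: cont_on_itv_sub (ltW ts) (lexx _) k2.
    - move=> r; rewrite in_itv/= => /andP[sr rt]; apply: k3.
      by rewrite in_itv/= rt (lt_trans ts).
  rewrite -(FTC st dZs).
  apply: (@le_trans _ _ (integral_on s (t + 1) (fun s => I (B1^~ s)))).
    apply: integral_on_le.
    - exact: cont_on_itv_sub (ltW ts) (lexx _) cut.
    - exact: cont_on_itv_sub (ltW ts) (lexx _) cB.
    move=> r; rewrite in_itv/= => /andP[sr rt].
    have tr : t < r by exact: lt_trans sr.
    rewrite (mass_u_derivative ab S (lt_trans t0 tr)).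
    have := uvZ r (ltW tr); have := mulr_ge0 (ltW c0) (Z0 r (lt_trans t0 tr)); lra.
  apply: integral_sub => //; first exact: ltW.
  by move=> r; rewrite in_itv/= => /andP[tr _]; apply: B0; exact: lt_le_trans tr.
have h2 : Z (t + 1) - Z t <= - c * (Z (t + 1) - beta t) + beta t.
  rewrite -(FTC tt1 dZ).
  have -> : - c * (Z (t + 1) - beta t) + beta t =
    integral_on t (t + 1) (fun s => - c * (Z (t + 1) - beta t) + I (B1^~ s)).
    rewrite integral_onD//; last exact: cont_on_cst.
    by rewrite integral_on_cst ?(ltW tt1)// -/(beta t); congr (_ + _); ring.
  apply: integral_on_le => //; first by apply: cont_onD => //; exact: cont_on_cst.
  move=> s sab; have := h1 s sab; move: sab; rewrite in_itv/= => /andP[ts _] h.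
  rewrite (mass_u_derivative ab S (lt_trans t0 ts)) lerD2r.
  have := uvZ s (ltW ts).
  have : c * (Z (t + 1) - beta t) <= c * Z s by rewrite ler_wpM2l ?(ltW c0)//; lra.
  lra.
lra.
Qed.

Lemma u_bounded : exists2 U, 0 <= U & forall t x, 2 <= t -> x \in `[a, b] -> u x t <= U.
Proof.
have [G HG] := gradient_bounded ab S c0 M0 Hc HM.
exists (1 + (2 * (M / L) ^+ 2 + 2 * L) * (1 + `|G|)).
  apply: addr_ge0 => //; apply: mulr_ge0; last exact: addr_ge0.
  by rewrite addr_ge0// mulr_ge0// ?sqr_ge0// ltW.
move=> t x t2 xab; have := u_sqr_le ab S M0 HM t2 xab => h1.
have h2 : (2 * (M / L) ^+ 2 + 2 * L) * (1 + dirichlet a b ux t) <=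
    (2 * (M / L) ^+ 2 + 2 * L) * (1 + `|G|).
  apply: ler_wpM2l; first by rewrite addr_ge0// mulr_ge0// ?sqr_ge0// ltW.
  by rewrite lerD2l; apply: le_trans (HG t t2) (ler_norm _).
have h3 := le_trans h1 h2; set K := (X in _ <= X) in h3.
have := sqr_ge0 (u x t - 2^-1); rewrite -/K; lra.
Qed.

(** sup u^2 is bounded by int u^2 / L + 2 int |u u_x|. Young's inequality with the
    small weight d leaves d int u_x^2, which is small since the gradient is bounded,
    and a multiple of int u^2 <= U Z, which tends to 0. *)
Lemma u_vanishes : (forall e, 0 < e -> exists T, forall t, T <= t -> beta t <= e) ->
  forall e, 0 < e -> exists T, forall t x, T <= t -> x \in `[a, b] -> u x t <= e.
Proof.
move=> Hbeta e e0; have [G HG] := gradient_bounded ab S c0 M0 Hc HM.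
have [U U0 HU] := u_bounded.
have e20 : 0 < e ^+ 2 by rewrite exprn_gt0.
pose d := e ^+ 2 / (2 * (`|G| + 1)).
have G1 : 0 < `|G| + 1 by rewrite ltr_pwDr.
have d0 : 0 < d by rewrite divr_gt0// mulr_gt0.
pose k := U * (L^-1 + d^-1) + 1.
have k0 : 0 < k by rewrite ltr_pwDr// mulr_ge0// addr_ge0// invr_ge0 ltW.
have HZ t : 2 <= t -> Z t <= M by move=> /HM[].
have ek0 : 0 < e ^+ 2 / (2 * k) by rewrite divr_gt0// mulr_gt0.
have [T HT] := contraction_decay c0 HZ mass_contraction Hbeta ek0.
exists (Num.max 2 T) => t x; rewrite ge_max => /andP[t2 Tt] xab.
have t0 : 0 < t by lra.
have [cu cux _ _] := ns_slice (rs_u S) t0.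
have h1 := sup_sqr_le ab (ns_C1 (rs_u S) t0) xab.
have d1 : 0 < d^-1 by rewrite invr_gt0.
have := young_integral d1 cu cux; rewrite invrK -/(dirichlet a b ux t) => h2.
have h3 := integral_sqr_le t0 cu (fun x h => rs_upos S h t0)
  (fun x (h : x \in `[a, b]) => HU t x t2 h).
have h4 : (L^-1 + d^-1) * I (fun x => u x t ^+ 2) <= (L^-1 + d^-1) * (U * Z t).
  by rewrite ler_wpM2l// addr_ge0// invr_ge0 ltW.
have Z0 : 0 <= Z t by apply: integral_on_ge0 => y yab; rewrite ltW// (rs_upos S).
have h5 : (L^-1 + d^-1) * (U * Z t) <= e ^+ 2 / 2.
  have : k * Z t <= k * (e ^+ 2 / (2 * k)) by rewrite ler_wpM2l ?(ltW k0)// HT.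
  have -> : k * (e ^+ 2 / (2 * k)) = e ^+ 2 / 2 by field; rewrite gt_eqF.
  by rewrite /k; lra.
have h6 : d * dirichlet a b ux t <= e ^+ 2 / 2.
  apply: (@le_trans _ _ (d * (`|G| + 1))).
    rewrite ler_wpM2l ?(ltW d0)//; apply: le_trans (HG t t2) _.
    by apply: le_trans (ler_norm _) _; rewrite lerDl.
  by rewrite /d le_eqVlt; apply/orP; left; apply/eqP; field; rewrite gt_eqF.
have : u x t ^+ 2 <= e ^+ 2 by lra.
by rewrite ler_pXn2r// nnegrE ltW// (rs_upos S).
Qed.

End Decay.

(** * Classical solutions *)
Section Classical.
Context {R : realType} {a b : R} (ab : a < b).
Implicit Types (x t : R).
Local Notation I := (integral_on a b).
Local Notation cont := (cont_on `[a, b]).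
Context (chi r M1 M2 : R) (B1 B2 : R -> R -> R) (u0 v0 : R -> R) (u v : R -> R -> R).
Context (sol : is_classical_solution a b chi r B1 B2 u0 v0 u v).
Context (B1_ge0 : forall x t, x \in `[a, b] -> 0 <= t -> 0 <= B1 x t)
        (B2_ge0 : forall x t, x \in `[a, b] -> 0 <= t -> 0 <= B2 x t)
        (B1_le : forall x t, x \in `[a, b] -> 0 <= t -> B1 x t <= M1)
        (B2_le : forall x t, x \in `[a, b] -> 0 <= t -> B2 x t <= M2).

Local Notation ux := (dx a b u).
Local Notation uxx := (dxx a b u).
Local Notation ut := (dt u).
Local Notation vx := (dx a b v).
Local Notation vxx := (dxx a b v).
Local Notation vt := (dt v).

(** The source terms, recovered from the equations: on the open interval these
    are B1 and B2, and they are continuous up to the boundary. *)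
Definition source_u x t : R := ut x t - uxx x t
  + chi * (ux x t * vx x t * (v x t)^-1 + u x t * vxx x t * (v x t)^-1
           - u x t * vx x t ^+ 2 * (v x t)^-1 ^+ 2) + u x t * v x t.
Definition source_v x t : R := vt x t - vxx x t - u x t * v x t + v x t.

Let su : neumann_smooth a b u ux uxx ut.
Proof.
apply: C21_neumann_smooth; first exact: sol_u_C21 sol.
by move=> x t xab t0; have [] := sol_neumann sol xab t0.
Qed.

Let sv : neumann_smooth a b v vx vxx vt.
Proof.
apply: C21_neumann_smooth; first exact: sol_v_C21 sol.
by move=> x t xab t0; have [] := sol_neumann sol xab t0.
Qed.

Lemma source_uE x t : x \in `]a, b[ -> 0 < t -> source_u x t = B1 x t.
Proof.
move=> xab t0; rewrite /source_u (sol_u_eq sol xab t0).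
have [_ v0'] := sol_pos sol (subset_itv_oo_cc xab) t0.
have vn0 : v x t != 0 by rewrite gt_eqF.
have E : dx a b (fun y s => u y s / v y s * vx y s) x t =
   ux x t * vx x t * (v x t)^-1 + u x t * vxx x t * (v x t)^-1
     - u x t * vx x t ^+ 2 * (v x t)^-1 ^+ 2.
  apply: (derive_onE xab).
  have := derM (derM (ns_derx su xab t0) (derV (f := v^~ t) vn0 (ns_derx sv xab t0)))
    (ns_derxx sv xab t0).
  by congr is_derive; field.
rewrite E; ring.
Qed.

Lemma source_vE x t : x \in `]a, b[ -> 0 < t -> source_v x t = B2 x t.
Proof. by move=> xab t0; rewrite /source_v (sol_v_eq sol xab t0); ring. Qed.

Lemma classical_regular : regular_solution a b chi
  (Num.max M1 M2) source_u source_v u ux uxx ut v vx vxx vt.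
Proof.
split => //.
- by move=> x t xab t0; have [] := sol_pos sol xab t0.
- by move=> x t xab t0; have [] := sol_pos sol xab t0.
- move=> t t0; have [? ? ? ?] := ns_slice su t0; have [? ? ? ?] := ns_slice sv t0.
  have cvi : cont (fun x => (v x t)^-1).
    by apply: cont_onV => // x xab; have [_ h] := sol_pos sol xab t0; rewrite gt_eqF.
  suff : cont (fun x => ut x t - uxx x t
    + chi * (ux x t * vx x t * (v x t)^-1 + u x t * vxx x t * (v x t)^-1
           - u x t * vx x t ^+ 2 * (v x t)^-1 ^+ 2) + u x t * v x t) by [].
  by solve_cont.
- move=> t t0; have [? ? ? ?] := ns_slice su t0; have [? ? ? ?] := ns_slice sv t0.
  suff : cont (fun x => vt x t - vxx x t - u x t * v x t + v x t) by [].
  by solve_cont.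
- move=> x t xab /[dup] t0 /ltW t0'; have xab' := subset_itv_oo_cc xab.
  by rewrite source_uE// B1_ge0//= le_max B1_le.
- move=> x t xab /[dup] t0 /ltW t0'; have xab' := subset_itv_oo_cc xab.
  by rewrite source_vE// B2_ge0//= le_max B2_le// orbT.
- by move=> x t xab t0; rewrite /source_u; ring.
- by move=> x t xab t0; rewrite /source_v; ring.
Qed.

Lemma integral_source_u t : 0 < t ->
  \int[lebesgue_measure]_(x in [set` `]a, b[]) B1 x t = I (source_u^~ t).
Proof.
move=> t0; rewrite -integral_oo; last exact: (rs_cB1 classical_regular).
by apply: eq_Rintegral => x; rewrite inE => xab; rewrite source_uE.
Qed.

Lemma integral_source_v t : 0 < t ->
  \int[lebesgue_measure]_(x in [set` `]a, b[]) B2 x t = I (source_v^~ t).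
Proof.
move=> t0; rewrite -integral_oo; last exact: (rs_cB2 classical_regular).
by apply: eq_Rintegral => x; rewrite inE => xab; rewrite source_vE.
Qed.

Lemma cont_on_rectangle (w : R -> R -> R) (D : set (R * R)) p q : p <= q ->
  [set` `[a, b]] `*` [set` `[p, q]] `<=` D -> continuous_in D w ->
  exists z1 z2 : R * R, [/\ z1.1 \in `[a, b] /\ z1.2 \in `[p, q],
    z2.1 \in `[a, b] /\ z2.2 \in `[p, q] &
    forall x t, x \in `[a, b] -> t \in `[p, q] ->
      w z1.1 z1.2 <= w x t <= w z2.1 z2.2].
Proof.
move=> pq KD /(continuous_subspaceW KD) cw.
have K0 : [set` `[a, b]] `*` [set` `[p, q]] !=set0.
  by exists (a, p); split; rewrite /= bound_itvE// ltW.
have cK : compact ([set` `[a, b]] `*` [set` `[p, q]]).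
  by apply: compact_setX; exact: segment_compact.
have [z1 + H1] := compact_EVT_min K0 cK cw.
have [z2 + H2] := compact_EVT_max K0 cK cw.
rewrite !inE => -[z2a z2p] [z1a z1p]; exists z1, z2; split => // x t xab tpq.
have Kxt : (x, t) \in [set` `[a, b]] `*` [set` `[p, q]] by rewrite inE.
by rewrite (H1 _ Kxt) (H2 _ Kxt).
Qed.

Context (v0_cont : cont v0) (v0_gt0 : forall x, x \in `[a, b] -> 0 < v0 x).
Context (r_gt1 : 1 < r).

(** Before some time d the function v stays close to v0; on [p, 2] with 0 < p < d it
    is continuous and positive on a compact set. *)
Lemma bounds_before_2 : exists2 C, 0 < C & forall x t, x \in `]a, b[ -> 0 < t -> t <= 2 ->
  u x t <= C /\ C^-1 <= v x t <= C.
Proof.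
have [xm xmab Hm] := EVT_min (ltW ab) v0_cont.
have [xM xMab HM] := EVT_max (ltW ab) v0_cont.
have m0 : 0 < v0 xm by exact: v0_gt0.
have m20 : 0 < v0 xm / 2 by rewrite divr_gt0.
have cv t : 0 < t -> cont (v^~ t) by move=> /(ns_slice sv)[].
have v00 : {in `]a, b[, v^~ 0 =1 v0} by move=> x xab; have [] := sol_init sol xab.
have [d d0 Hd] := initial_trace ab r_gt1 (sol_v_cont sol) cv v0_cont v00 m20.
pose p := Num.min (d / 2) 1.
have p0 : 0 < p by rewrite lt_min divr_gt0//= ltr01.
have pd : p < d by rewrite gt_min; apply/orP; left; lra.
have p2 : p <= 2 by rewrite ge_min; apply/orP; right; lra.
have Ku : [set` `[a, b]] `*` [set` `[(0 : R), 2]] `<=`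
    [set` `[a, b]] `*` [set` `[(0 : R), +oo[].
  by move=> [x t] /= [xab]; rewrite !in_itv/= => /andP[-> _].
have Kv : [set` `[a, b]] `*` [set` `[p, 2]] `<=` [set` `[a, b]] `*` [set t | 0 < t].
  move=> [x t] /= [xab]; rewrite in_itv/= => /andP[pt _]; split => //=.
  exact: lt_le_trans pt.
have [z1 [z2 [_ _ Hu]]] := cont_on_rectangle (ler0n _ 2) Ku (sol_u_cont sol).
have [w1 [w2 [[w1a w1p] _ Hv]]] := cont_on_rectangle p2 Kv (ns_cont sv).
have w10 : 0 < v w1.1 w1.2.
  have w12 : 0 < w1.2.
    by move: w1p; rewrite in_itv/= => /andP[h _]; exact: lt_le_trans h.
  by have [] := sol_pos sol w1a w12.
pose m := Num.min (v0 xm / 2) (v w1.1 w1.2).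
have mpos : 0 < m by rewrite lt_min m20.
pose N := `|u z2.1 z2.2| + v0 xM + `|v w2.1 w2.2| + v0 xm + m^-1.
have M0 : 0 < v0 xM by exact: v0_gt0.
have mi : 0 < m^-1 by rewrite invr_gt0.
have n1 := normr_ge0 (u z2.1 z2.2); have n2 := normr_ge0 (v w2.1 w2.2).
have N0 : 0 < N by rewrite /N; lra.
exists N => // x t xab t0 t2; have xab' := subset_itv_oo_cc xab.
have Nm : N^-1 <= m.
  by rewrite -[leRHS]invrK lef_pV2 ?posrE// /N; lra.
split.
  have /andP[_ h] : u z1.1 z1.2 <= u x t <= u z2.1 z2.2.
    by apply: Hu => //; rewrite in_itv/= t2 ltW.
  have := ler_norm (u z2.1 z2.2); rewrite /N; lra.
have [td|dt] := ltP t d.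
  have := Hd t x t0 td xab; have := Hm x xab'; have := HM x xab'.
  rewrite ler_norml => h1 h2 /andP[h3 h4]; apply/andP; split.
    apply: le_trans Nm _; apply: (@le_trans _ _ (v0 xm / 2)); first by rewrite ge_min lexx.
    lra.
  by rewrite /N; lra.
have /andP[h1 h2] : v w1.1 w1.2 <= v x t <= v w2.1 w2.2.
  by apply: Hv => //; rewrite in_itv/= t2 andbT (le_trans (ltW pd)).
apply/andP; split.
  by apply: le_trans Nm (le_trans _ h1); rewrite ge_min lexx orbT.
have := ler_norm (v w2.1 w2.2); rewrite /N; lra.
Qed.

End Classical.

Arguments source_u {R} a b chi u v x t.

Lemma LpNorm_oo_le (R : realType) (D : set R) (f : R -> R) (e : R) : 0 <= e ->
  (forall x, D x -> `|f x| <= e) -> (LpNorm D +oo%E f <= e%:E)%E.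
Proof.
move=> e0 H; rewrite /LpNorm unlock; case: ifPn => // _.
apply/ess_supP; apply: nearW => x /=; rewrite lee_fin patchE.
by case: ifPn => [/set_mem/H//|_]; rewrite normr0.
Qed.

Theorem theorem1p2 (R : realType) (a b chi theta r : R)
    (B1 B2 : R -> R -> R) (u0 v0 : R -> R) (u v : R -> R -> R)
    (ab : a < b) (chi_gt0 : 0 < chi)
    (theta01 : 0 < theta < 1)
    (B1_ge0 : forall x t, x \in `[a, b] -> 0 <= t -> 0 <= B1 x t)
    (B2_ge0 : forall x t, x \in `[a, b] -> 0 <= t -> 0 <= B2 x t)
    (B1_bounded : exists M : R,
       forall x t, x \in `[a, b] -> 0 <= t -> B1 x t <= M)
    (B2_bounded : exists M : R,
       forall x t, x \in `[a, b] -> 0 <= t -> B2 x t <= M)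
    (B1_holder : holder_loc theta ([set` `[a, b]] `*` [set` `[0, +oo[]) B1)
    (B2_holder : holder_loc theta ([set` `[a, b]] `*` [set` `[0, +oo[]) B2)
    (u0_cont : {within [set` `[a, b]], continuous u0})
    (u0_ge0 : forall x, x \in `]a, b[ -> 0 <= u0 x)
    (* v0 is the continuous representative, so v0 > 0 makes sense on [a, b] *)
    (v0_cont : {within [set` `[a, b]], continuous v0})
    (v0_W1 : W1 [set` `]a, b[] +oo%E v0)
    (v0_gt0 : forall x, x \in `[a, b] -> 0 < v0 x)
    (r_gt1 : 1 < r)
    (uv_sol : is_classical_solution a b chi r B1 B2 u0 v0 u v) :
  0 < inf [set \int[lebesgue_measure]_(x in [set` `]a, b[]) B2 x t
          | t in [set` `]0, +oo[]] ->
  (exists2 C : R, 0 < C &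
     forall x t, x \in `]a, b[ -> 0 < t ->
       u x t <= C /\ C^-1 <= v x t <= C) /\
  ((\int[lebesgue_measure]_(s in [set` `[t, (t + 1)]])
       \int[lebesgue_measure]_(x in [set` `]a, b[]) B1 x s)
     @[t --> +oo] --> 0 ->
   LpNorm [set` `]a, b[] +oo%E (u^~ t) @[t --> +oo] --> 0%E).
Proof.
move=> infB2; have [M1 HM1] := B1_bounded; have [M2 HM2] := B2_bounded.
have S := classical_regular uv_sol B1_ge0 B2_ge0 HM1 HM2.
have [c c0 Hc] : exists2 c, 0 < c & forall x t, x \in `]a, b[ -> 2 <= t -> c <= v x t.
  apply: (v_lower ab S infB2) => t t0.
  rewrite -(integral_source_v uv_sol B1_ge0 B2_ge0 HM1 HM2 t0).
  apply: ge_inf; last by exists t => //=; rewrite in_itv/= t0.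
  exists 0 => y [s /=]; rewrite in_itv/= andbT => s0 <-.
  by apply: Rintegral_ge0 => x /subset_itv_oo_cc xab; apply: B2_ge0 => //; exact: ltW.
have [M M0 HM] := mass_upper ab S c0 Hc.
split.
  have [C1 C10 HC1] := bounds_before_2 ab uv_sol v0_cont v0_gt0 r_gt1.
  have [U U0 HU] := u_bounded ab S c0 M0 Hc HM.
  have [V V0 HV] := v_upper ab S c0 M0 Hc HM.
  have ci : 0 < c^-1 by rewrite invr_gt0.
  pose C := C1 + U + V + c^-1; have C0 : 0 < C by rewrite /C; lra.
  exists C => // x t xab t0; have [t2|/ltW t2] := leP t 2.
    have [h1 /andP[h2 h3]] := HC1 x t xab t0 t2.
    have h4 : C^-1 <= C1^-1 by rewrite lef_pV2 ?posrE// /C; lra.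
    split; first by rewrite /C; lra.
    by rewrite (le_trans h4 h2)/= /C; lra.
  have xab' := subset_itv_oo_cc xab; have [_ hv] := HV t t2.
  have h1 := HU t x t2 xab'; have h2 := hv x xab'.
  have h3 : C^-1 <= c by rewrite -[leRHS]invrK lef_pV2 ?posrE// /C; lra.
  split; first by rewrite /C; lra.
  by rewrite (le_trans h3 (Hc x t xab t2))/= /C; lra.
move=> HB1.
have Hbeta e : 0 < e -> exists T, forall t, T <= t ->
    integral_on t (t + 1) (fun s => integral_on a b
      (source_u a b chi u v ^~ s)) <= e.
  move=> e0; move/cvgrPdist_le: HB1 => /(_ e e0) [T [_ HT]].
  exists (Num.max (T + 1) 1) => t; rewrite ge_max => /andP[Tt t1].
  have t0 : 0 < t by lra.
  have := HT t; rewrite sub0r normrN => /(_ ltac:(lra)).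
  apply: le_trans; apply: le_trans (ler_norm _).
  rewrite le_eqVlt; apply/orP; left; apply/eqP; apply: eq_Rintegral => s.
  rewrite inE /= in_itv/= => /andP[ts _].
  rewrite (integral_source_u uv_sol B1_ge0 B2_ge0 HM1 HM2)//.
  exact: lt_le_trans ts.
have Hu := u_vanishes ab S c0 M0 Hc HM Hbeta.
move=> U [d /= d0 HU].
have d20 : 0 < d / 2 by rewrite divr_gt0.
have [T HT] := Hu _ d20.
exists (Num.max T 1); split; first exact: num_real.
move=> t; rewrite gt_max => /andP[Tt t1] /=.
have t0 : 0 < t by lra.
have le : (LpNorm [set` `]a, b[] +oo (u^~ t) <= (d / 2)%:E)%E.
  apply: LpNorm_oo_le; first exact: ltW.
  move=> x xab; have xab' := subset_itv_oo_cc xab.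
  have [u_gt0 _] := sol_pos uv_sol xab' t0.
  by rewrite gtr0_norm// HT// ltW.
have ge : (0 <= LpNorm [set` `]a, b[] +oo (u^~ t))%E by exact: Lnorm_ge0.
case: (LpNorm _ _ _) le ge => [y| |] //; rewrite !lee_fin => le ge.
apply: HU; rewrite /= sub0r normrN ger0_norm//; lra.
Qed.
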